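(* Let $\mathcal{E}$ and $\mathcal{E}_k$ ($k\ge1$) be complex separable Hilbert spaces, let $J_k$ be the truncated shift of index $k$ on $\mathbb{E}_k=\mathcal{E}_k\otimes\mathbb{C}^k$, and let $\mathcal{M}$ be a closed subspace of $H^2_{\mathcal{E}}(\mathbb{D})\oplus\big(\bigoplus_{k=1}^\infty\mathbb{E}_k\big)$. Then $\mathcal{M}$ is hyperinvariant for the pure power partial isometry $M_z^{\mathcal{E}}\oplus\big(\bigoplus_{k=1}^\infty J_k\big)$ if and only if either $$\mathcal{M}=\{0\}\oplus\bigoplus_{k=1}^\infty\mathcal{N}(J_k^{n_k})\quad\text{or}\quad \mathcal{M}=uH^2_{\mathcal{E}}(\mathbb{D})\oplus\bigoplus_{k=1}^\infty\mathcal{N}(J_k^{n_k})$$ for some $n_k\in\{0,1,2,\ldots,k\}$ ($k\ge1$) such that $n_k\le n_{k+1}\le n_k+1$ for all $k\geq 1$, and (in the second form) a scalar-valued inner function $u$ such that $u\in z^{k-n_k}H^2(\mathbb{D})$ for all $k\ge1$.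
   Context: $\mathcal{N}(\cdot)$ denotes kernel. $H^2_{\mathcal{E}}(\mathbb{D})$ is the $\mathcal{E}$-valued Hardy space on the open unit disc, $H^2(\mathbb{D})$ the scalar Hardy space, and $M_z^{\mathcal{E}}$ is multiplication by $z$ on $H^2_{\mathcal{E}}(\mathbb{D})$. A scalar-valued inner function is $u\in H^\infty$ with $|u(e^{it})|=1$ a.e. on the unit circle. The truncated shift of index $k$ on $\mathcal{E}_k\otimes\mathbb{C}^k$ (the direct sum of $k$ copies of $\mathcal{E}_k$) is $J_1=0$ and, for $k\ge2$, $J_k(x_1,\ldots,x_k)=(0,x_1,\ldots,x_{k-1})$; $J_k^0=I$. A closed subspace is hyperinvariant for $T$ if it is invariant under every bounded operator commuting with $T$. A power partial isometry is an operator all of whose positive powers are partial isometries; a contraction $T$ is pure if $T^{*m}\to0$ strongly as $m\to\infty$. *)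

(* Defs.v *)
From HB Require Import structures.
From mathcomp Require Import all_boot all_order all_algebra.
From mathcomp Require Import complex zify ring lra.
From mathcomp Require Import all_classical all_reals all_analysis.

Set Implicit Arguments.
Unset Strict Implicit.
Unset Printing Implicit Defensive.

Import Order.TTheory GRing.Theory Num.Theory.
Import numFieldNormedType.Exports.

Local Open Scope classical_set_scope.
Local Open Scope complex_scope.
Local Open Scope ring_scope.

(** * Complex Hilbert spaces *)

HB.mixin Record NormedModule_hasInner (R : realType) E & NormedModule R[i] E := {
  inner : {dot E for Num.conj};
  norm_inner : forall x : E, `|x| ^+ 2 = inner x x
}.

#[short(type="hilbertType")]
HB.structure Definition Hilbert (R : realType) :=
  {E of NormedModule_hasInner R E & CompleteNormedModule R[i] E}.

Definition separable_space (T : topologicalType) :=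
  exists A : set T, countable A /\ dense A.

(** * Norms as real numbers *)

(* The norm of a [normedModType R[i]] takes its values in [R[i]]. *)
Definition rnorm (R : realType) (V : normedModType R[i]) (x : V) : R :=
  complex.Re `|x|.

Section rnorm.
Variables (R : realType) (V : normedModType R[i]).
Implicit Types x y : V.

Lemma rnormE x : `|x| = (rnorm x)%:C.
Proof. by rewrite /rnorm complexRe; rewrite (Creal_ReP _ _) ?normr_real. Qed.

Lemma rnorm_ge0 x : 0 <= rnorm x.
Proof. by rewrite -lecR -rnormE normr_ge0. Qed.

Lemma rnorm0 : rnorm (0 : V) = 0.
Proof. by rewrite /rnorm normr0. Qed.

Lemma rnorm_eq0 x : rnorm x = 0 -> x = 0.
Proof. by move=> x0; apply/normr0_eq0; rewrite rnormE x0. Qed.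

Lemma rnormD x y : rnorm (x + y) <= rnorm x + rnorm y.
Proof. by rewrite -lecR rmorphD/= -!rnormE ler_normD. Qed.

Lemma rnormZ (a : R[i]) x : rnorm (a *: x) = complex.Re `|a| * rnorm x.
Proof.
apply: complexI; rewrite -rnormE normrZ rmorphM/= -rnormE; congr (_ * _).
Qed.

Lemma rnormN x : rnorm (- x) = rnorm x.
Proof. by rewrite /rnorm normrN. Qed.

End rnorm.

Lemma le_rnorm (R : realType) (V W : normedModType R[i]) (x : V) (y : W) :
  (rnorm x <= rnorm y) = (`|x| <= `|y|).
Proof. by rewrite (rnormE x) (rnormE y) lecR. Qed.


(** * Hilbert direct sums *)

Section hsum.
Variables (R : realType) (I : choiceType) (V : I -> normedModType R[i]).

(* The l^2 direct sum, normed by (\sum_i `|x_i|^2)^(1/2); for Hilbert spaces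
   [V i] this is the Hilbert space direct sum. *)
Definition sqsum (x : forall i, V i) : \bar R :=
  \esum_(i in [set: I]) (rnorm (x i) ^+ 2)%:E.

Record hsum := Hsum {
  hsum_fun :> forall i, V i;
  hsumP : (sqsum hsum_fun < +oo)%E
}.

HB.instance Definition _ := gen_eqMixin hsum.
HB.instance Definition _ := gen_choiceMixin hsum.

Lemma hsum_ext (x y : hsum) : (forall i, x i = y i) -> x = y.
Proof.
case: x y => [x hx] [y hy]/= xy.
have {}xy : x = y by exact: functional_extensionality_dep.
by subst y; congr Hsum; exact: Prop_irrelevance.
Qed.

Lemma sqsum_ge0 x : (0 <= sqsum x)%E.
Proof. by apply: esum_ge0 => i _; rewrite lee_fin sqr_ge0. Qed.

Lemma esum_scale_le (c : R) (a : I -> R) : 0 <= c -> (forall i, 0 <= a i) ->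
  (\esum_(i in [set: I]) (c * a i)%:E <= c%:E * \esum_(i in [set: I]) (a i)%:E)%E.
Proof.
move=> c0 a0; apply: ge_ereal_sup => _ [X [finX _] <-].
under eq_fsbigr do rewrite EFinM.
rewrite -ge0_mule_fsumr//.
apply: lee_wpmul2l; first by rewrite lee_fin.
by apply: ereal_sup_ubound; exists X.
Qed.

Lemma sqsumZ (a : R[i]) x :
  (sqsum (fun i => (a *: x i)%R) <= ((complex.Re `|a|) ^+ 2)%:E * sqsum x)%E.
Proof.
rewrite /sqsum; under eq_esum do rewrite rnormZ exprMn.
by apply: esum_scale_le => [|i]; exact: sqr_ge0.
Qed.

Lemma sqsumD_le (s t : R) x y : 0 < s -> 0 < t ->
  (sqsum (fun i => (x i + y i)%R) <=
   ((s + t) / s)%:E * sqsum x + ((s + t) / t)%:E * sqsum y)%E.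
Proof.
move=> s0 t0.
have st c : 0 < c -> 0 <= (s + t) / c.
  by move=> c0; rewrite divr_ge0// ltW// addr_gt0.
apply: (@le_trans _ _ (\esum_(i in [set: I])
    (((s + t) / s * rnorm (x i) ^+ 2)%:E + ((s + t) / t * rnorm (y i) ^+ 2)%:E))%E).
  apply: le_esum => i _; rewrite -EFinD lee_fin.
  have le1 : rnorm (x i + y i) ^+ 2 <= (rnorm (x i) + rnorm (y i)) ^+ 2.
    by rewrite lerXn2r ?nnegrE ?addr_ge0 ?rnorm_ge0 ?rnormD.
  apply: (le_trans le1); rewrite -subr_ge0.
  set u := rnorm _; set v := rnorm _.
  have -> : (s + t) / s * u ^+ 2 + (s + t) / t * v ^+ 2 - (u + v) ^+ 2
      = (t * u - s * v) ^+ 2 / (s * t).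
    by field; rewrite !gt_eqF.
  by rewrite divr_ge0 ?sqr_ge0// mulr_ge0// ltW.
rewrite esumD; last 2 first.
- by move=> i _; rewrite lee_fin mulr_ge0 ?sqr_ge0// st.
- by move=> i _; rewrite lee_fin mulr_ge0 ?sqr_ge0// st.
by apply: leeD; apply: esum_scale_le => [|i]; rewrite ?sqr_ge0 ?st.
Qed.

Lemma hsum0P : (sqsum (fun i => (0 : V i)%R) < +oo)%E.
Proof. by rewrite /sqsum esum1 ?ltry// => i _; rewrite rnorm0 expr0n. Qed.

Lemma hsumZP (a : R[i]) (x : hsum) : (sqsum (fun i => (a *: x i)%R) < +oo)%E.
Proof.
apply: le_lt_trans (sqsumZ a x) _; apply: lte_mul_pinfty (hsumP x) => //.
by rewrite lee_fin sqr_ge0.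
Qed.

Lemma hsumNP (x : hsum) : (sqsum (fun i => (- x i)%R) < +oo)%E.
Proof.
by rewrite /sqsum; under eq_esum do rewrite rnormN; exact: hsumP x.
Qed.

Lemma hsumDP (x y : hsum) : (sqsum (fun i => (x i + y i)%R) < +oo)%E.
Proof.
apply: le_lt_trans (sqsumD_le x y ltr01 ltr01) _.
by apply: lte_add_pinfty; apply: lte_mul_pinfty (hsumP _) => //;
  rewrite lee_fin divr_ge0.
Qed.

Definition hsum0 := Hsum hsum0P.
Definition hsumZ a x := Hsum (hsumZP a x).
Definition hsumN x := Hsum (hsumNP x).
Definition hsumD x y := Hsum (hsumDP x y).

Let hsumDA : associative hsumD.
Proof. by move=> x y z; apply: hsum_ext => i /=; rewrite addrA. Qed.
Let hsumDC : commutative hsumD.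
Proof. by move=> x y; apply: hsum_ext => i /=; rewrite addrC. Qed.
Let hsum0D : left_id hsum0 hsumD.
Proof. by move=> x; apply: hsum_ext => i /=; rewrite add0r. Qed.
Let hsumND : left_inverse hsum0 hsumN hsumD.
Proof. by move=> x; apply: hsum_ext => i /=; rewrite addNr. Qed.

HB.instance Definition _ :=
  GRing.isZmodule.Build hsum hsumDA hsumDC hsum0D hsumND.

Let hsumZA a b x : hsumZ a (hsumZ b x) = hsumZ (a * b) x.
Proof. by apply: hsum_ext => i /=; rewrite scalerA. Qed.
Let hsum1Z : left_id 1 hsumZ.
Proof. by move=> x; apply: hsum_ext => i /=; rewrite scale1r. Qed.
Let hsumZDr : right_distributive hsumZ +%R.
Proof. by move=> a x y; apply: hsum_ext => i /=; rewrite scalerDr. Qed.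
Let hsumZDl x : {morph hsumZ^~ x : a b / a + b}.
Proof. by move=> a b; apply: hsum_ext => i /=; rewrite scalerDl. Qed.

HB.instance Definition _ :=
  GRing.Zmodule_isLmodule.Build R[i] hsum hsumZA hsum1Z hsumZDr hsumZDl.

Definition hnorm (x : hsum) : R := Num.sqrt (fine (sqsum x)).

Lemma hnorm_ge0 x : 0 <= hnorm x.
Proof. exact: sqrtr_ge0. Qed.

Lemma hnormE (x : hsum) : sqsum x = (hnorm x ^+ 2)%:E.
Proof.
rewrite /hnorm sqr_sqrtr ?fine_ge0 ?sqsum_ge0// fineK//.
by rewrite ge0_fin_numE ?sqsum_ge0 ?hsumP.
Qed.

Lemma hnorm_le (x : hsum) (c : R) :
  0 <= c -> (sqsum x <= (c ^+ 2)%:E)%E -> hnorm x <= c.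
Proof.
by move=> c0; rewrite hnormE lee_fin ler_pXn2r// nnegrE ?hnorm_ge0.
Qed.

Lemma rnorm_le_hnorm (x : hsum) i : rnorm (x i) <= hnorm x.
Proof.
have : (sqsum x >= (rnorm (x i) ^+ 2)%:E)%E.
  apply: esum_ge; exists [set i]; first by split => //; exact: finite_set1.
  by rewrite fsbig_set1.
by rewrite hnormE lee_fin ler_pXn2r// nnegrE ?hnorm_ge0 ?rnorm_ge0.
Qed.

Lemma hnorm0_eq0 (x : hsum) : hnorm x = 0 -> x = 0.
Proof.
move=> x0; apply: hsum_ext => i; apply: rnorm_eq0.
by apply/eqP; rewrite eq_le rnorm_ge0 -x0 rnorm_le_hnorm.
Qed.

Lemma hnormD (x y : hsum) : hnorm (x + y) <= hnorm x + hnorm y.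
Proof.
have [x0|x0] := eqVneq (hnorm x) 0.
  by rewrite x0 (hnorm0_eq0 x0) !add0r.
have [y0|y0] := eqVneq (hnorm y) 0.
  by rewrite y0 (hnorm0_eq0 y0) !addr0.
have {}x0 : 0 < hnorm x by rewrite lt_def x0 hnorm_ge0.
have {}y0 : 0 < hnorm y by rewrite lt_def y0 hnorm_ge0.
apply: hnorm_le; first by rewrite addr_ge0 ?hnorm_ge0.
apply: le_trans (sqsumD_le x y x0 y0) _.
rewrite !hnormE -!EFinM -EFinD lee_fin le_eqVlt; apply/orP; left; apply/eqP.
by field; rewrite !gt_eqF.
Qed.

Lemma hnormZ_le (a : R[i]) (x : hsum) :
  hnorm (a *: x) <= complex.Re `|a| * hnorm x.
Proof.
apply: hnorm_le.
  by apply: mulr_ge0; [exact: (@rnorm_ge0 R R[i]^o a)|exact: hnorm_ge0].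
by apply: le_trans (sqsumZ a x) _; rewrite hnormE -EFinM exprMn.
Qed.

Let norm_hsum (x : hsum) : R[i] := (hnorm x)%:C.

Let ler_norm_hsumD x y : norm_hsum (x + y) <= norm_hsum x + norm_hsum y.
Proof. by rewrite -rmorphD/= lecR hnormD. Qed.

Let norm_hsumZ (a : R[i]) x : norm_hsum (a *: x) = `|a| * norm_hsum x.
Proof.
have nE (b : R[i]) : (complex.Re `|b|)%:C = `|b| by rewrite -(@rnormE R R[i]^o).
rewrite -nE -rmorphM; congr (_%:C).
apply/eqP; rewrite eq_le hnormZ_le andTb.
have [->|a0] := eqVneq a 0; first by rewrite normr0 mul0r hnorm_ge0.
have ap : 0 < complex.Re `|a| by rewrite -ltcR nE normr_gt0.
rewrite mulrC -ler_pdivlMr//.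
apply: le_trans (_ : hnorm (a^-1 *: (a *: x)) <= _).
  by rewrite scalerA mulVf// scale1r.
apply: le_trans (hnormZ_le _ _) _; rewrite mulrC ler_wpM2l ?hnorm_ge0//.
by rewrite -lecR fmorphV !nE normfV.
Qed.

Let norm_hsum0_eq0 x : norm_hsum x = 0 -> x = 0.
Proof. by move/complexI/hnorm0_eq0. Qed.

HB.instance Definition _ :=
  Lmodule_isNormed.Build R[i] hsum ler_norm_hsumD norm_hsumZ norm_hsum0_eq0.

Lemma hsum_normE (x : hsum) : `|x| = (hnorm x)%:C.
Proof. by []. Qed.

End hsum.

(** * Linear contractions *)

Record lin_contraction (R : realType) (V : normedModType R[i]) := Contraction {
  contraction_fun :> V -> V;
  contraction_linear : linear contraction_fun;
  contraction_le : forall x, `|contraction_fun x| <= `|x|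
}.

Section hsum_map.
Variables (R : realType) (I : choiceType) (V : I -> normedModType R[i]).
Variable T : forall i, lin_contraction (V i).

Lemma sqsum_map (x : hsum V) : (sqsum (fun i => T i (x i)) <= sqsum x)%E.
Proof.
apply: le_esum => i _; rewrite lee_fin ler_pXn2r ?nnegrE ?rnorm_ge0//.
by rewrite le_rnorm contraction_le.
Qed.

Definition hsum_map_fun (x : hsum V) : hsum V :=
  Hsum (le_lt_trans (sqsum_map x) (hsumP x)).

Lemma hsum_map_linear : linear hsum_map_fun.
Proof. by move=> a x y; apply: hsum_ext => i /=; rewrite contraction_linear. Qed.

Lemma hsum_map_le x : `|hsum_map_fun x| <= `|x|.
Proof.
rewrite !hsum_normE lecR hnorm_le ?hnorm_ge0// -hnormE; exact: sqsum_map.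
Qed.

Definition hsum_map : lin_contraction (hsum V) :=
  Contraction hsum_map_linear hsum_map_le.

End hsum_map.

(** * Shifts *)

Lemma le_esum_pshift (R : realType) (I : choiceType) (f : I -> \bar R)
    (p : I -> option I) : (forall i, (0 <= f i)%E) ->
    (forall i j k, p i = Some k -> p j = Some k -> i = j) ->
  (\esum_(i in [set: I]) oapp f 0 (p i) <= \esum_(i in [set: I]) f i)%E.
Proof.
move=> f0 pinj; pose D := [set i | p i]; pose e i := odflt i (p i).
have -> : \esum_(i in [set: I]) oapp f 0%E (p i) = \esum_(i in D) f (e i).
  rewrite [RHS]esum_mkcond; apply: eq_esum => i _; rewrite /e.
  case: ifPn; by rewrite ?(inE, notin_setE) /D/=; case: (p i).
rewrite -(esum_image D e f); last first.
  move=> i j; rewrite !inE /D/= /e.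
  case pi : (p i) => [k|//]; case pj : (p j) => [l|//] _ _ /= kl.
  by apply: (pinj _ _ k) => //; rewrite kl.
rewrite esum_mkcond; apply: le_esum => i _.
by case: ifPn.
Qed.

Section pshift.
Variables (R : realType) (I : choiceType) (E : normedModType R[i]).
Variable p : I -> option I.
Hypothesis pinj : forall i j k, p i = Some k -> p j = Some k -> i = j.

Lemma sqsum_pshift (x : hsum (fun _ : I => E)) :
  (sqsum (V := fun=> E) (fun i => oapp x (0 : E)%R (p i)) <= sqsum x)%E.
Proof.
apply: le_trans (le_esum_pshift _ pinj); last first.
  by move=> i; rewrite lee_fin sqr_ge0.
apply: le_esum => i _; case: (p i) => [j|] //=.
by rewrite rnorm0 expr0n.
Qed.

(* (pshift p x)_i is x_j if p i = Some j, and 0 if p i = None. *)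
Definition pshift (x : hsum (fun _ : I => E)) : hsum (fun _ : I => E) :=
  @Hsum _ _ (fun=> E) _ (le_lt_trans (sqsum_pshift x) (hsumP x)).

Lemma pshift_linear : linear pshift.
Proof.
move=> a x y; apply: hsum_ext => i /=.
by case: (p i) => //=; rewrite scaler0 addr0.
Qed.

Lemma pshift_le x : `|pshift x| <= `|x|.
Proof.
rewrite !hsum_normE lecR hnorm_le ?hnorm_ge0// -hnormE; exact: sqsum_pshift.
Qed.

End pshift.

Definition copies (R : realType) (k : nat) (E : normedModType R[i]) :=
  hsum (fun _ : 'I_k => E).

Definition ord_prev k (i : 'I_k) : option 'I_k :=
  if i == 0%N :> nat then None else insub i.-1.

Lemma ord_prev_inj k (i j l : 'I_k) :
  ord_prev i = Some l -> ord_prev j = Some l -> i = j.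
Proof.
rewrite /ord_prev; case: eqP => // i0; case: eqP => // j0.
case: insubP => // a _ ai [al]; case: insubP => // b _ bj [bl].
by apply: val_inj; move: ai bj i0 j0; rewrite al bl /=; lia.
Qed.

(* (x_0, ..., x_(k-1)) |-> (0, x_0, ..., x_(k-2)) *)
Definition trunc_shift (R : realType) (E : normedModType R[i]) (k : nat) :
    lin_contraction (copies k E) :=
  Contraction (pshift_linear (@ord_prev_inj k))
              (pshift_le (@ord_prev_inj k)).

(** * Hardy spaces on the unit disc *)

Notation disc R := {z : R[i] | `|z| < 1}.

Definition power_series (R : realType) (E : normedModType R[i])
  (a : nat -> E) (z : R[i]) : nat -> E := series (fun n => z ^+ n *: a n).

(* Analyticity on the disc, as convergence of the Taylor series at 0. *)
Definition analytic (R : realType) (E : normedModType R[i]) (f : disc R -> E) :=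
  exists a : nat -> E, forall z, power_series a (val z) @ \oo --> f z.

Section hardy.
Variables (R : realType) (E : normedModType R[i]).
Local Notation l2 := (hsum (fun _ : nat => E)).

Record hardy := Hardy {
  hardy_fun :> disc R -> E;
  hardyP : exists a : l2, forall z, power_series a (val z) @ \oo --> hardy_fun z
}.

HB.instance Definition _ := gen_eqMixin hardy.
HB.instance Definition _ := gen_choiceMixin hardy.

Lemma hardy_ext (f g : hardy) : (forall z, f z = g z) -> f = g.
Proof.
case: f g => [f hf] [g hg]/= /funext fg.
by subst g; congr Hardy; exact: Prop_irrelevance.
Qed.

Definition taylor (f : hardy) : l2 := projT1 (cid (hardyP f)).

Lemma taylorP (f : hardy) z : power_series (taylor f) (val z) @ \oo --> f z.
Proof. by rewrite /taylor; case: cid. Qed.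

Lemma power_series_lin (c z : R[i]) (a b : nat -> E) :
  power_series (fun n => c *: a n + b n) z =
  (fun n => c *: power_series a z n + power_series b z n).
Proof.
apply/funext => n; rewrite /power_series /series/= scaler_sumr -big_split/=.
by apply: eq_bigr => i _; rewrite scalerDr !scalerA mulrC.
Qed.

Lemma cvg_power_series_lin (c z : R[i]) (a b : nat -> E) (u v : E) :
  power_series a z @ \oo --> u -> power_series b z @ \oo --> v ->
  power_series (fun n => c *: a n + b n) z @ \oo --> c *: u + v.
Proof.
move=> au bv; rewrite power_series_lin.
by apply: cvgD => //; apply: cvgZr.
Qed.

Lemma power_series_tail (K r : R) (a : nat -> E) m N :
  0 <= r -> r <= 2^-1 -> 0 <= K -> (forall n, rnorm (a n) <= K) ->
  (forall n, (n < m)%N -> a n = 0) -> (m < N)%N ->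
  rnorm (power_series a r%:C N - r%:C ^+ m *: a m) <=
    K * (2 * r ^+ m.+1 - 2 * r ^+ N).
Proof.
move=> r0 r2 K0 aK am; elim: N => // N IH; rewrite ltnS leq_eqVlt => /orP[/eqP <-|mN].
  rewrite /power_series /series/= big_nat_recr//= big_nat big1.
    by rewrite add0r !subrr mulr0 rnorm0.
  by move=> i /am ->; rewrite scaler0.
rewrite /power_series /series/= big_nat_recr//= -/(series _ N) addrAC.
apply: le_trans (rnormD _ _) _.
apply: le_trans (lerD (IH mN) (lexx _)) _.
rewrite rnormZ -rmorphXn.
have -> : complex.Re `|(r ^+ N)%:C| = r ^+ N.
  by rewrite ger0_norm // ler0c exprn_ge0.
have rN : 0 <= r ^+ N by rewrite exprn_ge0.
have h1 : r ^+ N * rnorm (a N) <= r ^+ N * K by rewrite ler_wpM2l.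
have h2 : r ^+ N.+1 <= r ^+ N * 2^-1 by rewrite exprSr ler_wpM2l.
have h3 : K * r ^+ N.+1 <= K * (r ^+ N * 2^-1) by rewrite ler_wpM2l.
move: h1 h3; move: (r ^+ N) (r ^+ N.+1) (r ^+ m.+1) (rnorm _) => A B C D h1 h3.
by lra.
Qed.

Lemma power_series_inj0 (a : l2) :
  (forall z : disc R, power_series a (val z) @ \oo --> (0 : E)) ->
  forall n, a n = 0.
Proof.
move=> a0; elim/ltn_ind => m am; apply: rnorm_eq0.
pose K := hnorm a; have K0 : 0 <= K by exact: hnorm_ge0.
apply/eqP; rewrite eq_le rnorm_ge0 andbT; apply/ler_addgt0Pl => e e0.
rewrite addr0; pose r := Num.min 2^-1 (e / (2 * K + 1)).
have K1 : 0 < 2 * K + 1 by rewrite ltr_pwDr// mulr_ge0.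
have r0 : 0 < r by rewrite lt_min invr_gt0 ltr0n divr_gt0.
have r2 : r <= 2^-1 by rewrite ge_min lexx.
have re : r * (2 * K + 1) <= e by rewrite -ler_pdivlMr// ge_min lexx orbT.
have r1 : `|r%:C| < 1 :> R[i].
  rewrite ger0_norm ?ler0c ?(ltW r0)// -[1]/(1%:C) ltcR.
  by rewrite (le_lt_trans r2)// invf_lt1// ltr1n.
have rm0 : 0 < r ^+ m by rewrite exprn_gt0.
have main : rnorm (r%:C ^+ m *: a m) <= K * (2 * r ^+ m.+1).
  apply/ler_addgt0Pl => d d0.
  have /cvgrPdist_le/(_ d%:C) := a0 (exist _ r%:C r1).
  rewrite -[X in X < _]/(0%:C) ltcR => /(_ d0) [N _ /(_ (maxn N m.+1) (leq_maxl _ _))] /=.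
  set M := maxn _ _; rewrite sub0r normrN rnormE lecR => SM.
  have mM : (m < M)%N by rewrite leq_maxr.
  have := @power_series_tail K r a m M (ltW r0) r2 K0 (rnorm_le_hnorm a) am mM.
  rewrite -rnormN opprB => tM.
  rewrite -[X in rnorm X](subrK (power_series a r%:C M)) addrC.
  apply: le_trans (rnormD _ _) _; apply: lerD => //.
  apply: le_trans tM _; rewrite ler_wpM2l// gerBl mulr_ge0// exprn_ge0//.
  exact: ltW.
move: main; rewrite rnormZ -rmorphXn ger0_norm ?ler0c ?(ltW rm0)//.
rewrite (_ : K * _ = r ^+ m * (K * 2 * r)) ?ler_pM2l//; last by rewrite exprSr; ring.
move/le_trans; apply; apply: le_trans re.
by move: (r) r0 (K) => x x0 y; lra.
Qed.

Lemma taylor_unique (f : hardy) (a : l2) :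
  (forall z, power_series a (val z) @ \oo --> f z) -> taylor f = a.
Proof.
move=> af; have h : forall n, (- 1 *: taylor f + a) n = 0.
  apply: power_series_inj0 => z.
  by have := @cvg_power_series_lin (-1) _ _ _ _ _ (@taylorP f z) (af z); rewrite scaleN1r addNr.
apply/esym/eqP; rewrite -subr_eq0 -scaleN1r addrC; apply/eqP.
by apply: hsum_ext => n; rewrite h.
Qed.

Lemma hardy0P : exists a : l2,
  forall z : disc R, power_series a (val z) @ \oo --> (0 : E).
Proof.
exists 0 => z; rewrite (_ : power_series _ _ = cst 0); first exact: cvg_cst.
by apply/funext => n; rewrite /power_series /series/= big1// => i _; rewrite scaler0.
Qed.

Lemma hardy_linP (c : R[i]) (f g : hardy) : exists a : l2,
  forall z : disc R, power_series a (val z) @ \oo --> c *: f z + g z.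
Proof.
exists (c *: taylor f + taylor g) => z.
by apply: (@cvg_power_series_lin c _ (taylor f) (taylor g)); exact: taylorP.
Qed.

Lemma hardyDP (f g : hardy) : exists a : l2,
  forall z : disc R, power_series a (val z) @ \oo --> f z + g z.
Proof.
by have [a ha] := hardy_linP 1 f g; exists a => z; have := ha z; rewrite scale1r.
Qed.

Definition hardy0 := Hardy hardy0P.

Lemma hardyZP (c : R[i]) (f : hardy) : exists a : l2,
  forall z : disc R, power_series a (val z) @ \oo --> c *: f z.
Proof.
by have [a ha] := hardy_linP c f hardy0; exists a => z; have := ha z; rewrite addr0.
Qed.

Lemma hardyNP (f : hardy) : exists a : l2,
  forall z : disc R, power_series a (val z) @ \oo --> - f z.
Proof.
by have [a ha] := hardyZP (-1) f; exists a => z; have := ha z; rewrite scaleN1r.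
Qed.

Definition hardyN f := Hardy (hardyNP f).
Definition hardyD f g := Hardy (hardyDP f g).
Definition hardyZ c f := Hardy (hardyZP c f).

Let hardyDA : associative hardyD.
Proof. by move=> f g h; apply: hardy_ext => z /=; rewrite addrA. Qed.
Let hardyDC : commutative hardyD.
Proof. by move=> f g; apply: hardy_ext => z /=; rewrite addrC. Qed.
Let hardy0D : left_id hardy0 hardyD.
Proof. by move=> f; apply: hardy_ext => z /=; rewrite add0r. Qed.
Let hardyND : left_inverse hardy0 hardyN hardyD.
Proof. by move=> f; apply: hardy_ext => z /=; rewrite addNr. Qed.

HB.instance Definition _ :=
  GRing.isZmodule.Build hardy hardyDA hardyDC hardy0D hardyND.

Let hardyZA a b f : hardyZ a (hardyZ b f) = hardyZ (a * b) f.
Proof. by apply: hardy_ext => z /=; rewrite scalerA. Qed.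
Let hardy1Z : left_id 1 hardyZ.
Proof. by move=> f; apply: hardy_ext => z /=; rewrite scale1r. Qed.
Let hardyZDr : right_distributive hardyZ +%R.
Proof. by move=> a f g; apply: hardy_ext => z /=; rewrite scalerDr. Qed.
Let hardyZDl f : {morph hardyZ^~ f : a b / a + b}.
Proof. by move=> a b; apply: hardy_ext => z /=; rewrite scalerDl. Qed.

HB.instance Definition _ :=
  GRing.Zmodule_isLmodule.Build R[i] hardy hardyZA hardy1Z hardyZDr hardyZDl.

Lemma taylor_linear : linear taylor.
Proof.
move=> c f g; apply: taylor_unique => z.
exact: (@cvg_power_series_lin c _ _ _ _ _ (@taylorP f z) (@taylorP g z)).
Qed.

HB.instance Definition _ :=
  GRing.isLinear.Build R[i] hardy l2 *:%R taylor taylor_linear.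

Lemma taylor_inj f : taylor f = 0 -> f = 0.
Proof.
move=> f0; apply: hardy_ext => z.
have fz := @taylorP f z; have oz := @taylorP 0 z.
rewrite f0 -(linear0 taylor) in fz.
exact: cvg_unique fz oz.
Qed.

(* (\sum_n `|a_n|^2)^(1/2), where a is the Taylor sequence of f at 0 *)
Let norm_hardy (f : hardy) : R[i] := `|taylor f|.

Let ler_norm_hardyD f g : norm_hardy (f + g) <= norm_hardy f + norm_hardy g.
Proof. by rewrite /norm_hardy linearD ler_normD. Qed.

Let norm_hardyZ (a : R[i]) f : norm_hardy (a *: f) = `|a| * norm_hardy f.
Proof. by rewrite /norm_hardy linearZ normrZ. Qed.

Let norm_hardy0_eq0 f : norm_hardy f = 0 -> f = 0.
Proof. by move/normr0_eq0/taylor_inj. Qed.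

HB.instance Definition _ :=
  Lmodule_isNormed.Build R[i] hardy ler_norm_hardyD norm_hardyZ norm_hardy0_eq0.

Lemma hardy_normE (f : hardy) : `|f| = `|taylor f|.
Proof. by []. Qed.

(** Multiplication by [z] *)

Let nat_prev n := if n is m.+1 then Some m else None.

Let nat_prev_inj i j k : nat_prev i = Some k -> nat_prev j = Some k -> i = j.
Proof. by case: i j => [|i] [|j]//= [->] [->]. Qed.

Let power_series_shift (a : l2) (z : R[i]) (v : E) :
  power_series a z @ \oo --> v ->
  power_series (pshift nat_prev_inj a) z @ \oo --> z *: v.
Proof.
move=> av; rewrite -(cvg_shiftn 1).
rewrite (_ : (fun n => _) = (fun n => z *: power_series a z n)); first exact: cvgZr.
apply/funext => n; rewrite /power_series /series/= addn1 big_nat_recl//=.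
rewrite scaler0 add0r scaler_sumr; apply: eq_bigr => i _.
by rewrite scalerA exprS.
Qed.

Let mulzP (f : hardy) : exists a : l2,
  forall z, power_series a (val z) @ \oo --> val z *: f z.
Proof.
exists (pshift nat_prev_inj (taylor f)) => z.
by apply: power_series_shift; exact: taylorP.
Qed.

Definition mulz_fun (f : hardy) : hardy := Hardy (mulzP f).

Lemma mulz_linear : linear mulz_fun.
Proof.
move=> c f g; apply: hardy_ext => z /=.
by rewrite scalerDr !scalerA mulrC.
Qed.

Lemma mulz_le f : `|mulz_fun f| <= `|f|.
Proof.
rewrite !hardy_normE (@taylor_unique _ (pshift nat_prev_inj (taylor f))).
  exact: pshift_le.
by move=> z; apply: power_series_shift; exact: taylorP.
Qed.

Definition mulz : lin_contraction hardy := Contraction mulz_linear mulz_le.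

End hardy.

(** * Inner functions *)

Section inner_function.
Variable R : realType.
Implicit Types u : disc R -> R[i]^o.

(* u(r e^(it)), for 0 <= r < 1 *)
Definition radial u (t r : R) : R[i]^o :=
  if insub (r%:C * (cos t +i* sin t)) is Some z then u z else 0.

(* The boundary value u(e^(it)) is the radial limit of u, which exists for
   almost every t since u is bounded (Fatou). *)
Definition inner_function u :=
  [/\ analytic u,
      exists c : R, forall z, `|u z| <= c%:C &
      {ae @lebesgue_measure R, forall t : R, t \in `[0, 2 * pi[ ->
        exists2 w : R[i]^o, `|w| = 1 & radial u t r @[r --> (1 : R)^'-] --> w}].

(* z^m H^2 *)
Definition zpow_hardy (m : nat) : set (disc R -> R[i]^o) :=
  [set u | exists g : hardy R[i]^o, forall z, u z = val z ^+ m * g z].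

(* u H^2_E *)
Definition mul_hardy (E : normedModType R[i]) u : set (hardy E) :=
  [set g | exists f : hardy E, forall z, g z = u z *: f z].

End inner_function.

(** * Subspaces and operators *)

Definition closed_subspace (R : realType) (V : normedModType R[i]) (M : set V) :=
  [/\ closed M, M 0 & forall (a : R[i]) x y, M x -> M y -> M (a *: x + y)].

Definition bounded_op (R : realType) (V : normedModType R[i]) (X : V -> V) :=
  exists c : R, forall x, `|X x| <= c%:C * `|x|.

Definition hyperinvariant (R : realType) (V : normedModType R[i])
    (T : V -> V) (M : set V) :=
  forall X : {linear V -> V}, bounded_op X -> (forall x, X (T x) = T (X x)) ->
  forall x, M x -> M (X x).

Definition nullspace (R : realType) (V : normedModType R[i]) (T : V -> V) : set V :=
  [set x | T x = 0].

Definition hsum_set (R : realType) (I : choiceType) (V : I -> normedModType R[i])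
    (A : forall i, set (V i)) : set (hsum V) :=
  [set x | forall i, A i (x i)].

(* Binary direct sums; [true] indexes the first summand. *)
Section hsum2.
Variables (R : realType) (V W : normedModType R[i]).

Definition hsum2 := hsum (fun b : bool => if b then V else W).

Definition hsum2_map (S : lin_contraction V) (T : lin_contraction W) :
    lin_contraction hsum2 :=
  hsum_map (fun b : bool =>
    if b return lin_contraction (if b then V else W) then S else T).

Definition hsum2_set (A : set V) (B : set W) : set hsum2 :=
  hsum_set (fun b : bool => if b return set (if b then V else W) then A else B).

End hsum2.

(* Main.v *)
Require Import Defs.
From HB Require Import structures.
From mathcomp Require Import all_boot all_order all_algebra.
From mathcomp Require Import complex zify ring lra.
From mathcomp Require Import all_classical all_reals all_analysis.
From mathcomp Require Import measurable_realfun.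

Set Implicit Arguments.
Unset Strict Implicit.
Unset Printing Implicit Defensive.

Import Order.TTheory GRing.Theory Num.Theory.
Import numFieldNormedType.Exports.

Local Open Scope classical_set_scope.
Local Open Scope complex_scope.
Local Open Scope ring_scope.

(** Write T for the operator. A bounded operator from one summand of the space
to another that intertwines the actions of T on them extends by zero to an
operator commuting with T, and hyperinvariance is used only through such
operators.

If M is hyperinvariant, the coordinate projections show that M is determined
by its components in the summands ([M_parts]). Rank-one operators applied to
all coefficients at once, composed with shifts, show that a vector of M whose
first nonzero coefficient is the i-th one forces M to contain every vector of
a truncated shift whose first i + s slots vanish, where s is the difference of
the two lengths, or 0 if the target is not longer or the source is the Hardy
space ([M_fill]). So the k-th component is the set of vectors whose first d_k
slots vanish, which is the null space of the power k - d_k of J_k, and the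
same property bounds d_l by d_k + max(l - k, 0); this is the condition on the
n_k. A zero space E_k imposes nothing, and its n_k is interpolated
([lipschitz_extension]).

The Hardy component S is closed, invariant under the shift and under rank-one
operators acting on the coefficients. A Beurling theorem in the space of
square-summable coefficient sequences ([beurling]) gives S = u H^2 for one
scalar sequence u: the vector of least norm with a prescribed leading
coefficient e can be replaced by its projection to the multiples of e, so it
has the form u e, and the shifts of all u x span S. Multiplication by u is
isometric; applied to powers this gives |u| <= 1 on the disc
([isometric_symbol_le1]), and then Fatou's theorem together with
sum |u_n|^2 = 1 gives unimodular radial limits ([fatou_inner]). That z^(d_k)
divides u is again [M_fill], with a source in the Hardy space.

Conversely, let X commute with T and let x be in a set M of the stated form.
In the Hardy component X acts through its H^2 to H^2 corner, since T is
nilpotent on each truncated summand and multiplication by z is injective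
([pr_X_copies]); the corner commutes with z, hence with u
([commute_mul_hardy]). In the k-th truncated summand the form of M gives y
with T^(n_k) x = T^k y, whence J_k^(n_k) (X x)_k = J_k^k (X y)_k = 0
([pr_X_copies_part]).

For Fatou's theorem, u is approximated in H^2, fast, by trigonometric
polynomials bounded by 2. They converge almost everywhere to a boundary function
whose Poisson integral is u ([poisson_u]), and the Poisson kernel is dominated
by averages over balls ([poisson_kernel_dyadic]), so that Poisson integrals
converge at every Lebesgue point. *)

(** * Norms and limits *)

Section rnorm_facts.
Variables (R : realType) (V : normedModType R[i]).
Implicit Types (x y : V).

(** The norm of the spaces considered is complex valued; this is the convergence
criterion with real errors used throughout. *)
Lemma cvg_rnormP (x : nat -> V) l :
  (forall e : R, 0 < e -> exists N, forall n, (N <= n)%N -> rnorm (l - x n) <= e) <->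
  x @ \oo --> l.
Proof.
split=> h.
  apply/cvgrPdist_le => e e0.
  have eE : e = (complex.Re e)%:C.
    by case: e e0 => a b; rewrite ltcE /= => /andP[/eqP -> _].
  have [|N Nh] := h (complex.Re e); first by move: e0; rewrite eE ltcR.
  by exists N => // n /= /Nh; rewrite eE rnormE lecR.
move=> e e0; have /cvgrPdist_le/(_ e%:C) := h.
rewrite -[X in X < _]/(0%:C) ltcR => /(_ e0) [N _ Nh].
by exists N => n /Nh /=; rewrite rnormE lecR.
Qed.

Lemma rnormB x y : rnorm (x - y) = rnorm (y - x).
Proof. by rewrite -rnormN opprB. Qed.

Lemma rnorm_cvg_le (x : nat -> V) l y B N : x @ \oo --> l ->
  (forall n, (N <= n)%N -> rnorm (x n - y) <= B) -> rnorm (l - y) <= B.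
Proof.
move=> /cvg_rnormP xl xB; apply/ler_addgt0Pl => e e0.
have [M Mh] := xl e e0.
rewrite -(subrKA (x (maxn M N)) l (- y)); apply: le_trans (rnormD _ _) _.
by rewrite lerD ?Mh ?xB ?leq_maxl ?leq_maxr.
Qed.

Lemma rnorm_sum I (s : seq I) (P : pred I) (F : I -> V) :
  rnorm (\sum_(i <- s | P i) F i) <= \sum_(i <- s | P i) rnorm (F i).
Proof.
elim/big_rec2: _ => [|i x y _ h]; first by rewrite rnorm0.
by apply: le_trans (rnormD _ _) _; rewrite lerD2l.
Qed.

End rnorm_facts.

Lemma le_rnorm_lim (R : realType) (x : nat -> R) (l B : R) N : x @ \oo --> l ->
  (forall n, (N <= n)%N -> x n <= B) -> l <= B.
Proof.
move=> xl xB; have <- := cvg_lim (@Rhausdorff R) xl.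
apply: limr_le; first by apply/cvg_ex; exists l.
by exists N => // n /= /xB.
Qed.

Lemma ge_lim (R : realType) (x : nat -> R) (l B : R) N : x @ \oo --> l ->
  (forall n, (N <= n)%N -> B <= x n) -> B <= l.
Proof.
move=> xl xB; have <- := cvg_lim (@Rhausdorff R) xl.
apply: limr_ge; first by apply/cvg_ex; exists l.
by exists N => // n /= /xB.
Qed.

Lemma geo_sum (R : realType) (r : R) N M : 0 <= r < 1 ->
  \sum_(N <= n < M) r ^+ n <= r ^+ N / (1 - r).
Proof.
move=> /andP[r0 r1]; have d0 : 0 < 1 - r by rewrite subr_gt0.
rewrite ler_pdivlMr//.
have [NM|MN] := leqP N M; last first.
  by rewrite big_geq ?(ltnW MN)// mul0r exprn_ge0.
rewrite mulr_suml (_ : \sum_(_ <= _ < _) _ = r ^+ N - r ^+ M).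
  by rewrite gerBl exprn_ge0.
rewrite -[RHS]opprB; have /= <- := telescope_sumr (fun n => r ^+ n) NM.
rewrite -sumrN; apply: eq_bigr => n _.
by rewrite exprS; ring.
Qed.

Lemma cvg_sq (R : realType) (x : nat -> R) (l : R) :
  x @ \oo --> l -> x n ^+ 2 @[n --> \oo] --> l ^+ 2.
Proof. by move=> xl; rewrite expr2; under eq_fun do rewrite expr2; exact: cvgM. Qed.

Lemma sqr_le (R : realType) (x y : R) : 0 <= x -> x <= y -> x ^+ 2 <= y ^+ 2.
Proof. by move=> x0 xy; rewrite lerXn2r ?nnegrE// (le_trans x0). Qed.

Lemma sqr_leW (R : realType) (x y : R) : 0 <= y -> x ^+ 2 <= y ^+ 2 -> x <= y.
Proof.
move=> y0 h; rewrite leNgt; apply/negP => yx.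
by move: h; rewrite leNgt => /negP; apply; rewrite ltrXn2r// ?nnegrE// ltW// (le_lt_trans y0).
Qed.

(** * Trigonometric polynomials and the Poisson kernel *)

Section bounded_measurable.
Variable R : realType.
Implicit Types (f g : R -> R).
Local Notation mu := (@lebesgue_measure R).

(** Bounded measurable functions: integrals over bounded intervals are linear and
monotone on them without further hypotheses. *)
Definition bmf f := measurable_fun setT f /\ exists B, forall x, `|f x| <= B.

Lemma bmf_cst (k : R) : bmf (cst k).
Proof. by split; [exact: measurable_cst | exists `|k|]. Qed.

Lemma bmfD f g : bmf f -> bmf g -> bmf (fun x => f x + g x).
Proof.
move=> [mf [B fB]] [mg [C gC]]; split; first exact: measurable_funD.
by exists (B + C) => x; rewrite (le_trans (ler_normD _ _))// lerD.
Qed.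

Lemma bmfN f : bmf f -> bmf (fun x => - f x).
Proof.
move=> [mf [B fB]]; split; first exact: measurableT_comp.
by exists B => x; rewrite normrN.
Qed.

Lemma bmfB f g : bmf f -> bmf g -> bmf (fun x => f x - g x).
Proof. by move=> bf bg; apply: bmfD bf (bmfN bg). Qed.

Lemma bmfM f g : bmf f -> bmf g -> bmf (fun x => f x * g x).
Proof.
move=> [mf [B fB]] [mg [C gC]]; split; first exact: measurable_funM.
by exists (B * C) => x; rewrite normrM ler_pM.
Qed.

Lemma bmf_norm f : bmf f -> bmf (fun x => `|f x|).
Proof.
move=> [mf [B fB]]; split; first exact: measurableT_comp.
by exists B => x; rewrite normr_id.
Qed.

Lemma bmf_sum I (s : seq I) (F : I -> R -> R) :
  (forall i, bmf (F i)) -> bmf (fun x => \sum_(i <- s) F i x).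
Proof.
move=> bF; elim: s => [|i s IH].
  by under eq_fun do rewrite big_nil; exact: bmf_cst.
by under eq_fun do rewrite big_cons; exact: bmfD.
Qed.

Lemma bmf_continuous f : continuous f -> (exists B, forall x, `|f x| <= B) -> bmf f.
Proof. by move=> cf bf; split=> //; exact: continuous_measurable_fun. Qed.

Lemma continuous_cosM (j : R) : continuous (fun x : R => cos (j * x)).
Proof.
move=> x; apply: (@continuous_comp _ _ _ ( *%R j) cos); last exact: continuous_cos.
exact: mulrl_continuous.
Qed.

Lemma continuous_sinM (j : R) : continuous (fun x : R => sin (j * x)).
Proof.
move=> x; apply: (@continuous_comp _ _ _ ( *%R j) sin); last exact: continuous_sin.
exact: mulrl_continuous.
Qed.

Lemma bmf_cos (j : R) : bmf (fun x => cos (j * x)).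
Proof.
by apply: bmf_continuous; [exact: continuous_cosM | exists 1 => x; exact: cos_max].
Qed.

Lemma bmf_sin (j : R) : bmf (fun x => sin (j * x)).
Proof.
by apply: bmf_continuous; [exact: continuous_sinM | exists 1 => x; exact: sin_max].
Qed.

Lemma bmf_integrable f (D : set R) : measurable D -> (mu D < +oo)%E -> bmf f ->
  mu.-integrable D (EFin \o f).
Proof.
move=> mD Dfin [mf [B fB]]; apply: measurable_bounded_integrable => //.
  exact: measurable_funTS.
exists B; split; first exact: num_real.
by move=> M BM x _ /=; rewrite (le_trans (fB x))// ltW.
Qed.

Lemma itv_lty (a b : R) : (mu `[a, b]%classic < +oo)%E.
Proof.
rewrite lebesgue_measure_itv/= lte_fin; case: ifP => _; last by [].
by rewrite -EFinB ltry.
Qed.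

Lemma bmf_integrable_itv f a b : bmf f -> mu.-integrable `[a, b]%classic (EFin \o f).
Proof. by apply: bmf_integrable; [exact: measurable_itv|exact: itv_lty]. Qed.

Definition int_itv (a b : R) f : R := \int[mu]_(x in `[a, b]%classic) f x.

Lemma eq_int_itv a b f g : (forall x, f x = g x) -> int_itv a b f = int_itv a b g.
Proof. by move=> fg; rewrite /int_itv; apply: eq_Rintegral => x _; exact: fg. Qed.

Lemma int_itvD a b f g : bmf f -> bmf g ->
  int_itv a b (fun x => f x + g x) = int_itv a b f + int_itv a b g.
Proof. by move=> bf bg; rewrite /int_itv RintegralD//; exact: bmf_integrable_itv. Qed.

Lemma int_itvB a b f g : bmf f -> bmf g ->
  int_itv a b (fun x => f x - g x) = int_itv a b f - int_itv a b g.
Proof. by move=> bf bg; rewrite /int_itv RintegralB//; exact: bmf_integrable_itv. Qed.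

Lemma int_itvZ a b k f : bmf f -> int_itv a b (fun x => k * f x) = k * int_itv a b f.
Proof. by move=> bf; rewrite /int_itv RintegralZl//; exact: bmf_integrable_itv. Qed.

Lemma int_itv_cst a b k : a <= b -> int_itv a b (cst k) = k * (b - a).
Proof.
move=> ab; rewrite /int_itv Rintegral_cst//= lebesgue_measure_itv/= lte_fin.
by case: (ltgtP a b) ab => // -> _; rewrite subrr.
Qed.

Lemma int_itv_le a b f g : bmf f -> bmf g -> (forall x, x \in `[a, b] -> f x <= g x) ->
  int_itv a b f <= int_itv a b g.
Proof.
by move=> bf bg fg; rewrite /int_itv le_Rintegral//; exact: bmf_integrable_itv.
Qed.

Lemma int_itv_sum a b I (s : seq I) (F : I -> R -> R) : (forall i, bmf (F i)) ->
  int_itv a b (fun x => \sum_(i <- s) F i x) = \sum_(i <- s) int_itv a b (F i).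
Proof.
move=> bF; elim: s => [|i s IH].
  rewrite big_nil (@eq_int_itv _ _ _ (fun x => 0 * cst 0 x)).
    by rewrite int_itvZ ?mul0r//; exact: bmf_cst.
  by move=> x; rewrite big_nil mul0r.
rewrite big_cons -IH -int_itvD//; last exact: bmf_sum.
by apply: eq_int_itv => x; rewrite big_cons.
Qed.

Lemma int_itv_norm a b f : bmf f -> `|int_itv a b f| <= int_itv a b (fun x => `|f x|).
Proof.
move=> bf; rewrite /int_itv; apply: le_normr_Rintegral => //.
exact: bmf_integrable_itv.
Qed.

Lemma int_itv_bound a b f B : a <= b -> bmf f -> (forall x, x \in `[a, b] -> `|f x| <= B) ->
  `|int_itv a b f| <= B * (b - a).
Proof.
move=> ab bf fB; rewrite (le_trans (int_itv_norm _ _ bf))// -int_itv_cst//.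
by apply: int_itv_le => //; [exact: bmf_norm|exact: bmf_cst].
Qed.

End bounded_measurable.

Section trig.
Variable R : realType.
Local Notation mu := (@lebesgue_measure R).
Local Notation C := R[i].
Implicit Types (c d : C) (j t : R).

(** Re (c e^(ijt)) *)
Definition trig_mono c j t : R := complex.Re c * cos (j * t) - complex.Im c * sin (j * t).

Lemma bmf_trig_mono c j : bmf (trig_mono c j).
Proof.
by apply: bmfB; apply: bmfM; (exact: bmf_cst || exact: bmf_cos || exact: bmf_sin).
Qed.

Lemma trig_mono_continuous c j : continuous (trig_mono c j).
Proof.
move=> x; apply: cvgB; apply: cvgM; (exact: cvg_cst || exact: continuous_cosM || exact: continuous_sinM).
Qed.

Lemma cos2n (x : R) (k : nat) : cos (x + 2 * pi * k%:R) = cos x.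
Proof.
have -> : 2 * pi * k%:R = (pi *+ 2) *+ k :> R by rewrite mulr_natr mulr_natl.
by rewrite (periodicn (@cosD2pi R)).
Qed.

Lemma sin2n (x : R) (k : nat) : sin (x + 2 * pi * k%:R) = sin x.
Proof.
have -> : 2 * pi * k%:R = (pi *+ 2) *+ k :> R by rewrite mulr_natr mulr_natl.
by rewrite (periodicn (@sinD2pi R)).
Qed.

Lemma trig_mono_periodic c (j : int) t (m : nat) :
  trig_mono c j%:~R (t + 2 * pi * m%:R) = trig_mono c j%:~R t.
Proof.
rewrite /trig_mono; case: j => n.
  by rewrite mulrDr (mulrC _ (2 * _ * _)) -mulrA -natrM cos2n sin2n.
rewrite NegzE mulrNz !mulNr !cosN !sinN.
by rewrite mulrDr (mulrC _ (2 * _ * _)) -mulrA -natrM cos2n sin2n.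
Qed.

Lemma trig_mono_derive c j t : j != 0 ->
  is_derive t (1 : R) (fun x => (complex.Re c * sin (j * x) + complex.Im c * cos (j * x)) / j)
    (trig_mono c j t).
Proof.
move=> j0.
have dl : is_derive t (1 : R) (fun x : R => j * x) j.
  by have := is_deriveZ j (is_derive_id t (1 : R)); rewrite /GRing.scale/= mulr1.
have ds : is_derive t (1 : R) (fun x : R => sin (j * x)) (cos (j * t) * j).
  exact: is_derive1_comp.
have dc : is_derive t (1 : R) (fun x : R => cos (j * x)) (- sin (j * t) * j).
  exact: is_derive1_comp.
have h := is_deriveD (is_deriveZ (complex.Re c) ds) (is_deriveZ (complex.Im c) dc).
have := is_deriveZ j^-1 h.
rewrite (_ : _ *: _ = trig_mono c j t); last first.
  by rewrite /trig_mono /GRing.scale/=; field.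
have -> //: (fun x : R => (complex.Re c * sin (j * x) + complex.Im c * cos (j * x)) / j) =
   j^-1 \*: (complex.Re c \*: (fun x => sin (j * x)) + complex.Im c \*: (fun x => cos (j * x))).
  by apply/funext => x /=; rewrite mulrC.
Qed.

Lemma FTC_simple (F f : R -> R) a b : a < b -> continuous f ->
  (forall x, is_derive x (1 : R) F (f x)) -> int_itv a b f = F b - F a.
Proof.
move=> ab cf dF.
have cF : continuous F.
  move=> x; apply/differentiable_continuous; rewrite -derivable1_diffP.
  by have [] := dF x.
rewrite /int_itv /Rintegral (@continuous_FTC2 _ f F)//.
- exact: continuous_subspaceT.
- split.
  + by move=> x _; have [] := dF x.
  + by apply: cvg_at_right_filter; exact: cF.
  + by apply: cvg_at_left_filter; exact: cF.
- by move=> x _; rewrite derive1E; have [_ ->] := dF x.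
Qed.

Lemma int_itv_trig_mono c (j : int) a (m : nat) : (0 < m)%N ->
  int_itv a (a + 2 * pi * m%:R) (trig_mono c j%:~R) = (j == 0)%:R * (2 * pi * m%:R * complex.Re c).
Proof.
move=> m0; have pm : 0 < 2 * pi * m%:R :> R by rewrite !mulr_gt0 ?pi_gt0 ?ltr0n.
have [->|j0] := eqVneq j 0.
  rewrite mul1r (@eq_int_itv _ _ _ _ (cst (complex.Re c))).
    by rewrite int_itv_cst ?lerDl ?ltW// addrC addKr mulrC.
  by move=> x; rewrite /trig_mono mul0r cos0 sin0 mulr1 mulr0 subr0.
rewrite mul0r; have j0' : j%:~R != 0 :> R by rewrite intr_eq0.
rewrite (FTC_simple _ (@trig_mono_continuous c j%:~R) (fun x => @trig_mono_derive c _ x j0')) ?ltrDl//.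
have := trig_mono_periodic (complex.Im c -i* complex.Re c) j a m.
rewrite /trig_mono/=; set A := sin _; set B := cos _; set A' := sin _; set B' := cos _ => h.
by rewrite -mulrBl; apply/eqP; rewrite mulf_eq0; apply/orP; left; apply/eqP; lra.
Qed.

(** Re (sum_(n < N) c n e^(int)) *)
Definition trig_poly (c : nat -> C) (N : nat) t : R := \sum_(n < N) trig_mono (c n) n%:R t.

Lemma bmf_trig_poly (c : nat -> C) N : bmf (trig_poly c N).
Proof. by apply: bmf_sum => i; exact: bmf_trig_mono. Qed.

(** Adding the products of the real and of the imaginary parts (the latter are
the real parts after multiplication by - i) gives Re (z w^* ), a single
monomial; this makes the integral of |f|^2 computable term by term. *)
Lemma trig_mono_mul c d (n m : nat) t :
  trig_mono c n%:R t * trig_mono d m%:R t + trig_mono (- 'i * c) n%:R t * trig_mono (- 'i * d) m%:R t =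
  trig_mono (c * d^*) (Posz n - Posz m)%:~R t.
Proof.
have E : (Posz n - Posz m)%:~R * t = n%:R * t - m%:R * t :> R.
  by rewrite intrB mulrBl.
rewrite /trig_mono E cosB sinB.
case: c d => [a b] [a' b'] /=.
by ring.
Qed.

(** The period is allowed to be repeated m times, since pointwise limits are needed
on an interval longer than [0, 2 pi]. *)
Lemma parseval (c : nat -> C) N a (m : nat) : (0 < m)%N ->
  int_itv a (a + 2 * pi * m%:R)
    (fun t => trig_poly c N t * trig_poly c N t + trig_poly (fun n => - 'i * c n) N t * trig_poly
      (fun n => - 'i * c n) N t) =
  2 * pi * m%:R * \sum_(n < N) complex.Re (c n * (c n)^*).
Proof.
move=> m0.
rewrite (@eq_int_itv _ _ _ _ (fun t => \sum_(n < N) \sum_(k < N)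
   trig_mono (c n * (c k)^*) (Posz n - Posz k)%:~R t)); last first.
  move=> t; rewrite /trig_poly !mulr_suml -big_split/=; apply: eq_bigr => n _.
  rewrite !mulr_sumr -big_split/=; apply: eq_bigr => k _.
  by rewrite trig_mono_mul.
rewrite int_itv_sum; last by move=> n; apply: bmf_sum => k; exact: bmf_trig_mono.
rewrite mulr_sumr; apply: eq_bigr => n _.
rewrite int_itv_sum; last by move=> k; exact: bmf_trig_mono.
rewrite (bigD1 n)//= big1 ?addr0.
  by rewrite int_itv_trig_mono// subrr eqxx mul1r.
move=> k kn; rewrite int_itv_trig_mono// subr_eq0 eqz_nat eq_sym.
by rewrite (_ : (k == n :> nat) = false) ?mul0r//; exact: negbTE.
Qed.

Lemma geometric0 (K r x : R) N : 0 <= r < 1 ->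
  (forall M, (N <= M)%N -> `|x| <= K * r ^+ M) -> x = 0.
Proof.
move=> /andP[r0 r1] h; apply/normr0_eq0/eqP; rewrite eq_le normr_ge0 andbT.
have : (K * r ^+ M @[M --> \oo] --> K * 0).
  by apply: cvgM; [exact: cvg_cst|apply: cvg_expr; rewrite ger0_norm].
rewrite mulr0 => /cvg_lim <-//.
apply: limr_ge.
  apply/cvg_ex; exists (K * 0); apply: cvgM; [exact: cvg_cst|].
  by apply: cvg_expr; rewrite ger0_norm.
by exists N => // M /h.
Qed.

Definition poisson_den (r s : R) := 1 - 2 * r * cos s + r ^+ 2.
Definition poisson_kernel (r s : R) := (1 - r ^+ 2) / poisson_den r s.
(** The partial sums of the Fourier series of the Poisson kernel. *)
Definition trunc_kernel (r : R) N s := 1 + \sum_(j < N) (2 * r ^+ j.+1 * cos (j.+1%:R * s)).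

Lemma poisson_den_ge r s : 0 <= r -> (1 - r) ^+ 2 <= poisson_den r s.
Proof.
move=> r0; rewrite -subr_ge0 /poisson_den.
have -> : 1 - 2 * r * cos s + r ^+ 2 - (1 - r) ^+ 2 = 2 * r * (1 - cos s) by ring.
by rewrite !mulr_ge0// subr_ge0 cos_le1.
Qed.

Lemma poisson_den_gt0 r s : 0 <= r < 1 -> 0 < poisson_den r s.
Proof.
move=> /andP[r0 r1]; apply: lt_le_trans (poisson_den_ge s r0).
by rewrite exprn_gt0// subr_gt0.
Qed.

Lemma poisson_kernel_ge0 r s : 0 <= r < 1 -> 0 <= poisson_kernel r s.
Proof.
move=> r01; have /andP[r0 r1] := r01.
by rewrite divr_ge0 ?(ltW (poisson_den_gt0 _ _))// subr_ge0 expr_le1// ltW.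
Qed.

(** The product telescopes since 2 cos s cos (j s) = cos ((j+1) s) + cos ((j-1) s). *)
Lemma trunc_kernelE r N s : poisson_den r s * trunc_kernel r N s =
  1 - r ^+ 2 - 2 * r ^+ N.+1 * cos (N.+1%:R * s) + 2 * r ^+ N.+2 * cos (N%:R * s).
Proof.
rewrite /trunc_kernel; elim: N => [|N IH].
  by rewrite big_ord0 mul1r mul0r cos0 /poisson_den; ring.
rewrite big_ord_recr/= addrA mulrDr IH /poisson_den.
have -> : N%:R * s = N.+1%:R * s - s by rewrite -natr1; ring.
have -> : N.+2%:R * s = N.+1%:R * s + s by rewrite -[N.+2%:R]natr1; ring.
by rewrite cosB cosD !exprS; ring.
Qed.

Lemma poisson_kernel_trunc r N s : 0 <= r < 1 -> `|poisson_kernel r s - trunc_kernel r N s| <= 4 *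
  r ^+ N / (1 - r) ^+ 2.
Proof.
move=> r01; have /andP[r0 r1] := r01; have p0 := poisson_den_gt0 s r01.
have -> : poisson_kernel r s - trunc_kernel r N s =
   (2 * r ^+ N.+1 * cos (N.+1%:R * s) - 2 * r ^+ N.+2 * cos (N%:R * s)) / poisson_den r s.
  apply: (mulfI (lt0r_neq0 p0)); rewrite mulrBr trunc_kernelE /poisson_kernel; field.
  exact: lt0r_neq0.
rewrite normrM normfV [X in _ / X]gtr0_norm//.
have rN : 0 <= r ^+ N by exact: exprn_ge0.
apply: ler_pM => //; first by rewrite invr_ge0 ltW.
  apply: le_trans (ler_normB _ _) _; rewrite !normrM.
  rewrite (@ger0_norm _ 2)// (@ger0_norm _ (r ^+ N.+1)) ?exprn_ge0//.
  rewrite (ger0_norm r0).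
  have h (k : nat) x : 2 * r ^+ (N + k) * `|cos x| <= 2 * r ^+ N.
    rewrite -[leRHS]mulr1 ler_pM ?mulr_ge0 ?exprn_ge0 ?cos_max//.
    rewrite ler_wpM2l// exprD -[leRHS]mulr1 ler_wpM2l//.
    by rewrite exprn_ile1// ltW.
  have := h 1%N (N.+1%:R * s); have := h 2%N (N%:R * s).
  by rewrite addn1 addn2 ?exprS; lra.
by rewrite lef_pV2 ?posrE ?exprn_gt0 ?subr_gt0// poisson_den_ge.
Qed.

Lemma bmf_poisson_kernel r t : 0 <= r < 1 -> bmf (fun s => poisson_kernel r (s - t)).
Proof.
move=> r01; have /andP[r0 r1] := r01.
have cB : continuous (fun s : R => s - t).
  by move=> x; apply: cvgB; [exact: cvg_id|exact: cvg_cst].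
apply: bmf_continuous => [x|].
  apply: cvgM; first exact: cvg_cst.
  apply: cvgV; first exact/lt0r_neq0/poisson_den_gt0.
  apply: cvgD; last exact: cvg_cst.
  apply: cvgB; first exact: cvg_cst.
  apply: cvgM; first exact: cvg_cst.
  by apply: (@continuous_comp _ _ _ (fun s => s - t) cos); [exact: cB|exact: continuous_cos].
exists ((1 - r ^+ 2) / (1 - r) ^+ 2) => x.
rewrite ger0_norm ?poisson_kernel_ge0// /poisson_kernel ler_wpM2l//.
  by rewrite subr_ge0 expr_le1// ltW.
by rewrite lef_pV2 ?posrE ?exprn_gt0 ?subr_gt0 ?poisson_den_gt0 ?poisson_den_ge.
Qed.

Lemma bmf_trunc_kernel r N t : bmf (fun s => trunc_kernel r N (s - t)).
Proof.
apply: bmfD; first exact: bmf_cst.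
apply: bmf_sum => j; apply: bmfM; first exact: bmf_cst.
under eq_fun do rewrite mulrBr cosB.
by apply: bmfD; apply: bmfM; (exact: bmf_cos||exact: bmf_sin||exact: bmf_cst).
Qed.

(** The product-to-sum formula, with the phase - k t moved to the coefficient. *)
Lemma cos_trig_mono (c : C) (n k : nat) s t :
  2 * cos (k%:R * (s - t)) * trig_mono c n%:R s =
  trig_mono (c * (cos (k%:R * t) -i* sin (k%:R * t))) (Posz n + Posz k)%:~R s +
  trig_mono (c * (cos (k%:R * t) +i* sin (k%:R * t))) (Posz n - Posz k)%:~R s.
Proof.
have E : (Posz n - Posz k)%:~R * s = n%:R * s - k%:R * s :> R.
  by rewrite intrB mulrBl.
have E' : (Posz n + Posz k)%:~R * s = n%:R * s + k%:R * s :> R.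
  by rewrite intrD mulrDl.
have -> : k%:R * (s - t) = k%:R * s - k%:R * t by ring.
rewrite /trig_mono E E' !cosD !sinD !cosN !sinN.
by case: c => [a b] /=; ring.
Qed.

(** By orthogonality only the n-th term of the kernel contributes, hence n <= N. *)
Lemma poisson_trig_mono r (c : C) (n N : nat) t : (n <= N)%N ->
  int_itv (t - pi) (t + pi) (fun s => trunc_kernel r N (s - t) * trig_mono c n%:R s) =
  2 * pi * (r ^+ n * trig_mono c n%:R t).
Proof.
move=> nN.
have tpi : t + pi = t - pi + 2 * pi * 1%:R by ring.
rewrite tpi (@eq_int_itv _ _ _ _ (fun s => trig_mono c (Posz n)%:~R s + \sum_(j < N) (r ^+ j.+1 *
  (trig_mono (c * (cos (j.+1%:R * t) -i* sin (j.+1%:R * t))) (Posz n + Posz j.+1)%:~R s +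
   trig_mono (c * (cos (j.+1%:R * t) +i* sin (j.+1%:R * t))) (Posz n - Posz j.+1)%:~R s)))); last first.
  move=> s; rewrite /trunc_kernel mulrDl mul1r; congr (_ + _).
  rewrite mulr_suml; apply: eq_bigr => j _; rewrite -cos_trig_mono; ring.
have bD (d d' : C) j j' : bmf (fun s => trig_mono d j s + trig_mono d' j' s).
  by apply: bmfD; exact: bmf_trig_mono.
rewrite int_itvD; first last.
- by apply: bmf_sum => j; apply: bmfM; [exact: bmf_cst|exact: bD].
- exact: bmf_trig_mono.
rewrite int_itv_trig_mono// int_itv_sum; last first.
  by move=> j; apply: bmfM; [exact: bmf_cst|exact: bD].
have E (j : 'I_N) : int_itv (t - pi) (t - pi + 2 * pi * 1%:R) (fun s => r ^+ j.+1 *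
  (trig_mono (c * (cos (j.+1%:R * t) -i* sin (j.+1%:R * t))) (Posz n + Posz j.+1)%:~R s +
   trig_mono (c * (cos (j.+1%:R * t) +i* sin (j.+1%:R * t))) (Posz n - Posz j.+1)%:~R s)) =
   (n == j.+1)%:R * (2 * pi * (r ^+ n * trig_mono c n%:R t)).
  rewrite int_itvZ// int_itvD; try exact: bmf_trig_mono.
  rewrite !int_itv_trig_mono// -PoszD eqz_nat addnS/= mul0r add0r subr_eq0 eqz_nat.
  have [->|] := eqVneq n j.+1; last by rewrite !mul0r mulr0.
  rewrite !mul1r mulr1 /trig_mono; case: (c) => a b /=; ring.
rewrite (eq_bigr _ (fun (j : 'I_N) _ => E j)) eqz_nat.
case: n nN {E} => [|n] nN.
  rewrite big1; last by move=> j _; rewrite mul0r.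
  by rewrite eqxx addr0 mul1r mulr1 expr0 mul1r /trig_mono mul0r cos0 sin0 mulr1 mulr0 subr0.
rewrite mul0r add0r (bigD1 (Ordinal nN))//= eqxx mul1r big1 ?addr0//.
move=> j jn; rewrite eqSS (_ : (n == j) = false) ?mul0r//.
by apply/negbTE; apply: contra jn => /eqP nj; apply/eqP/val_inj.
Qed.

(** The truncated kernels of order at least N all give the right-hand side, and
they converge uniformly to the Poisson kernel. *)
Lemma poisson_trig_poly r (c : nat -> C) N t : 0 <= r < 1 ->
  int_itv (t - pi) (t + pi) (fun s => poisson_kernel r (s - t) * trig_poly c N s) =
  2 * pi * \sum_(n < N) (r ^+ n * trig_mono (c n) n%:R t).
Proof.
move=> r01; have [_ [B tB]] := bmf_trig_poly c N.
have p0 := @pi_gt0 R.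
apply/eqP; rewrite -subr_eq0; apply/eqP.
apply: (@geometric0 (4 / (1 - r) ^+ 2 * B * (2 * pi)) r _ N r01) => M NM.
have E : int_itv (t - pi) (t + pi) (fun s => trunc_kernel r M (s - t) * trig_poly c N s) =
    2 * pi * \sum_(n < N) (r ^+ n * trig_mono (c n) n%:R t).
  rewrite (@eq_int_itv _ _ _ _ (fun s => \sum_(n < N) trunc_kernel r M (s - t) * trig_mono (c n)
    n%:R s)); last first.
    by move=> s; rewrite mulr_sumr.
  rewrite int_itv_sum; last first.
    by move=> n; apply: bmfM; [exact: bmf_trunc_kernel|exact: bmf_trig_mono].
  rewrite mulr_sumr; apply: eq_bigr => n _; apply: poisson_trig_mono.
  by rewrite (leq_trans _ NM)// ltnW.
rewrite -E -int_itvB; try (by apply: bmfM; [exact: bmf_poisson_kernel || exact: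
  bmf_trunc_kernel|exact: bmf_trig_poly]).
have -> : 4 / (1 - r) ^+ 2 * B * (2 * pi) * r ^+ M =
  (4 * r ^+ M / (1 - r) ^+ 2 * B) * ((t + pi) - (t - pi)) by ring.
apply: int_itv_bound.
- by rewrite lerD2l; lra.
- apply: bmfB; (by apply: bmfM; [exact: bmf_poisson_kernel || exact: bmf_trunc_kernel|exact: bmf_trig_poly]).
by move=> x _; rewrite -mulrBl normrM ler_pM// poisson_kernel_trunc.
Qed.

End trig.

(** * Poisson integrals at Lebesgue points *)

Section fatou_kernel.
Variable R : realType.
Local Notation mu := (@lebesgue_measure R).

Lemma cos_piquarter_ge : 2^-1 <= cos (pi / 4 : R).
Proof.
have c0 : 0 <= cos (pi / 4 : R).
  by have := @pi_gt0 R => p0; apply: cos_ge0_pihalf; apply/andP; split; lra.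
have E : cos (pi / 4 : R) ^+ 2 *+ 2 = 1.
  apply/eqP; rewrite -subr_eq0 -cos_mulr2n.
  by rewrite (_ : pi / 4 *+ 2 = pi / 2 :> R) ?cos_pihalf// -mulr_natr; field.
rewrite leNgt; apply/negP => h.
have : cos (pi / 4 : R) ^+ 2 <= 2^-1 ^+ 2 by rewrite lerXn2r ?nnegrE ?invr_ge0// ltW.
by rewrite expr2 in E *; lra.
Qed.

Lemma sin_ge_half (y : R) : 0 <= y <= pi / 4 -> y / 2 <= sin y.
Proof.
move=> /andP[y0 y4]; have p0 := @pi_gt0 R.
have [//|] := @MVT_segment R sin cos 0 y y0 (fun x _ => is_derive_sin x).
  by apply: continuous_subspaceT; exact: continuous_sin.
move=> c /[!in_itv]/= /andP[c0 cy]; rewrite sin0 !subr0 => ->.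
rewrite mulrC ler_wpM2r//; apply: le_trans cos_piquarter_ge _.
have [->//|cn] := eqVneq c (pi / 4).
apply/ltW; rewrite ltr_cos ?in_itv/=.
- by rewrite lt_def eq_sym cn/=; lra.
- by apply/andP; split; lra.
- by apply/andP; split; lra.
Qed.

(** 1 - cos s = 2 sin^2 (s/2), and sin y >= y/2 on [0, pi/4]. *)
Lemma oneBcos_ge (s : R) : `|s| <= pi -> s ^+ 2 / 32 <= 1 - cos s.
Proof.
move=> sp; rewrite -cos_norm -(ger0_norm (sqr_ge0 s)) normrX.
move: (normr_ge0 s) sp; move: `|s| => {}s s0 sp.
have p0 := @pi_gt0 R.
have h1 : s / 8 <= sin (s / 4).
  have := @sin_ge_half (s / 4).
  by rewrite (_ : s / 4 / 2 = s / 8); [apply; apply/andP; split; lra|field].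
have h2 : 2^-1 <= cos (s / 4).
  apply: le_trans cos_piquarter_ge _.
  have [->//|cn] := eqVneq s pi.
  by apply/ltW; rewrite ltr_cos ?in_itv/=; [rewrite ltr_pM2r ?invr_gt0// lt_def eq_sym cn|
    apply/andP; split; lra|apply/andP; split; lra].
have h3 : s / 8 <= sin (s / 2).
  have -> : s / 2 = s / 4 *+ 2 by rewrite -mulr_natr; field.
  rewrite sin_mulr2n -mulr_natr.
  have : 2^-1 * (s / 8) <= cos (s / 4) * sin (s / 4).
    by rewrite ler_pM// ?invr_ge0//; lra.
  by lra.
have -> : s = s / 2 *+ 2 by rewrite -mulr_natr; field.
rewrite cos_mulr2n cos2sin2 -mulr_natr.
have : (s / 8) ^+ 2 <= sin (s / 2) ^+ 2.
  by rewrite lerXn2r ?nnegrE//; lra.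
rewrite (_ : (s / 8) ^+ 2 = s ^+ 2 / 64); last by field.
rewrite (_ : (s / 2 * 2) ^+ 2 = s ^+ 2); last by field.
by lra.
Qed.

Lemma poisson_kernel_le_near (r s : R) : 0 <= r < 1 -> poisson_kernel r s <= 2 / (1 - r).
Proof.
move=> r01; have /andP[r0 r1] := r01.
have h0 : 0 < 1 - r by lra.
rewrite /poisson_kernel ler_pdivrMr ?poisson_den_gt0//.
apply: (@le_trans _ _ (2 / (1 - r) * (1 - r) ^+ 2)).
  rewrite (_ : 2 / (1 - r) * (1 - r) ^+ 2 = 2 * (1 - r)); last by field; lra.
  rewrite (_ : 1 - r ^+ 2 = (1 + r) * (1 - r)); last by ring.
  by rewrite ler_wpM2r//; lra.
by rewrite ler_wpM2l ?poisson_den_ge// divr_ge0// ltW.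
Qed.

Lemma poisson_kernel_le_far (r s a : R) : 2^-1 <= r -> r < 1 -> 0 < a -> a <= `|s| -> `|s| <= pi ->
  poisson_kernel r s <= 64 * (1 - r) / a ^+ 2.
Proof.
move=> r2 r1 a0 as_ sp.
have r01 : 0 <= r < 1 by apply/andP; split=> //; lra.
have h0 : 0 < 1 - r by lra.
have as2 : a ^+ 2 <= s ^+ 2.
  by rewrite -(real_normK (num_real s)) lerXn2r ?nnegrE// ltW.
rewrite ler_pdivlMr ?exprn_gt0// /poisson_kernel mulrAC ler_pdivrMr ?poisson_den_gt0//.
have p1 : s ^+ 2 / 32 <= poisson_den r s.
  have := oneBcos_ge sp => h.
  have -> : poisson_den r s = (1 - r) ^+ 2 + 2 * r * (1 - cos s) by rewrite /poisson_den; ring.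
  have : 1 * (s ^+ 2 / 32) <= 2 * r * (1 - cos s).
    by rewrite ler_pM//; [exact: divr_ge0 (sqr_ge0 _) _|lra].
  by have := sqr_ge0 (1 - r); lra.
apply: (@le_trans _ _ (2 * (1 - r) * s ^+ 2)).
  rewrite ler_pM ?sqr_ge0//; last first.
    rewrite (_ : 1 - r ^+ 2 = (1 + r) * (1 - r)); last by ring.
    by rewrite ler_wpM2r//; lra.
  by rewrite subr_ge0 expr_le1//; lra.
rewrite (_ : 2 * (1 - r) * s ^+ 2 = 64 * (1 - r) * (s ^+ 2 / 32)); last by field.
by rewrite ler_wpM2l//; lra.
Qed.

(** At distance about 2^k (1 - r) from the origin the kernel is of order
1 / (4^k (1 - r)). It is thus dominated by normalized indicator functions of
balls of radius 2^k (1 - r) with weights of order 2^(-k), and its integral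
against |f - f t| is controlled by averages of this function over balls. *)
Lemma poisson_kernel_dyadic (r s : R) K : 2^-1 <= r -> r < 1 -> `|s| <= pi ->
  `|s| < 2 ^+ K * (1 - r) ->
  poisson_kernel r s <= \sum_(k < K.+1) 256 / (4 ^+ k * (1 - r)) * (`|s| < 2 ^+ k * (1 - r))%R%:R.
Proof.
move=> r2 r1 sp sK; have h0 : 0 < 1 - r by lra.
have r01 : 0 <= r < 1 by apply/andP; split=> //; lra.
have ex : exists k, `|s| < 2 ^+ k * (1 - r) by exists K.
have [k sk kmin] := ex_minnP ex.
have kK : (k < K.+1)%N by rewrite ltnS kmin.
rewrite (bigD1 (Ordinal kK))//= sk mulr1.
rewrite -[leLHS]addr0 lerD//; last first.
  apply: sumr_ge0 => i _; apply: mulr_ge0; last by case: (_ < _).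
  apply: divr_ge0; first exact: ler0n.
  by apply: mulr_ge0; [exact: exprn_ge0|exact: ltW].
case: k sk kmin kK => [|k] sk kmin kK.
  rewrite expr0 mul1r; apply: le_trans (poisson_kernel_le_near _ r01) _.
  by rewrite ler_pM2r ?invr_gt0//; lra.
have ks : 2 ^+ k * (1 - r) <= `|s|.
  by rewrite leNgt; apply/negP => /kmin; rewrite ltnn.
have a0 : 0 < 2 ^+ k * (1 - r) by rewrite mulr_gt0// exprn_gt0.
apply: le_trans (poisson_kernel_le_far r2 r1 a0 ks sp) _.
rewrite exprMn -exprM mulnC exprM (_ : 2 ^+ 2 = 4 :> R); last by ring.
rewrite (exprS 4 k) le_eqVlt; apply/orP; left; apply/eqP; field.
by rewrite (gt_eqF h0) expf_neq0.
Qed.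

Lemma bmf_indic (A : set R) : measurable A -> bmf (\1_A : R -> R).
Proof.
move=> mA; split; first exact: measurable_indic.
by exists 1 => x; rewrite indicE; case: (_ \in _); rewrite ?normr1 ?normr0.
Qed.

Lemma lebesgue_ball (f : R -> R) (t rho e a b : R) : bmf f -> 0 < rho ->
  (davg f t rho <= e%:E)%E ->
  int_itv a b (fun s => \1_(ball t rho) s * `|f s - f t|) <= e * (rho *+ 2).
Proof.
move=> bf rho0.
have bphi : bmf (fun s => `|f s - f t|).
  by apply: bmf_norm; apply: bmfB => //; exact: bmf_cst.
have mb : measurable (ball t rho) by exact: measurable_ball.
have fin : (mu (ball t rho) < +oo)%E by rewrite lebesgue_measure_ball ?ltry// ltW.
have /integrableP[mphi iphi] := bmf_integrable mb fin bphi.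
rewrite /davg /iavg (lebesgue_measure_ball _ (ltW rho0)).
have r20 : 0 < rho *+ 2 by rewrite pmulrn_lgt0.
rewrite inver gt_eqF// => h.
have {h} h : (\int[mu]_(y in ball t rho) `|f y - f t|%:E <= (e * (rho *+ 2))%:E)%E.
  rewrite -(@lee_pmul2l _ (rho *+ 2)^-1%:E) ?lte_fin ?invr_gt0//.
  by rewrite -EFinM mulrCA mulVf ?gt_eqF// mulr1.
have -> : int_itv a b (fun s => \1_(ball t rho) s * `|f s - f t|) =
    \int[mu]_(y in `[a, b] `&` ball t rho) `|f y - f t|.
  rewrite Rintegral_mkcondr /int_itv; apply: eq_Rintegral => x _.
  by rewrite patchE indicE; case: ifPn => _; rewrite ?mul1r ?mul0r.
rewrite -lee_fin; apply: le_trans h.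
rewrite /Rintegral fineK.
  apply: ge0_subset_integral => //; first exact: measurableI.
apply: integrable_fin_num => //; first exact: measurableI.
apply: bmf_integrable bphi; first exact: measurableI.
by apply: le_lt_trans fin; apply: le_measure; rewrite ?inE//; exact: measurableI.
Qed.

Lemma int_poisson_kernel (r t : R) : 0 <= r < 1 ->
  int_itv (t - pi) (t + pi) (fun s => poisson_kernel r (s - t)) = 2 * pi.
Proof.
move=> r01; have := poisson_trig_poly (fun=> 1) 1 t r01.
rewrite big_ord1/= mul1r /trig_mono mul0r cos0 sin0/= mulr1 mul0r subr0 mulr1 => <-.
apply: eq_int_itv => s; rewrite /trig_poly big_ord1/= /trig_mono mul0r cos0 sin0/=.
by rewrite mulr1 mul0r subr0 mulr1.
Qed.

Lemma sum_half (K : nat) : \sum_(k < K) (2 ^- k : R) <= 2.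
Proof.
suff -> : \sum_(k < K) (2 ^- k : R) = 2 - 2 * 2 ^- K.
  by rewrite gerBl mulr_ge0// invr_ge0 exprn_ge0.
elim: K => [|K IH]; first by rewrite big_ord0 expr0 invr1; ring.
rewrite big_ord_recr/= IH exprS invfM.
by move: (2 ^- K) => x; field.
Qed.

(** The balls of radius less than delta contribute the first term, through
[poisson_kernel_dyadic] and the hypothesis on averages; the remaining part of the circle
contributes the second one, through [poisson_kernel_le_far]. *)
Lemma poisson_err (f : R -> R) (t e delta B r : R) : bmf f -> (forall x, `|f x| <= B) ->
  0 < delta -> 0 <= e ->
  (forall rho, 0 < rho -> rho < delta -> (davg f t rho <= e%:E)%E) ->
  2^-1 <= r -> r < 1 -> 1 - r < delta / 2 ->
  `|int_itv (t - pi) (t + pi) (fun s => poisson_kernel r (s - t) * f s) / (2 * pi) - f t| * (2 * pi) <=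
   1024 * e + 256 * (1 - r) / delta ^+ 2 * (2 * B) * (2 * pi).
Proof.
move=> bf fB d0 e0 leb r2 r1 rd; have p0 := @pi_gt0 R.
have r01 : 0 <= r < 1 by apply/andP; split=> //; lra.
have h0 : 0 < 1 - r by lra.
have bp := bmf_poisson_kernel t r01.
have bphi : bmf (fun s => f s - f t) by apply: bmfB => //; exact: bmf_cst.
have -> : `|int_itv (t - pi) (t + pi) (fun s => poisson_kernel r (s - t) * f s) / (2 * pi) - f t| * (2 * pi) =
   `|int_itv (t - pi) (t + pi) (fun s => poisson_kernel r (s - t) * (f s - f t))|.
  rewrite -[X in _ * X]ger0_norm; last by lra.
  rewrite -normrM mulrBl divfK; last by rewrite gt_eqF//; lra.
  rewrite -(int_poisson_kernel t r01) -int_itvZ// -int_itvB//; [|exact: bmfM|by apply: bmfM => //;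
    exact: bmf_cst].
  by congr `|_|; apply: eq_int_itv => s; ring.
(* the least K such that the ball of radius 2^K (1 - r) reaches delta / 2 *)
have [K Kd] : exists K, delta / 2 <= 2 ^+ K * (1 - r).
  have [N NE] : exists N : nat, delta / 2 / (1 - r) < N%:R.
    exists (Num.truncn (delta / 2 / (1 - r))).+1; exact: truncnS_gt.
  exists N; rewrite -ler_pdivrMr//; apply: le_trans (ltW NE) _.
  by rewrite -natrX ler_nat ltnW// ltn_expl.
pose P K := delta / 2 <= 2 ^+ K * (1 - r).
have [{}K {}Kd Kmin] := ex_minnP (ex_intro P K Kd).
have Kd' : 2 ^+ K * (1 - r) < delta.
  case: K Kd Kmin => [|K] Kd Kmin; first by move: Kd; rewrite /P expr0 mul1r; lra.
  have : 2 ^+ K * (1 - r) < delta / 2.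
    by rewrite ltNge; apply/negP => /Kmin; rewrite ltnn.
  by rewrite exprS; lra.
pose a k := 256 / (4 ^+ k * (1 - r)).
pose c := 256 * (1 - r) / delta ^+ 2.
have c0 : 0 <= c.
  apply: divr_ge0; last exact: exprn_ge0 (ltW d0).
  by apply: mulr_ge0; [exact: ler0n|exact: ltW].
have a0 k : 0 <= a k.
  apply: divr_ge0; first exact: ler0n.
  by apply: mulr_ge0; [exact: exprn_ge0|exact: ltW].
have bI k : bmf (fun s => \1_(ball t (2 ^+ k * (1 - r))) s * `|f s - f t|).
  by apply: bmfM; [apply: bmf_indic; exact: measurable_ball|exact: bmf_norm].
have bS : bmf (fun s => \sum_(k < K.+1) a k * (\1_(ball t (2 ^+ k * (1 - r))) s * `|f s - f t|)).
  by apply: bmf_sum => k; apply: bmfM => //; exact: bmf_cst.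
apply: le_trans (int_itv_norm _ _ (bmfM bp bphi)) _.
apply: (@le_trans _ _ (int_itv (t - pi) (t + pi) (fun s =>
   \sum_(k < K.+1) a k * (\1_(ball t (2 ^+ k * (1 - r))) s * `|f s - f t|) + c * (2 * B)))).
  apply: int_itv_le.
  - by apply: bmf_norm; exact: bmfM.
  - by apply: bmfD => //; exact: bmf_cst.
  move=> s; rewrite in_itv/= => /andP[s1 s2].
  have sp : `|s - t| <= pi by rewrite ler_norml; apply/andP; split; lra.
  have f2B : `|f s - f t| <= 2 * B.
    by apply: le_trans (ler_normB _ _) _; have := fB s; have := fB t; lra.
  rewrite normrM ger0_norm ?poisson_kernel_ge0//.
  under eq_bigr do rewrite mulrA.
  rewrite -mulr_suml.
  have S0 : 0 <= \sum_(i < K.+1) a i * \1_(ball t (2 ^+ i * (1 - r))) s.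
    by apply: sumr_ge0 => i _; rewrite mulr_ge0// indicE.
  have [st|st] := ltP `|s - t| (2 ^+ K * (1 - r)).
    rewrite -[leLHS]addr0 lerD//; last first.
      by rewrite mulr_ge0// (le_trans _ f2B).
    rewrite ler_wpM2r//; apply: le_trans (poisson_kernel_dyadic r2 r1 sp st) _.
    apply: ler_sum => k _; apply: ler_wpM2l; first exact: (a0 k).
    rewrite indicE; have [h|_] := boolP (`|s - t| < _) => //.
    by rewrite mem_set// -ball_normE/= distrC.
  rewrite -[leLHS]add0r lerD//; first by rewrite mulr_ge0.
  rewrite ler_pM// ?poisson_kernel_ge0//.
  apply: le_trans (poisson_kernel_le_far r2 r1 _ (le_trans Kd st) sp) _; first by lra.
  by rewrite /c le_eqVlt; apply/orP; left; apply/eqP; field; rewrite gt_eqF.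
rewrite int_itvD//; last exact: bmf_cst.
rewrite int_itv_cst; last by lra.
rewrite (_ : t + pi - (t - pi) = 2 * pi); last by ring.
rewrite lerD2r int_itv_sum; last by move=> k; apply: bmfM => //; exact: bmf_cst.
apply: (@le_trans _ _ (\sum_(k < K.+1) 512 * e * 2 ^- k)).
  apply: ler_sum => k _; rewrite int_itvZ//.
  have k0 : 0 < 2 ^+ k * (1 - r) by rewrite mulr_gt0// exprn_gt0.
  have kd : 2 ^+ k * (1 - r) < delta.
    apply: le_lt_trans Kd'; rewrite ler_pM2r// ler_eXn2l ?ltr1n//.
    by rewrite -ltnS.
  apply: le_trans (ler_wpM2l (a0 k) (lebesgue_ball _ _ bf k0 (leb _ k0 kd))) _.
  rewrite /a -mulr_natr (_ : 4 = 2 * 2); last by ring.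
  rewrite exprMn le_eqVlt; apply/orP; left; apply/eqP; field.
  by rewrite (gt_eqF h0) expf_eq0 pnatr_eq0 andbF.
rewrite -mulr_sumr; have := sum_half K.+1 => h.
by have := ler_wpM2l e0 h; move: (\sum_(i < _) _) => x; lra.
Qed.

(** Fatou's theorem at a Lebesgue point: first the averages are made small, which
fixes delta in [poisson_err], then 1 - r. *)
Lemma fatou_real (f : R -> R) (t : R) : bmf f -> lebesgue_pt f t ->
  int_itv (t - pi) (t + pi) (fun s => poisson_kernel r (s - t) * f s) / (2 * pi) @[r --> (1 : R)^'-] --> f t.
Proof.
move=> bf leb; have [_ [B0 fB0]] := bf; have p0 := @pi_gt0 R.
pose B := B0 + 1.
have B1 : 0 < B by rewrite /B ltr_wpDl// (le_trans _ (fB0 t)).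
have fB x : `|f x| <= B by rewrite /B (le_trans (fB0 x))// lerDl.
apply/cvgrPdist_le => e e0.
have [e1 e1E] : exists e1, 1024 * e1 = e by exists (e / 1024); field.
have e10 : 0 < e1 by lra.
have [d /= d0 dP] : exists2 d : R, 0 < d & forall rho, 0 < rho -> rho < d ->
    (davg f t rho <= e1%:E)%E.
  move/fine_cvgP : leb => [lf /cvgrPdist_le/(_ e1 e10) le].
  have := filterI lf le => -[d /= d0 dP].
  exists d => // rho r0 rd; have [] := dP rho _ r0.
    by rewrite /= sub0r normrN gtr0_norm.
  move=> fin; rewrite sub0r normrN => h.
  by rewrite -(fineK fin) lee_fin (le_trans _ h)// ler_norm.
(* 1 - r < eta makes the second term of poisson_err at most e pi *)
pose eta := Num.min (d / 2) (e * pi / (256 / d ^+ 2 * (2 * B) * (2 * pi))).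
have K0 : 0 < 256 / d ^+ 2 * (2 * B) * (2 * pi).
  by rewrite !mulr_gt0 ?invr_gt0 ?exprn_gt0 ?ltr0n ?B1 ?p0.
have pp : 0 < 2 * pi :> R by rewrite mulr_gt0 ?ltr0n.
near=> r.
have r1 : r < 1 by near: r; exact: nbhs_left_lt.
have r2 : 2^-1 <= r.
  by near: r; apply: nbhs_left_ge; rewrite invf_lt1 ?ltr1n.
have re : 1 - r < eta.
  near: r; apply: nbhs_left_ltBl; rewrite lt_min; apply/andP; split; first by lra.
  by apply: divr_gt0 K0; exact: mulr_gt0.
have rd : 1 - r < d / 2 by rewrite (lt_le_trans re)// ge_min lexx.
have := poisson_err bf fB d0 (ltW e10) dP r2 r1 rd.
set X := _ / (2 * pi); rewrite distrC => h.
have h2 : (1 - r) * (256 / d ^+ 2 * (2 * B) * (2 * pi)) <= e * pi.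
  by rewrite -(ler_pdivlMr _ _ K0) (ltW (lt_le_trans re _))// ge_min lexx orbT.
have h3 : 256 * (1 - r) / d ^+ 2 * (2 * B) * (2 * pi) =
  (1 - r) * (256 / d ^+ 2 * (2 * B) * (2 * pi)) by ring.
rewrite -(@ler_pM2r _ _ pp); apply: le_trans h _; rewrite h3 e1E.
rewrite (_ : e * (2 * pi) = e * pi + e * pi); last by ring.
by apply: lerD h2; rewrite ler_peMr ?(ltW e0)// (le_trans _ (@pi_ge2 R))// ler1n.
Unshelve. all: by end_near. Qed.

End fatou_kernel.

(** * Almost everywhere convergence *)

Section ae_limits.
Variable R : realType.
Local Notation mu := (@lebesgue_measure R).

Lemma ae_imp (P Q : R -> Prop) : (forall x, P x -> Q x) ->
  {ae mu, forall x, P x} -> {ae mu, forall x, Q x}.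
Proof. by move=> PQ; apply: filterS; first exact: (ae_filter_ringOfSetsType mu). Qed.

Lemma ae_and (P Q : R -> Prop) :
  {ae mu, forall x, P x} -> {ae mu, forall x, Q x} -> {ae mu, forall x, P x /\ Q x}.
Proof.
by move=> p q; apply: (@filterI _ _ (ae_filter_ringOfSetsType mu)).
Qed.

Lemma int_itv_dominated (f_ : nat -> R -> R) (f : R -> R) B a b :
  (forall k, measurable_fun setT (f_ k)) -> (forall k x, `|f_ k x| <= B) -> bmf f ->
  {ae mu, forall x, x \in `[a, b] -> f_ ^~ x @ \oo --> f x} ->
  int_itv a b (f_ k) @[k --> \oo] --> int_itv a b f.
Proof.
move=> mf fB bf cf.
have [|||||_ _ h] := @dominated_convergence _ _ _ mu `[a, b]%classic (measurable_itv _)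
   (fun k => EFin \o f_ k) (EFin \o f) (EFin \o cst B).
- by move=> k; apply/measurable_EFinP; apply: measurable_funTS; exact: mf.
- by apply/measurable_EFinP; apply: measurable_funTS; case: bf.
- apply: ae_imp cf => x h xab; apply: cvg_EFin; last exact: h.
  by apply: nearW.
- by apply: bmf_integrable_itv; exact: bmf_cst.
- by apply: aeW => x k _ /=; rewrite lee_fin.
apply: fine_cvg; rewrite fineK; first exact: h.
by apply: integrable_fin_num => //; exact: bmf_integrable_itv.
Qed.

(** The upper limit is a measurable representative of an almost everywhere limit
that is defined, and bounded, everywhere. *)
Lemma bmf_limn_sup (f_ : nat -> R -> R) B :
  (forall k, measurable_fun setT (f_ k)) -> (forall k x, `|f_ k x| <= B) ->
  bmf (fun x => limn_sup (f_ ^~ x)).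
Proof.
move=> mf fB.
have ub x : has_ubound (range (f_ ^~ x)).
  by exists B => _ [k _ <-]; rewrite (le_trans (ler_norm _)).
have lb x : has_lbound (range (f_ ^~ x)).
  by exists (- B) => _ [k _ <-]; have := fB k x; rewrite ler_norml => /andP[].
split; first by apply: measurable_fun_limn_sup.
exists B => x; rewrite ler_norml.
have cs : cvgn (sups (f_ ^~ x)) by apply/cvg_ex; eexists; exact: (cvg_sups_inf (ub x) (lb x)).
apply/andP; split.
  apply: limr_ge => //; apply: nearW => n.
  apply: (@le_trans _ _ (f_ n x)); first by have := fB n x; rewrite ler_norml => /andP[].
  by apply: ub_le_sup; [exact: has_ubound_sdrop|exists n => /=].
apply: limr_le => //; apply: nearW => n.
apply: ge_sup; first by exists (f_ n x); exists n => /=.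
by move=> _ [k _ <-]; rewrite (le_trans (ler_norm _)).
Qed.

Lemma cvg_fast (a : nat -> R) K : (forall k, `|a k.+1 - a k| <= K * 2 ^- k) -> cvgn a.
Proof.
move=> h.
have : cvgn (series (fun k => a k.+1 - a k)).
  have K0 : 0 <= K by have := le_trans (normr_ge0 _) (h 0%N); rewrite expr0 divr1.
  have g : cvgn (series (fun k => K * 2^-1 ^+ k)).
    by apply: (@is_cvg_geometric_series _ K 2^-1); rewrite ger0_norm ?invf_lt1 ?ltr1n.
  apply: normed_cvg; apply: series_le_cvg g => [n|n|n /=].
  - exact: normr_ge0.
  - by rewrite mulr_ge0 ?exprn_ge0.
  - by rewrite exprVn.
move=> /cvg_ex[l hl]; apply/cvg_ex; exists (l + a 0%N).
have : series (fun k => a k.+1 - a k) n + a 0%N @[n --> \oo] --> l + a 0%N.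
  by apply: cvgD => //; exact: cvg_cst.
apply: cvg_trans; apply: near_eq_cvg; apply: nearW => n /=.
by rewrite /series/= telescope_sumr// subrK.
Qed.

(** With errors 16^(-k) the sum of the integrals of 4^k (A_(k+1) - A_k)^2 is
finite, so its integrand is bounded in k almost everywhere, and there the
increments are O(2^(-k)). *)
Lemma ae_cvg_fast (A : nat -> R -> R) K a b : (forall k, bmf (A k)) ->
  (forall k, int_itv a b (fun x => (A k.+1 x - A k x) ^+ 2) <= K * 16 ^- k) ->
  {ae mu, forall x, x \in `[a, b] -> cvgn (A ^~ x)}.
Proof.
move=> bA AK.
have bD k : bmf (fun x => (A k.+1 x - A k x) ^+ 2).
  by under eq_fun do rewrite expr2; apply: bmfM; exact: bmfB.
pose g k x := 4 ^+ k * (A k.+1 x - A k x) ^+ 2.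
have bg k : bmf (g k) by apply: bmfM => //; exact: bmf_cst.
have g0 k x : 0 <= g k x by rewrite mulr_ge0 ?sqr_ge0 ?exprn_ge0.
have mg k : measurable_fun `[a, b] (EFin \o g k).
  by apply/measurable_EFinP; apply: measurable_funTS; case: (bg k).
have K0 : 0 <= K.
  have := AK 0%N; rewrite expr0 invr1 mulr1; apply: le_trans.
  by apply: Rintegral_ge0 => x _; exact: sqr_ge0.
have intg k : (\int[mu]_(x in `[a, b]) (g k x)%:E = (int_itv a b (g k))%:E)%E.
  rewrite /int_itv /Rintegral fineK//; apply: integrable_fin_num => //.
  exact: bmf_integrable_itv.
have intgK k : int_itv a b (g k) <= K * 2 ^- k.
  rewrite /g int_itvZ//; apply: le_trans (ler_wpM2l _ (AK k)) _; first exact: exprn_ge0.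
  rewrite mulrCA ler_wpM2l//.
  have -> : 16 ^- k = 4 ^- k * 4 ^- k :> R.
    by rewrite -invfM -exprMn; congr (_ ^- _); ring.
  rewrite mulrA divff ?mul1r ?expf_neq0// lef_pV2 ?posrE ?exprn_gt0//.
  by rewrite lerXn2r ?nnegrE// ler_nat.
have fin : (\int[mu]_(x in `[a, b]) (\sum_(k <oo) (g k x)%:E) < +oo)%E.
  rewrite integral_nneseries//; last by move=> k x _; rewrite lee_fin.
  apply: (@le_lt_trans _ _ (K * 2)%:E); last exact: ltry.
  apply: lime_le.
    by apply: is_cvg_nneseries => k _ _; rewrite intg lee_fin; apply: Rintegral_ge0 => x _.
  apply: nearW => n; rewrite (eq_bigr (fun k => (int_itv a b (g k))%:E)); last by move=> k _; rewrite intg.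
  rewrite sumEFin lee_fin; apply: (@le_trans _ _ (\sum_(0 <= k < n) K * 2 ^- k)).
    by apply: ler_sum => k _.
  by rewrite -mulr_sumr big_mkord ler_wpM2l// sum_half.
have S0 x : (0 <= \sum_(k <oo) (g k x)%:E)%E.
  by apply: nneseries_ge0 => k _ _; rewrite lee_fin.
have ig : mu.-integrable `[a, b] (fun x => \sum_(k <oo) (g k x)%:E)%E.
  apply/integrableP; split.
    apply: (@ge0_emeasurable_sum _ _ _ _ (fun k x => (g k x)%:E) xpredT) => k.
      by move=> x _ _; rewrite lee_fin.
    by move=> _; exact: mg.
  by under eq_integral do rewrite gee0_abs//.
have := @integrable_ae _ _ _ mu _ (measurable_itv `[a, b]) _ ig.
apply: ae_imp => x + xab => /(_ xab) hx.
pose M := fine (\sum_(k <oo) (g k x)%:E).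
have gM k : g k x <= M.
  rewrite -lee_fin /M fineK//.
  apply: le_trans (nneseries_lim_ge k.+1 _); last by move=> n _ _; rewrite lee_fin.
  by rewrite big_nat_recr//= leeDr// sumEFin lee_fin sumr_ge0.
have M0 : 0 <= M by exact: le_trans (g0 0%N x) (gM 0%N).
apply: (@cvg_fast _ (M + 1)) => k.
rewrite ler_pdivlMr ?exprn_gt0// -ler_sqr ?nnegrE ?mulr_ge0 ?exprn_ge0 ?addr_ge0//.
apply: le_trans (_ : M <= _); last by rewrite sqrrD1; have := sqr_ge0 M; lra.
apply: le_trans (gM k); rewrite exprMn real_normK ?num_real// mulrC /g.
by rewrite -exprM mulnC exprM; rewrite (_ : 2 ^+ 2 = 4 :> R)//; ring.
Qed.

End ae_limits.

(** * Complex numbers through real and imaginary parts *)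

Section complex_facts.
Variable R : realType.
Local Notation C := R[i].
Implicit Types (w v : C).

Definition sqabs w : R := complex.Re w ^+ 2 + complex.Im w ^+ 2.

Lemma sqabs_ge0 w : 0 <= sqabs w. Proof. by rewrite addr_ge0 ?sqr_ge0. Qed.

Lemma normr_sqabs w : `|w| ^+ 2 = (sqabs w)%:C.
Proof. by rewrite -add_Re2_Im2. Qed.

Lemma norm_le_sqabs w (c : R) : 0 <= c -> (`|w| <= c%:C) = (sqabs w <= c ^+ 2).
Proof.
move=> c0; rewrite -(@ler_pXn2r _ 2)// ?nnegrE ?ler0c// normr_sqabs -rmorphXn.
by rewrite lecR.
Qed.

Lemma norm_eq1_sqabs w : sqabs w = 1 -> `|w| = 1.
Proof.
move=> h; apply/eqP; rewrite -(@eqrXn2 _ 2) ?normr_ge0//.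
by rewrite normr_sqabs h expr1n.
Qed.

Lemma sqabsM w v : sqabs (w * v) = sqabs w * sqabs v.
Proof. by case: w v => [a b] [c d]; rewrite /sqabs /=; ring. Qed.

Lemma sqabsD_le2 w v : sqabs (w + v) <= 2 * sqabs w + 2 * sqabs v.
Proof.
case: w v => [a b] [c d]; rewrite /sqabs /=; rewrite -subr_ge0.
rewrite (_ : _ - _ = (a - c) ^+ 2 + (b - d) ^+ 2); last by ring.
by rewrite addr_ge0 ?sqr_ge0.
Qed.

Lemma sqabsN w : sqabs (- w) = sqabs w.
Proof. by case: w => a b; rewrite /sqabs /= !sqrrN. Qed.

Lemma abs_Re_sq w c : 0 <= c -> sqabs w <= c ^+ 2 -> `|complex.Re w| <= c.
Proof.
move=> c0 h; rewrite -ler_sqr ?nnegrE// real_normK ?num_real//.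
by apply: le_trans h; rewrite lerDl sqr_ge0.
Qed.

Lemma abs_Im_sq w c : 0 <= c -> sqabs w <= c ^+ 2 -> `|complex.Im w| <= c.
Proof.
move=> c0 h; rewrite -ler_sqr ?nnegrE// real_normK ?num_real//.
by apply: le_trans h; rewrite lerDr sqr_ge0.
Qed.

Lemma norm_le_ReIm w (c : R) : `|complex.Re w| + `|complex.Im w| <= c -> `|w| <= c%:C.
Proof.
move=> h; have c0 : 0 <= c by rewrite (le_trans _ h)// addr_ge0.
rewrite norm_le_sqabs// /sqabs -(real_normK (num_real (complex.Re w))) -(real_normK (num_real
  (complex.Im w))).
have := normr_ge0 (complex.Re w); have := normr_ge0 (complex.Im w) => h1 h2.
apply: (@le_trans _ _ ((`|complex.Re w| + `|complex.Im w|) ^+ 2)).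
  by rewrite sqrrD lerD2r lerDl mulrn_wge0 ?mulr_ge0.
by rewrite lerXn2r ?nnegrE ?addr_ge0.
Qed.

Lemma Re_sum I (s : seq I) (F : I -> C) :
  complex.Re (\sum_(i <- s) F i) = \sum_(i <- s) complex.Re (F i).
Proof. by elim/big_rec2: _ => // i x y _ <-; case: (F i) => ? ?; case: y. Qed.

Lemma Re_B w v : complex.Re (w - v) = complex.Re w - complex.Re v.
Proof. by case: w v => [? ?] [? ?]. Qed.

Definition cis (t : R) : C := cos t +i* sin t.

Lemma cisX t n : cis t ^+ n = cis (n%:R * t).
Proof.
elim: n => [|n IH]; first by rewrite expr0 mul0r /cis cos0 sin0.
rewrite exprS IH -natr1 mulrDl mul1r addrC /cis cosD sinD.
by apply/eqP; rewrite eq_complex /=; apply/andP; split; apply/eqP; ring.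
Qed.

Lemma trig_monoE c n (t : R) : trig_mono c n%:R t = complex.Re (c * cis t ^+ n).
Proof. by rewrite cisX /trig_mono /cis; case: c. Qed.

Lemma Re_mulNi w : complex.Re (- 'i * w) = complex.Im w.
Proof. by case: w => a b /=; ring. Qed.

Lemma sqabs_cis t : sqabs (cis t) = 1.
Proof. by rewrite /sqabs /= cos2Dsin2. Qed.

Lemma sqabs_real (x : R) : sqabs x%:C = x ^+ 2.
Proof. by rewrite /sqabs /= expr0n addr0. Qed.

Lemma norm_rcis (r t : R) : 0 <= r -> `|r%:C * cis t| = r%:C.
Proof.
move=> r0; apply/eqP; rewrite -(@eqrXn2 _ 2)// ?ler0c//.
by rewrite normr_sqabs sqabsM sqabs_cis sqabs_real mulr1 rmorphXn.
Qed.

End complex_facts.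

(** * Bounded trigonometric approximation *)

Section fatou_inner.
Variable R : realType.
Local Notation mu := (@lebesgue_measure R).
Local Notation C := R[i].
Variables (c : nat -> C) (u : disc R -> R[i]^o).
Hypothesis hc : series (fun n => sqabs (c n)) @ \oo --> (1 : R).
Hypothesis hu : forall z : disc R, power_series (E := R[i]^o) c (val z) @ \oo --> u z.
Hypothesis hb : forall z, `|u z| <= 1.

Lemma rnorm_sq (w : R[i]^o) (b : R) : 0 <= b -> sqabs w <= b ^+ 2 -> rnorm w <= b.
Proof. by move=> b0 h; rewrite -lecR -rnormE norm_le_sqabs. Qed.

Lemma sq_rnorm (w : R[i]^o) (b : R) : 0 <= b -> rnorm w <= b -> sqabs w <= b ^+ 2.
Proof. by move=> b0 h; rewrite -norm_le_sqabs// (@rnormE R R[i]^o w) lecR. Qed.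

Lemma rnormM (w v : C) : rnorm (w * v : R[i]^o) = rnorm (w : R[i]^o) * rnorm (v : R[i]^o).
Proof. by rewrite -[w * v]/(w *: (v : R[i]^o)) rnormZ. Qed.

Lemma sum_sq_le1 N : series (fun n => sqabs (c n)) N <= 1.
Proof.
apply: (@ge_lim R (series (fun n => sqabs (c n))) 1 _ N hc) => n Nn.
by apply: nondecreasing_series Nn => i _ _; exact: sqabs_ge0.
Qed.

Lemma sum_sq_tail (e : R) : 0 < e -> exists N : nat, forall M : nat, 1 - e <= series (fun n =>
  sqabs (c n)) (N + M)%N.
Proof.
move=> e0; have /cvgrPdist_le/(_ e e0)[N _ h] := hc.
exists N => M; have := h (N + M)%N (leq_addr _ _) => /=.
by rewrite ler_norml => /andP[_]; rewrite lerBlDl lerBlDr addrC.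
Qed.

Lemma sq_c_le1 n : sqabs (c n) <= 1.
Proof.
apply: le_trans (sum_sq_le1 n.+1); rewrite /series/= big_nat_recr//= lerDr.
by apply: sumr_ge0 => i _; exact: sqabs_ge0.
Qed.

Lemma polar_point_lt1 (r t : R) (r01 : 0 <= r < 1) : `|r%:C * cis t| < 1.
Proof.
have /andP[r0 r1] := r01.
by rewrite norm_rcis// -[1]/(1%:C) ltcR.
Qed.

Definition polar_point (r t : R) (r01 : 0 <= r < 1) : disc R :=
  exist _ (r%:C * cis t) (polar_point_lt1 t r01).

Lemma rnorm_z (r t : R) n : 0 <= r -> rnorm ((r%:C * cis t) ^+ n : R[i]^o) = r ^+ n.
Proof. by move=> r0; rewrite /rnorm normrX norm_rcis// -rmorphXn. Qed.

(** The first K coefficients agree, so only the tail of a geometric series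
remains. *)
Lemma pser_close (d : nat -> C) N b (r t : R) (r01 : 0 <= r < 1) K : 0 <= b ->
  (forall n, (K <= n)%N -> sqabs (c n - d n) <= b ^+ 2) ->
  (forall n, (n < K)%N -> d n = c n) ->
  (forall n, (N <= n)%N -> d n = 0) -> (K <= N)%N ->
  rnorm (u (polar_point t r01) - \sum_(n < N) (r%:C * cis t) ^+ n * d n : R[i]^o) <= b * (r ^+ K / (1 - r)).
Proof.
move=> b0 cd dK dN KN; have /andP[r0 r1] := r01.
have key := @rnorm_cvg_le R R[i]^o _ _ (\sum_(n < N) (r%:C * cis t) ^+ n * d n : R[i]^o)
  (b * (r ^+ K / (1 - r))) N (@hu (polar_point t r01)).
apply: key => M NM.
rewrite /power_series /series/= -(big_mkord xpredT (fun n => (r%:C * cis t) ^+ n * d n)).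
rewrite (_ : \sum_(0 <= i < N) _ = \sum_(0 <= i < M) (r%:C * cis t) ^+ i * d i); last first.
  rewrite [RHS](big_cat_nat (leq0n N) NM)//= [X in _ = _ + X]big_nat [X in _ = _ + X]big1 ?addr0//.
  by move=> n /andP[/dN -> _]; rewrite mulr0.
rewrite -[X in rnorm X]/((\sum_(0 <= k < M) (r%:C * cis t) ^+ k * c k -
    \sum_(0 <= i < M) (r%:C * cis t) ^+ i * d i) : R[i]).
rewrite -sumrB (big_cat_nat (leq0n K) (leq_trans KN NM))//= big_nat big1 ?add0r; last first.
  by move=> n /andP[_ nK]; rewrite dK// subrr.
apply: le_trans (rnorm_sum _ _ _) _.
apply: (@le_trans _ _ (\sum_(K <= n < M) b * r ^+ n)).
  rewrite big_nat [leRHS]big_nat; apply: ler_sum => n /andP[Kn _].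
  rewrite -mulrBr rnormM rnorm_z// mulrC ler_wpM2r ?exprn_ge0//.
  by rewrite rnorm_sq// cd.
by rewrite -mulr_sumr ler_wpM2l// geo_sum.
Qed.

Lemma bernoulli1 (rho : R) n : 0 <= rho <= 1 -> 1 - rho ^+ n <= n%:R * (1 - rho).
Proof.
move=> /andP[r0 r1]; elim: n => [|n IH]; first by rewrite expr0 subrr mul0r.
rewrite (_ : 1 - rho ^+ n.+1 = 1 - rho ^+ n + rho ^+ n * (1 - rho)); last by rewrite exprS; ring.
rewrite -natr1 mulrDl mul1r lerD//.
by rewrite -[leRHS]mul1r ler_wpM2r ?subr_ge0// exprn_ile1.
Qed.

Lemma Re_psum (d : nat -> C) N (q : C) (r t : R) :
  complex.Re (q * \sum_(n < N) (r%:C * cis t) ^+ n * d n) =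
  \sum_(n < N) r ^+ n * trig_mono (q * d n) n%:R t.
Proof.
rewrite mulr_sumr Re_sum; apply: eq_bigr => n _.
rewrite trig_monoE exprMn -rmorphXn.
set x := _ ^+ n; set y := cis t ^+ n.
have -> : q * (x%:C * y * d n) = x%:C * (q * d n * y) by ring.
by case: (q * d n * y) => a b /=; ring.
Qed.

(** Dilate u by rho < 1 and truncate its series at order N. The dilation is bounded
by 1, and truncation changes it by at most rho^N / (1 - rho) <= 1; hence the
bound 2. The coefficients change little in l^2 as rho tends to 1. The factor q
is there for the real and imaginary parts, which are q = 1 and q = - i. *)
Lemma trig_approx (eps : R) : 0 < eps -> exists d : (nat -> C) * nat,
  [/\ forall n, (d.2 <= n)%N -> d.1 n = 0,
      forall q t, sqabs q = 1 -> `|trig_poly (fun n => q * d.1 n) d.2 t| <= 2,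
      forall M, \sum_(n < M) sqabs (c n - d.1 n) <= eps &
      forall n, sqabs (c n - d.1 n) <= eps].
Proof.
move=> eps0.
suff [d [h1 h2 h3]] : exists d : (nat -> C) * nat, [/\ forall n, (d.2 <= n)%N -> d.1 n = 0,
      forall q t, sqabs q = 1 -> `|trig_poly (fun n => q * d.1 n) d.2 t| <= 2 &
      forall M, \sum_(n < M) sqabs (c n - d.1 n) <= eps].
  exists d; split => // n; apply: le_trans (h3 n.+1); rewrite big_ord_recr/= lerDr.
  by apply: sumr_ge0 => i _; exact: sqabs_ge0.
have e20 : 0 < eps / 2 by rewrite divr_gt0.
have [N0 N0h] := sum_sq_tail e20.
(* del = 1 - rho must make the first N0 coefficients change by less than eps / 2 *)
pose del := Num.min 2^-1 (eps / 2 / (N0%:R ^+ 2 + 1)).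
have N1 : 0 < N0%:R ^+ 2 + 1 :> R by rewrite ltr_wpDl ?sqr_ge0.
have del0 : 0 < del by rewrite lt_min invr_gt0 ltr0n divr_gt0.
have del2 : del <= 2^-1 by rewrite ge_min lexx.
have delN : del * (N0%:R ^+ 2 + 1) <= eps / 2 by rewrite -ler_pdivlMr// ge_min lexx orbT.
pose rho := 1 - del.
have rho01 : 0 <= rho < 1 by rewrite /rho; apply/andP; split; lra.
have /andP[rho0 rho1] := rho01.
have [N N0N Nh] : exists2 N, (N0 <= N)%N & rho ^+ N / (1 - rho) <= 1.
  have : rho ^+ n @[n --> \oo] --> 0 by apply: cvg_expr; rewrite ger0_norm.
  have r10 : 0 < 1 - rho by rewrite subr_gt0.
  move/cvgrPdist_le => /(_ _ r10)[N _ h]; exists (maxn N0 N); first exact: leq_maxl.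
  rewrite ler_pdivrMr// mul1r; have := h (maxn N0 N) (leq_maxr _ _).
  by rewrite /= sub0r normrN ger0_norm ?exprn_ge0.
pose d n := if (n < N)%N then (rho ^+ n)%:C * c n else 0.
exists (d, N); split => /=.
- by move=> n Nn; rewrite /d ltnNge Nn.
- move=> q t q1.
  have E : trig_poly (fun n => q * d n) N t = complex.Re (q * \sum_(n < N) (rho%:C * cis t) ^+ n * c n).
    rewrite Re_psum; apply: eq_bigr => n _; rewrite /d ltn_ord.
    rewrite !trig_monoE; set y := cis t ^+ n; set x := rho ^+ n.
    have -> : q * (x%:C * c n) * y = x%:C * (q * c n * y) by ring.
    by case: (q * c n * y) => a b /=; ring.
  rewrite E; apply: abs_Re_sq => //; rewrite sqabsM q1 mul1r.
  apply: sq_rnorm => //.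
  pose d' n := if (n < N)%N then c n else 0.
  have := @pser_close d' N 1 rho t rho01 N ler01.
  have -> : \sum_(n < N) (rho%:C * cis t) ^+ n * d' n = \sum_(n < N) (rho%:C * cis t) ^+ n * c n.
    by apply: eq_bigr => n _; rewrite /d' ltn_ord.
  move=> h; set P := \sum_(n < N) _.
  have {}h : rnorm (u (polar_point t rho01) - P : R[i]^o) <= 1.
    apply: le_trans (h _ _ _ (leqnn N)) _; rewrite ?mul1r//.
    - by move=> n Nn; rewrite /d' ltnNge Nn/= subr0 expr1n sq_c_le1.
    - by move=> n nN; rewrite /d' nN.
    - by move=> n Nn; rewrite /d' ltnNge Nn.
  have hb1 : rnorm (u (polar_point t rho01)) <= 1 by rewrite -lecR -rnormE; exact: hb.
  rewrite -[P](subrK (u (polar_point t rho01))); apply: le_trans (rnormD _ _) _.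
  by rewrite rnormB; lra.
- move=> M.
  have term n : sqabs (c n - d n) <= eps / 2 * sqabs (c n) + (N0 <= n)%N%:R * sqabs (c n).
    have [N0n|nN0] := leqP N0 n.
      rewrite mul1r -[leLHS]add0r lerD ?mulr_ge0 ?sqabs_ge0 ?(ltW e20) ?(ltW eps0)//.
      rewrite /d; case: ifP => _; last by rewrite subr0.
      rewrite -[X in X - _]mul1r -[X in X * _ - _]/(1%:C) -mulrBl -rmorphB/= sqabsM sqabs_real.
      rewrite -[leRHS]mul1r ler_wpM2r ?sqabs_ge0// expr_le1//.
        by rewrite gerBl exprn_ge0.
      by rewrite subr_ge0 exprn_ile1// ltW.
    rewrite mul0r addr0 /d (leq_trans nN0 N0N).
    rewrite -[X in X - _]mul1r -[X in X * _ - _]/(1%:C) -mulrBl -rmorphB/= sqabsM sqabs_real.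
    rewrite ler_wpM2r ?sqabs_ge0//.
    have b1 := @bernoulli1 rho n; rewrite {1}rho0 (ltW rho1) /= in b1.
    have b2 : 1 - rho ^+ n <= N0%:R * del.
      apply: le_trans (b1 isT) _; rewrite /rho opprB addrC subrK.
      by rewrite ler_wpM2r ?(ltW del0)// ler_nat ltnW.
    have b3 : 0 <= 1 - rho ^+ n by rewrite subr_ge0 exprn_ile1// ltW.
    have b4 : (1 - rho ^+ n) ^+ 2 <= (N0%:R * del) ^+ 2 by rewrite lerXn2r ?nnegrE// (le_trans b3).
    apply: le_trans b4 _; rewrite exprMn.
    have b5 : del ^+ 2 <= del.
      by rewrite expr2 -[leRHS]mulr1 ler_wpM2l ?(ltW del0)//; lra.
    have b6 : N0%:R ^+ 2 * del ^+ 2 <= N0%:R ^+ 2 * del by rewrite ler_wpM2l ?sqr_ge0.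
    by lra.
  apply: le_trans (ler_sum _ (fun (n : 'I_M) _ => term n)) _.
  rewrite big_split/= -mulr_sumr.
  have h1 : \sum_(n < M) sqabs (c n) <= 1.
    by have := sum_sq_le1 M; rewrite /series/= big_mkord.
  have h2 : \sum_(n < M) (N0 <= n)%N%:R * sqabs (c n) + series (fun n => sqabs (c n)) N0 =
            series (fun n => sqabs (c n)) (maxn M N0).
    elim: M {h1} => [|M IH]; first by rewrite big_ord0 add0r max0n.
    rewrite big_ord_recr/= addrAC IH.
    have [N0M|MN0] := leqP N0 M.
      rewrite mul1r (maxn_idPl (leqW N0M)).
      by rewrite /series/= [RHS]big_nat_recr.
    by rewrite mul0r addr0 (maxn_idPr MN0).
  have := sum_sq_le1 (maxn M N0); rewrite -h2.
  have := N0h 0%N; rewrite addn0.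
  have := ler_wpM2l (ltW e20) h1.
  by lra.
Qed.

End fatou_inner.

(** * Boundary values of inner power series *)

Section fatou_main.
Variable R : realType.
Local Notation mu := (@lebesgue_measure R).
Local Notation C := R[i].
Variables (c : nat -> C) (u : disc R -> R[i]^o).
Hypothesis hc : series (fun n => sqabs (c n)) @ \oo --> (1 : R).
Hypothesis hu : forall z : disc R, power_series (E := R[i]^o) c (val z) @ \oo --> u z.
Hypothesis hb : forall z, `|u z| <= 1.

Variable dN : nat -> (nat -> C) * nat.
Hypothesis d0 : forall k n, ((dN k).2 <= n)%N -> (dN k).1 n = 0.
Hypothesis d2 : forall k q t, sqabs q = 1 -> `|trig_poly (fun n => q * (dN k).1 n) (dN k).2 t| <= 2.
Hypothesis dS : forall k M, \sum_(n < M) sqabs (c n - (dN k).1 n) <= 16 ^- k.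

Let A q k t := trig_poly (fun n => q * (dN k).1 n) (dN k).2 t.
(** The boundary function of Re (q u). *)
Let f q t := limn_sup (A q ^~ t).

(** Coefficient sequences that vanish from N on can be compared at any larger
order. *)
Lemma trig_poly_widen (e : nat -> C) N M t : (N <= M)%N -> (forall n, (N <= n)%N -> e n = 0) ->
  trig_poly e M t = trig_poly e N t.
Proof.
move=> NM e0; rewrite /trig_poly -(big_mkord xpredT (fun n => trig_mono (e n) n%:R t)).
rewrite (big_cat_nat (leq0n N) NM)//= [X in _ + X]big_nat [X in _ + X]big1 ?addr0 ?big_mkord//.
by move=> n /andP[/e0 -> _]; rewrite /trig_mono /= !mul0r subrr.
Qed.

Lemma trig_polyB (e e' : nat -> C) M t : trig_poly e M t - trig_poly e' M t = trig_poly (fun n => e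
  n - e' n) M t.
Proof.
rewrite /trig_poly -sumrB; apply: eq_bigr => n _.
by rewrite /trig_mono; case: (e n) => a b; case: (e' n) => a' b' /=; ring.
Qed.

Let bA q k : bmf (A q k). Proof. exact: bmf_trig_poly. Qed.

Lemma A_fast q k : sqabs q = 1 ->
  int_itv (- pi) (- pi + 2 * pi * 2%:R) (fun x => (A q k.+1 x - A q k x) ^+ 2) <= 16 * pi * 16 ^- k.
Proof.
move=> q1; pose M := maxn (dN k).2 (dN k.+1).2.
pose e n := q * ((dN k.+1).1 n - (dN k).1 n).
have AE x : A q k.+1 x - A q k x = trig_poly e M x.
  rewrite /A -(@trig_poly_widen _ _ M) ?leq_maxr//; last by move=> n /d0 ->; rewrite mulr0.
  rewrite -(@trig_poly_widen _ (dN k).2 M) ?leq_maxl//; last by move=> n /d0 ->; rewrite mulr0.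
  by rewrite trig_polyB /trig_poly; apply: eq_bigr => n _; rewrite /e mulrBr.
apply: (@le_trans _ _ (int_itv (- pi) (- pi + 2 * pi * 2%:R)
   (fun t => trig_poly e M t * trig_poly e M t + trig_poly (fun n => - 'i * e n) M t * trig_poly
     (fun n => - 'i * e n) M t))).
  apply: int_itv_le.
  - by under eq_fun do rewrite expr2; apply: bmfM; exact: bmfB.
  - by apply: bmfD; apply: bmfM; exact: bmf_trig_poly.
  by move=> x _; rewrite AE expr2 lerDl -expr2 sqr_ge0.
rewrite parseval//.
have Ee n : complex.Re (e n * (e n)^*) = sqabs ((dN k.+1).1 n - (dN k).1 n).
  rewrite -[RHS]mul1r -q1 -sqabsM -/(e n); case: (e n) => a b; rewrite /sqabs /=; ring.
rewrite (eq_bigr _ (fun (n : 'I_M) _ => Ee n)).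
have p0 := @pi_gt0 R.
have k0 : 0 < 16 ^- k :> R by rewrite invr_gt0 exprn_gt0// ltr0n.
have h : \sum_(n < M) sqabs ((dN k.+1).1 n - (dN k).1 n) <= 4 * 16 ^- k.
  apply: (@le_trans _ _ (\sum_(n < M) (2 * sqabs (c n - (dN k.+1).1 n) + 2 * sqabs (c n - (dN k).1 n)))).
    apply: ler_sum => n _.
    have -> : (dN k.+1).1 n - (dN k).1 n = - (c n - (dN k.+1).1 n) + (c n - (dN k).1 n) by ring.
    by apply: le_trans (sqabsD_le2 _ _) _; rewrite sqabsN.
  rewrite big_split/= -!mulr_sumr.
  have := dS k M; have := dS k.+1 M.
  have : 16 ^- k.+1 <= 16 ^- k :> R.
    rewrite lef_pV2 ?posrE ?exprn_gt0 ?ltr0n// ler_weXn2l ?leqnSn//.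
    by rewrite ler1n.
  by lra.
have : 2 * pi * 2%:R * \sum_(n < M) sqabs ((dN k.+1).1 n - (dN k).1 n) <= 2 * pi * 2%:R * (4 * 16 ^- k).
  by rewrite ler_wpM2l// !mulr_ge0// ltW.
move/le_trans; apply; rewrite le_eqVlt; apply/orP; left; apply/eqP; ring.
Qed.

Lemma A_cvg q : sqabs q = 1 ->
  {ae mu, forall x, x \in `[- pi, - pi + 2 * pi * 2%:R] -> A q k x @[k --> \oo] --> f q x}.
Proof.
move=> q1; apply: ae_imp (ae_cvg_fast (bA q) (fun k => A_fast k q1)) => x h xD.
by rewrite /f cvg_limn_supE ?h//; exact: h.
Qed.

Lemma bmf_f q : sqabs q = 1 -> bmf (f q).
Proof.
move=> q1; apply: (@bmf_limn_sup _ _ 2) => [k|k x]; last exact: d2.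
by case: (bA q k).
Qed.

Lemma pow4_16 k : 16 ^- k = (4 ^- k) ^+ 2 :> R.
Proof. by rewrite -!exprVn -[in RHS]exprM mulnC exprM; congr (_ ^+ _); field. Qed.

Lemma sqabsD_le (e : R) (w v : C) : 0 < e ->
  sqabs (w + v) <= (1 + e) * sqabs w + (1 + e^-1) * sqabs v.
Proof.
move=> e0; case: w v => [a b] [a' b']; rewrite /sqabs /= -subr_ge0.
rewrite (_ : _ - _ = ((e * a - a') ^+ 2 + (e * b - b') ^+ 2) / e); last first.
  by field; rewrite gt_eqF.
by rewrite divr_ge0 ?addr_ge0 ?sqr_ge0// ltW.
Qed.

Lemma cvg_4k (K : R) : K * 4 ^- k @[k --> \oo] --> (0 : R).
Proof.
rewrite -[X in _ --> X](mulr0 K); apply: cvgM; first exact: cvg_cst.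
under eq_fun do rewrite -exprVn.
by apply: cvg_expr; rewrite ger0_norm ?invr_ge0 ?ler0n// invf_lt1 ?ltr1n ?ltr0n.
Qed.

Lemma cvg_le0 (x : nat -> R) (l : R) (b : nat -> R) : b @ \oo --> (0 : R) ->
  (forall k, `|l - x k| <= b k) -> x @ \oo --> l.
Proof.
move=> b0 h; apply/cvgrPdist_le => e e0.
have /cvgrPdist_le/(_ e e0) := b0; apply: filterS => k /=.
by rewrite sub0r normrN => bk; apply: le_trans (h k) (le_trans (ler_norm _) bk).
Qed.

(** Both sides are limits of the same quantity for the approximating
trigonometric polynomials: dominated convergence on the left, convergence of
the power series inside the disc on the right. *)
Lemma poisson_u q (r t : R) (r01 : 0 <= r < 1) : sqabs q = 1 -> 0 <= t <= 2 * pi ->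
  int_itv (t - pi) (t + pi) (fun s => poisson_kernel r (s - t) * f q s) / (2 * pi) =
  complex.Re (q * u (polar_point t r01)).
Proof.
move=> q1 /andP[t0 t2]; have p0 := @pi_gt0 R; have /andP[r0 r1] := r01.
have c1 : int_itv (t - pi) (t + pi) (fun s => poisson_kernel r (s - t) * A q k s) @[k --> \oo] -->
          int_itv (t - pi) (t + pi) (fun s => poisson_kernel r (s - t) * f q s).
  have bp := bmf_poisson_kernel t r01; have [mp [B pB]] := bp.
  apply: (@int_itv_dominated _ _ _ (B * 2)) => [k|k x||].
  - by have [] := bmfM bp (bA q k).
  - by rewrite normrM ler_pM// d2.
  - by apply: bmfM => //; exact: bmf_f.
  apply: ae_imp (A_cvg q1) => x h; rewrite in_itv/= => /andP[x1 x2].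
  apply: cvgM; first exact: cvg_cst.
  by apply: h; rewrite in_itv/=; apply/andP; split; lra.
have c2 : int_itv (t - pi) (t + pi) (fun s => poisson_kernel r (s - t) * A q k s) @[k --> \oo] -->
          2 * pi * complex.Re (q * u (polar_point t r01)).
  apply: (cvg_le0 (cvg_4k (2 * pi * (r ^+ 0 / (1 - r))))) => k.
  rewrite /A poisson_trig_poly// -Re_psum -mulrBr normrM gtr0_norm; last by rewrite mulr_gt0.
  rewrite -mulrA ler_wpM2l//; first by rewrite mulr_ge0// ltW.
  rewrite -Re_B -mulrBr; apply: abs_Re_sq.
    by rewrite !mulr_ge0 ?invr_ge0 ?exprn_ge0 ?subr_ge0 ?ler0n// ltW.
  rewrite sqabsM q1 mul1r; apply: sq_rnorm.
    by rewrite !mulr_ge0 ?invr_ge0 ?exprn_ge0 ?subr_ge0 ?ler0n// ltW.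
  rewrite [leRHS]mulrC; apply: (pser_close (@hu)) => [|n _|n|n|].
  - by rewrite invr_ge0 exprn_ge0// ler0n.
  - rewrite -pow4_16; apply: le_trans (dS k n.+1).
    by rewrite big_ord_recr/= lerDr; apply: sumr_ge0 => i _; exact: sqabs_ge0.
  - by rewrite ltn0.
  - exact: d0.
  - exact: leq0n.
have E : int_itv (t - pi) (t + pi) (fun s => poisson_kernel r (s - t) * f q s) = 2 * pi *
  complex.Re (q * u (polar_point t r01)).
  by rewrite -(cvg_lim (@Rhausdorff R) c1) (cvg_lim (@Rhausdorff R) c2).
by rewrite E mulrC mulKf// mulf_neq0// gt_eqF.
Qed.

Lemma radialE (t r : R) (r01 : 0 <= r < 1) : radial u t r = u (polar_point t r01).
Proof.
rewrite /radial; case: insubP => [z _ zE|].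
  by congr u; apply: val_inj; rewrite zE.
by have := polar_point_lt1 t r01; rewrite /cis => ->.
Qed.

Lemma radial_lim q (t : R) : sqabs q = 1 -> 0 <= t <= 2 * pi -> lebesgue_pt (f q) t ->
  complex.Re (q * radial u t r) @[r --> (1 : R)^'-] --> f q t.
Proof.
move=> q1 t2 leb; have := fatou_real (bmf_f q1) leb.
apply: cvg_trans; apply: near_eq_cvg; near=> r.
have r01 : 0 <= r < 1.
  apply/andP; split; near: r; last exact: nbhs_left_lt.
  exact: nbhs_left_ge.
by rewrite (radialE t r01) -poisson_u.
Unshelve. all: by end_near. Qed.

Lemma bmf_loc (g : R -> R) : bmf g -> locally_integrable setT g.
Proof.
move=> bg; split; [by case: bg|exact: openT|].
move=> K _ cK.
have := bmf_integrable (compact_measurable cK) (compact_finite_measure cK) bg.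
by move=> /integrableP[_].
Qed.

(** By Parseval the integral equals 2 pi sum |c_n|^2 = 2 pi. *)
Lemma int_f2 : 2 * pi <= int_itv 0 (2 * pi) (fun s => f 1 s ^+ 2 + f (- 'i) s ^+ 2).
Proof.
have p0 := @pi_gt0 R.
have s1 : sqabs (1 : C) = 1 by rewrite /sqabs /= expr1n expr0n addr0.
have si : sqabs (- 'i : C) = 1 by rewrite /sqabs /= oppr0 expr0n sqrrN expr1n add0r.
pose S k := \sum_(n < (dN k).2) sqabs ((dN k).1 n).
have S0 k : 0 <= S k by apply: sumr_ge0 => n _; exact: sqabs_ge0.
have bA2 q k : bmf (fun s => A q k s ^+ 2).
  by under eq_fun do rewrite expr2; apply: bmfM.
have c1 : int_itv 0 (2 * pi) (fun s => A 1 k s ^+ 2 + A (- 'i) k s ^+ 2) @[k --> \oo] -->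
     int_itv 0 (2 * pi) (fun s => f 1 s ^+ 2 + f (- 'i) s ^+ 2).
  apply: (@int_itv_dominated _ _ _ (2 ^+ 2 + 2 ^+ 2)) => [k|k x||].
  - by have [] := bmfD (bA2 1 k) (bA2 (- 'i) k).
  - rewrite ger0_norm ?addr_ge0 ?sqr_ge0// lerD//.
      by rewrite -(real_normK (num_real _)) lerXn2r ?nnegrE ?normr_ge0// d2.
    by rewrite -(real_normK (num_real _)) lerXn2r ?nnegrE ?normr_ge0// d2.
  - by apply: bmfD; under eq_fun do rewrite expr2; apply: bmfM; exact: bmf_f.
  apply: ae_imp (ae_and (A_cvg s1) (A_cvg si)) => x [h1 h2] xI.
  have xD : x \in `[(- pi), (- pi + 2 * pi * 2%:R)].
    by move: xI; rewrite !in_itv/= => /andP[x1 x2]; apply/andP; split; lra.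
  exact: (cvgD (cvg_sq (h1 xD)) (cvg_sq (h2 xD))).
have E k : int_itv 0 (2 * pi) (fun s => A 1 k s ^+ 2 + A (- 'i) k s ^+ 2) = 2 * pi * S k.
  have := parseval (dN k).1 (dN k).2 0 (ltn0Sn 0).
  rewrite add0r !mulr1 (_ : \sum_(n < _) _ = S k); last first.
    by apply: eq_bigr => n _; case: ((dN k).1 n) => a b; rewrite /sqabs /=; ring.
  move=> <-; apply: eq_int_itv => t; rewrite !expr2 /A; congr (_ + _).
  by congr (_ * _); rewrite /trig_poly; apply: eq_bigr => n _; rewrite mul1r.
have c2 : 2 * pi * S k @[k --> \oo] --> int_itv 0 (2 * pi) (fun s => f 1 s ^+ 2 + f (- 'i) s ^+ 2).
  by apply: cvg_trans c1; apply: near_eq_cvg; apply: nearW => k; rewrite E.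
(* |c|^2 <= (1 + 4^-k) |d|^2 + (1 + 4^k) |c - d|^2, and the last term is small *)
have low k : 1 - 2 * 4 ^- k <= S k + 4 ^- k * S k.
  rewrite lerBlDr.
  have e0 : 0 < 4 ^- k :> R by rewrite invr_gt0 exprn_gt0// ltr0n.
  apply: (le_rnorm_lim (N := (dN k).2) hc) => M NM.
  rewrite /series/= big_mkord.
  have SM : \sum_(n < M) sqabs ((dN k).1 n) = S k.
    rewrite /S -!(big_mkord xpredT (fun n => sqabs ((dN k).1 n))) (big_cat_nat (leq0n _) NM)//=.
    rewrite [X in _ + X]big_nat [X in _ + X]big1 ?addr0//.
    by move=> n /andP[/d0 -> _]; rewrite /sqabs /= expr0n addr0.
  apply: (@le_trans _ _ (\sum_(n < M) ((1 + 4 ^- k) * sqabs ((dN k).1 n) + (1 + (4 ^- k)^-1) *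
    sqabs (c n - (dN k).1 n)))).
    apply: ler_sum => n _; rewrite -[X in sqabs X <= _](subrK ((dN k).1 n)) addrC.
    exact: sqabsD_le.
  rewrite big_split/= -!mulr_sumr SM.
  have h1 : (1 + (4 ^- k)^-1) * \sum_(n < M) sqabs (c n - (dN k).1 n) <= (1 + (4 ^- k)^-1) * 16 ^- k.
    by rewrite ler_wpM2l// addr_ge0// invr_ge0 ltW.
  have h2 : (1 + (4 ^- k)^-1) * 16 ^- k <= 2 * 4 ^- k :> R.
    rewrite pow4_16 (_ : _ * _ = 4 ^- k * 4 ^- k + 4 ^- k).
      have : 4 ^- k * 4 ^- k <= 4 ^- k * 1 :> R.
        by rewrite (ler_pM2l e0) invf_le1 ?exprn_gt0 ?ltr0n// exprn_ege1// ler1n.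
      by move: (4 ^- k) => x; lra.
    by move: (4 ^- k) e0 => x x0; field; rewrite gt_eqF.
  by move: h1 h2; move: (4 ^- k) (\sum_(n < M) _) => x y; lra.
have c3 : (2 * pi * (S k) + 4 ^- k * (2 * pi * S k) + 2 * pi * 2 * 4 ^- k) @[k --> \oo] -->
   int_itv 0 (2 * pi) (fun s => f 1 s ^+ 2 + f (- 'i) s ^+ 2) + 0 * int_itv 0 (2 * pi) (fun s => f
     1 s ^+ 2 + f (- 'i) s ^+ 2) + 0.
  apply: cvgD; last exact: cvg_4k.
  apply: cvgD => //; apply: cvgM => //.
  have := cvg_4k 1; apply: cvg_trans; apply: near_eq_cvg; apply: nearW => k.
  by rewrite mul1r.
rewrite mul0r !addr0 in c3.
apply: (ge_lim (N := 0) c3) => k _.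
have := low k; move: (4 ^- k) (S k) => x y h.
rewrite (_ : _ + _ = 2 * pi * (y + x * y + 2 * x)); last by ring.
rewrite -[leLHS]mulr1 ler_wpM2l//; last by lra.
by rewrite mulr_ge0// ltW.
Qed.

Let s1 : sqabs (1 : C) = 1. Proof. by rewrite /sqabs /= expr1n expr0n addr0. Qed.
Let si : sqabs (- 'i : C) = 1.
Proof. by rewrite /sqabs /= oppr0 expr0n sqrrN expr1n add0r. Qed.

Lemma ae_good : {ae mu, forall t, lebesgue_pt (f 1) t /\ lebesgue_pt (f (- 'i)) t}.
Proof.
by apply: ae_and; apply: lebesgue_differentiation; apply: bmf_loc; exact: bmf_f.
Qed.

Lemma cvg_complex (T : Type) (F : set_system T) (FF : Filter F) (g : T -> C) (a b : R) :
  complex.Re (g x) @[x --> F] --> a -> complex.Im (g x) @[x --> F] --> b ->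
  (g : T -> R[i]^o) @ F --> (a +i* b : R[i]^o).
Proof.
move=> ga gb; apply/cvgrPdist_le => e e0.
have eE : e = (complex.Re e)%:C.
  by case: e e0 => x y; rewrite ltcE /= => /andP[/eqP -> _].
have e1 : 0 < complex.Re e / 2.
  by rewrite divr_gt0//; move: e0; rewrite {1}eE ltcR.
have /cvgrPdist_le/(_ _ e1) := ga; have /cvgrPdist_le/(_ _ e1) := gb.
apply: filterS2 => x h1 h2; rewrite eE.
apply: norm_le_ReIm; case: (g x) h1 h2 => p q /=.
by lra.
Qed.

Lemma radial_cvg t : 0 <= t <= 2 * pi -> lebesgue_pt (f 1) t -> lebesgue_pt (f (- 'i)) t ->
  radial u t r @[r --> (1 : R)^'-] --> (f 1 t +i* f (- 'i) t : R[i]^o).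
Proof.
move=> t2 l1 l2; apply: cvg_complex.
  have := radial_lim s1 t2 l1; apply: cvg_trans; apply: near_eq_cvg.
  by apply: nearW => r; rewrite mul1r.
have := radial_lim si t2 l2; apply: cvg_trans; apply: near_eq_cvg.
by apply: nearW => r; rewrite Re_mulNi.
Qed.

Lemma f2_le1 t : 0 <= t <= 2 * pi -> lebesgue_pt (f 1) t -> lebesgue_pt (f (- 'i)) t ->
  f 1 t ^+ 2 + f (- 'i) t ^+ 2 <= 1.
Proof.
move=> t2 l1 l2.
have h : complex.Re (1 * radial u t r) ^+ 2 + complex.Re (- 'i * radial u t r) ^+ 2
    @[r --> (1 : R)^'-] --> f 1 t ^+ 2 + f (- 'i) t ^+ 2.
  have h1 := radial_lim s1 t2 l1; have h2 := radial_lim si t2 l2.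
  exact: (cvgD (cvgM h1 h1) (cvgM h2 h2)).
have <- := cvg_lim (@Rhausdorff R) h.
apply: limr_le; first by apply/cvg_ex; eexists; exact: h.
near=> r.
have r01 : 0 <= r < 1.
  apply/andP; split; near: r; last exact: nbhs_left_lt.
  exact: nbhs_left_ge.
rewrite (radialE t r01) mul1r Re_mulNi.
have := hb (polar_point t r01); rewrite -[1]/(1%:C) norm_le_sqabs// expr1n.
by [].
Unshelve. all: by end_near. Qed.

(** |u| <= 1 gives f_1^2 + f_(-i)^2 <= 1 at Lebesgue points, and the integral of
1 - (f_1^2 + f_(-i)^2) is at most 0. *)
Lemma ae_unimodular :
  {ae mu, forall t, t \in `[0, 2 * pi] -> f 1 t ^+ 2 + f (- 'i) t ^+ 2 = 1}.
Proof.
have p0 := @pi_gt0 R.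
pose h s := 1 - (f 1 s ^+ 2 + f (- 'i) s ^+ 2).
have bf2 : bmf (fun s => f 1 s ^+ 2 + f (- 'i) s ^+ 2).
  by apply: bmfD; under eq_fun do rewrite expr2; apply: bmfM; exact: bmf_f.
have bh : bmf h by apply: bmfB => //; exact: bmf_cst.
have [mh [B hB]] := bh.
have c1 : int_itv 0 (2 * pi) h @[k --> \oo] --> int_itv 0 (2 * pi) (fun s => `|h s|).
  apply: (@int_itv_dominated _ (fun _ : nat => h) _ B) => //; first exact: bmf_norm.
  apply: ae_imp ae_good => t [l1 l2]; rewrite in_itv/= => t2.
  rewrite ger0_norm; first exact: cvg_cst.
  by rewrite subr_ge0; exact: f2_le1.
have h0 : int_itv 0 (2 * pi) (fun s => `|h s|) <= 0.
  rewrite -(cvg_lim (@Rhausdorff R) c1) lim_cst//.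
  rewrite /h int_itvB//; last exact: bmf_cst.
  rewrite int_itv_cst; last by rewrite mulr_ge0// ltW.
  by have := int_f2; lra.
have z : (\int[mu]_(x in `[0%R, (2 * pi)%R]%classic) `|(h x)%:E| = 0)%E.
  apply/eqP; rewrite eq_le; apply/andP; split; last by apply: integral_ge0.
  move: h0; rewrite -lee_fin /int_itv /Rintegral fineK//.
  by apply: integrable_fin_num => //; apply: bmf_integrable_itv; exact: bmf_norm.
have mhE : measurable_fun `[0%R, 2 * pi]%classic (EFin \o h).
  by apply/measurable_EFinP; exact: measurable_funTS.
have := (ae_eq_integral_abs mu (measurable_itv _) mhE).1 z.
apply: ae_imp => t /= ht tI; have := ht tI.
by rewrite /h => -[] /eqP; rewrite subr_eq0 => /eqP <-.
Qed.

Lemma fatou_conclusion : {ae mu, forall t, t \in `[0, 2 * pi[ ->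
  exists2 w : R[i]^o, `|w| = 1 & radial u t r @[r --> (1 : R)^'-] --> w}.
Proof.
apply: ae_imp (ae_and ae_good ae_unimodular) => t [[l1 l2] h] tI.
have tI' : t \in `[0, 2 * pi].
  by move: tI; rewrite !in_itv/= => /andP[-> /ltW].
exists (f 1 t +i* f (- 'i) t).
  by apply: norm_eq1_sqabs; rewrite /sqabs /= h.
by apply: radial_cvg => //; move: tI'; rewrite in_itv.
Qed.

End fatou_main.

(** Fatou's theorem, with unimodular boundary values because the coefficients have
l^2 norm 1. *)
Theorem fatou_inner (R : realType) (c : nat -> R[i]) (u : disc R -> R[i]^o) :
  series (fun n => sqabs (c n)) @ \oo --> (1 : R) ->
  (forall z : disc R, power_series (E := R[i]^o) c (val z) @ \oo --> u z) ->
  (forall z, `|u z| <= 1) ->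
  {ae @lebesgue_measure R, forall t, t \in `[0, 2 * pi[ ->
    exists2 w : R[i]^o, `|w| = 1 & radial u t r @[r --> (1 : R)^'-] --> w}.
Proof.
move=> hc hu hb.
have /choice[dN dNP] : forall k, exists d : (nat -> R[i]) * nat,
    [/\ forall n, (d.2 <= n)%N -> d.1 n = 0,
      forall q t, sqabs q = 1 -> `|trig_poly (fun n => q * d.1 n) d.2 t| <= 2 &
      forall M, \sum_(n < M) sqabs (c n - d.1 n) <= 16 ^- k].
  move=> k; have [|d [h1 h2 h3 h4]] := trig_approx hc (@hu) hb (eps := 16 ^- k).
    by rewrite invr_gt0 exprn_gt0// ltr0n.
  by exists d.
apply: (fatou_conclusion hc (@hu) hb (dN := dN)) => k *.
- by have [h _ _] := dNP k; exact: h.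
- by have [_ h _] := dNP k; exact: h.
- by have [_ _ h] := dNP k; exact: h.
Qed.

(** * Inner products and Hilbert sums *)

Lemma rnorm_sqE (R : realType) (w : R[i]) : rnorm (w : R[i]^o) ^+ 2 = sqabs w.
Proof.
have := normr_sqabs w; rewrite (rnormE (w : R[i]^o)) -rmorphXn => /complexI; exact.
Qed.

Section inner_facts.
Variables (R : realType) (E : hilbertType R).
Implicit Types (x y z : E) (a : R[i]).

Lemma innerDl x y z : inner (x + y) z = inner x z + inner y z.
Proof. by rewrite linearDl. Qed.
Lemma innerZl a x z : inner (a *: x) z = a * inner x z.
Proof. by rewrite linearZl_LR. Qed.
Lemma innerZr a x z : inner z (a *: x) = conjc a * inner z x.
Proof. by rewrite linearZr_LR. Qed.
Lemma innerC x y : inner x y = conjc (inner y x).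
Proof. by rewrite hermC /= expr0 mul1r. Qed.
Lemma innerxx x : inner x x = (rnorm x ^+ 2)%:C.
Proof. by rewrite -norm_inner rnormE rmorphXn. Qed.

(** Minimal norm arguments only see the real part of the inner product. *)
Definition rdot x y : R := complex.Re (inner x y).

Lemma rdotC x y : rdot x y = rdot y x.
Proof. by rewrite /rdot innerC; case: (inner y x). Qed.
Lemma rdotDl x y z : rdot (x + y) z = rdot x z + rdot y z.
Proof. by rewrite /rdot innerDl; case: (inner x z) => ? ?; case: (inner y z). Qed.
Lemma rdotDr x y z : rdot z (x + y) = rdot z x + rdot z y.
Proof. by rewrite ![rdot z _]rdotC rdotDl. Qed.
Lemma rdotxx x : rdot x x = rnorm x ^+ 2.
Proof. by rewrite /rdot innerxx. Qed.
Lemma rdotNl x y : rdot (- x) y = - rdot x y.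
Proof. by rewrite /rdot -scaleN1r innerZl mulN1r; case: (inner x y). Qed.
Lemma rdotNr x y : rdot x (- y) = - rdot x y.
Proof. by rewrite rdotC rdotNl rdotC. Qed.
Lemma rdotZl a x y : rdot (a *: x) y = complex.Re (a * inner x y).
Proof. by rewrite /rdot innerZl. Qed.
Lemma rdotZr a x y : rdot x (a *: y) = complex.Re (conjc a * inner x y).
Proof. by rewrite /rdot innerZr. Qed.
Lemma rdot0l y : rdot 0 y = 0.
Proof. by rewrite -(scale0r 0) rdotZl mul0r. Qed.
Lemma rnormD_sq x y : rnorm (x + y) ^+ 2 = rnorm x ^+ 2 + 2 * rdot x y + rnorm y ^+ 2.
Proof. by rewrite -!rdotxx rdotDl !rdotDr (rdotC y x); ring. Qed.

Lemma rnormB_sq x y : rnorm (x - y) ^+ 2 = rnorm x ^+ 2 - 2 * rdot x y + rnorm y ^+ 2.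
Proof. by rewrite rnormD_sq rdotNr rnormN; ring. Qed.

Lemma rdot_polar x y : rdot x y = (rnorm (x + y) ^+ 2 - rnorm (x - y) ^+ 2) / 4.
Proof. by rewrite rnormD_sq rnormB_sq; field. Qed.

Lemma rnormZ_sq a x : rnorm (a *: x) ^+ 2 = sqabs a * rnorm x ^+ 2.
Proof.
by rewrite rnormZ exprMn; congr (_ * _); exact: rnorm_sqE.
Qed.

End inner_facts.

(** The discriminant of a nonnegative quadratic polynomial is not positive. *)
Lemma quad_CS (R : realType) (A B K : R) : 0 <= A -> 0 <= K ->
  (forall t, 0 <= A ^+ 2 + 2 * t * B + t ^+ 2 * K ^+ 2) -> `|B| <= A * K.
Proof.
move=> A0 K0 h; rewrite -ler_sqr ?nnegrE ?mulr_ge0// real_normK ?num_real//.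
have [K00|Kn] := eqVneq K 0.
  rewrite K00 mulr0 expr0n/=; have [->|Bn] := eqVneq B 0; first by rewrite expr0n.
  have := h (- (A ^+ 2 + 1) / (2 * B)).
  rewrite K00 (_ : _ + _ + _ = -1); last by field.
  by rewrite ler0N1.
have := h (- B / K ^+ 2); rewrite [X in _ -> _ <= X]exprMn.
have K2 : 0 < K ^+ 2 by rewrite exprn_gt0// lt_def Kn.
rewrite (_ : _ + _ + _ = (A ^+ 2 * K ^+ 2 - B ^+ 2) / K ^+ 2); last by field.
by rewrite pmulr_lge0 ?invr_gt0// subr_ge0.
Qed.

Section cauchy_schwarz.
Variables (R : realType) (E : hilbertType R).
Implicit Types (x y z : E) (a : R[i]).

Lemma rdot_CS x y : `|rdot x y| <= rnorm x * rnorm y.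
Proof.
apply: quad_CS; rewrite ?rnorm_ge0// => t.
have := sqr_ge0 (rnorm (x + t%:C *: y)); rewrite rnormD_sq rnormZ_sq sqabs_real rdotZr /rdot.
by case: (inner x y) => p q /=; rewrite oppr0 mul0r subr0; lra.
Qed.

(** The real case, after rotating x by the conjugate of <x, y>. *)
Lemma inner_CS x y : rnorm (inner x y : R[i]^o) <= rnorm x * rnorm y.
Proof.
set w := inner x y; set s := rnorm (w : R[i]^o).
have s2 : s ^+ 2 = sqabs w by rewrite rnorm_sqE.
have h1 : s ^+ 2 <= s * rnorm x * rnorm y.
  have := rdot_CS (w^* *: x) y; rewrite rdotZl -/w => /(le_trans (ler_norm _)).
  have -> : complex.Re (w^* * w) = s ^+ 2 by rewrite s2; case: (w) => a b; rewrite /sqabs /=; ring.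
  move/le_trans; apply; rewrite ler_wpM2r ?rnorm_ge0// -ler_sqr ?nnegrE ?rnorm_ge0 ?mulr_ge0 ?rnorm_ge0//.
  rewrite rnormZ_sq exprMn s2; case: (w) => a b; rewrite /sqabs /= sqrrN.
  by [].
have [s0|sn] := eqVneq s 0; first by rewrite s0 mulr_ge0 ?rnorm_ge0.
have sp : 0 < s by rewrite lt_def sn rnorm_ge0.
by rewrite -(ler_pM2l sp) -expr2 mulrA.
Qed.

Definition rank1 (F : lmodType R[i]) x (y : F) z : F := inner z x *: y.

Lemma rank1_linear (F : lmodType R[i]) x (y : F) : linear (rank1 x y).
Proof. by move=> a u v; rewrite /rank1 innerDl innerZl scalerDl scalerA. Qed.

Lemma rank1_le (F : normedModType R[i]) x (y : F) z :
  rnorm (rank1 x y z) <= rnorm x * rnorm y * rnorm z.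
Proof.
rewrite /rank1 rnormZ -[complex.Re _]/(rnorm (inner z x : R[i]^o)).
rewrite (_ : rnorm x * rnorm y * rnorm z = rnorm z * rnorm x * rnorm y); last by ring.
by rewrite ler_wpM2r ?rnorm_ge0// inner_CS.
Qed.

Lemma complete_rnorm (u : nat -> E) :
  (forall e : R, 0 < e -> exists N, forall m n, (N <= m)%N -> (N <= n)%N -> rnorm (u m - u n) <= e) ->
  exists l : E, u @ \oo --> l.
Proof.
move=> h; suff : cvg (u @ \oo) by move=> ?; exists (lim (u @ \oo)).
apply/cauchy_cvgP; apply/cauchy_ballP => e e0; near_simpl.
have eE : e = (complex.Re e)%:C.
  by case: e e0 => a b; rewrite ltcE /= => /andP[/eqP -> _].
have e1 : 0 < complex.Re e / 2 by rewrite divr_gt0//; move: e0; rewrite {1}eE ltcR.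
have [N Nh] := h _ e1.
near=> m n; rewrite -ball_normE /= rnormE eE ltcR.
apply: le_lt_trans (Nh m n _ _) _; last by lra.
  by near: m; exact: nbhs_infty_ge.
by near: n; exact: nbhs_infty_ge.
Unshelve. all: by end_near. Qed.

End cauchy_schwarz.

Section hsum_facts.
Variables (R : realType) (I : choiceType).
Implicit Types V W : I -> normedModType R[i].

Lemma rnorm_hsum V (x : hsum V) : rnorm x = hnorm x.
Proof. by []. Qed.

Lemma sqsum_le V W (x : hsum V) (y : forall i, W i) (K : R) : 0 <= K ->
  (forall i, rnorm (y i) <= K * rnorm (x i)) -> (sqsum y <= ((K * hnorm x) ^+ 2)%:E)%E.
Proof.
move=> K0 h; apply: (@le_trans _ _ (\esum_(i in [set: I]) (K ^+ 2 * rnorm (x i) ^+ 2)%:E)%E).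
  apply: le_esum => i _; rewrite lee_fin -exprMn lerXn2r ?nnegrE ?rnorm_ge0//.
  by rewrite mulr_ge0 ?rnorm_ge0.
apply: le_trans (esum_scale_le _ _) _ => [|i|]; rewrite ?sqr_ge0//.
by rewrite -/(sqsum x) hnormE -EFinM exprMn.
Qed.

Lemma hnorm_sqsum_le V (x : hsum V) (B : R) : 0 <= B -> (sqsum x <= (B ^+ 2)%:E)%E -> rnorm x <= B.
Proof. by move=> B0 h; rewrite rnorm_hsum; exact: hnorm_le. Qed.

Lemma rnorm_coord V (x : hsum V) i : rnorm (x i) <= rnorm x.
Proof. exact: rnorm_le_hnorm. Qed.

Lemma hsum_sumE V J (s : seq J) (P : pred J) (F : J -> hsum V) i :
  (\sum_(j <- s | P j) F j) i = \sum_(j <- s | P j) F j i.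
Proof. by elim/big_rec2: _ => // j x y _ <-. Qed.

Definition hinj_fun V i (x : V i) : forall j, V j := @dfwith I V (fun j => 0) i x.

Lemma hinj_at V i (x : V i) : hinj_fun x i = x.
Proof. by rewrite /hinj_fun dfwithin. Qed.

Lemma hinj_out V i (x : V i) j : i != j -> hinj_fun x j = 0.
Proof. by move=> ij; rewrite /hinj_fun dfwithout. Qed.

Lemma sqsum_hinj V i (x : V i) : sqsum (hinj_fun x) = (rnorm x ^+ 2)%:E.
Proof.
rewrite /sqsum (esumID [set i])//; last by move=> j _; rewrite lee_fin sqr_ge0.
rewrite setTI esum_set1 ?lee_fin ?sqr_ge0// hinj_at esum1 ?adde0//.
move=> j [_ /= /eqP ij]; rewrite hinj_out 1?eq_sym//.
by rewrite rnorm0 expr0n.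
Qed.

Lemma hinj_fin V i (x : V i) : (sqsum (hinj_fun x) < +oo)%E.
Proof. by rewrite sqsum_hinj ltry. Qed.

Definition hinj V i (x : V i) : hsum V := Hsum (hinj_fin x).

Lemma hinj_linear V i : linear (@hinj V i).
Proof.
move=> a x y; apply: hsum_ext => j /=.
have [<-|ij] := eqVneq i j; first by rewrite !hinj_at.
by rewrite !hinj_out// scaler0 addr0.
Qed.

Lemma rnorm_hinj V i (x : V i) : rnorm (hinj x) = rnorm x.
Proof.
rewrite rnorm_hsum; apply/eqP; rewrite -(@eqrXn2 _ 2)// ?hnorm_ge0 ?rnorm_ge0//.
by apply/eqP; have := sqsum_hinj x; rewrite -[sqsum _]/(sqsum (hinj x)) hnormE => -[].
Qed.

End hsum_facts.

Section hsum_nat.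
Variables (R : realType) (V : nat -> normedModType R[i]).
Implicit Types (x : hsum V).

Lemma cvg_hnorm x : series (fun n => rnorm (x n) ^+ 2) @ \oo --> rnorm x ^+ 2.
Proof.
have h : (\sum_(0 <= i < n) (rnorm (x i) ^+ 2)%:E)%E @[n --> \oo] --> (rnorm x ^+ 2)%:E.
  rewrite rnorm_hsum -hnormE /sqsum -nneseries_esumT; last by move=> n; rewrite lee_fin sqr_ge0.
  by apply: is_cvg_nneseries => n _ _; rewrite lee_fin sqr_ge0.
have h2 : fine \o (fun n => \sum_(0 <= i < n) (rnorm (x i) ^+ 2)%:E)%E @ \oo --> rnorm x ^+ 2.
  exact: fine_cvg.
apply: cvg_trans h2; apply: near_eq_cvg; apply: nearW => n /=.
by rewrite sumEFin.
Qed.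

Lemma hsum_of_bound (a : forall n, V n) (B : R) :
  (forall N, \sum_(n < N) rnorm (a n) ^+ 2 <= B) -> (sqsum a <= B%:E)%E.
Proof.
move=> h; rewrite /sqsum -nneseries_esumT; last by move=> n; rewrite lee_fin sqr_ge0.
apply: lime_le; first by apply: is_cvg_nneseries => n _ _; rewrite lee_fin sqr_ge0.
by apply: nearW => N; rewrite sumEFin lee_fin big_mkord.
Qed.

Lemma mk_hsum (a : forall n, V n) (B : R) : 0 <= B ->
  (forall N, \sum_(n < N) rnorm (a n) ^+ 2 <= B ^+ 2) ->
  exists2 x : hsum V, (forall n, x n = a n) & rnorm x <= B.
Proof.
move=> B0 /hsum_of_bound h.
exists (Hsum (le_lt_trans h (ltry _))) => //.
exact: hnorm_sqsum_le.
Qed.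

Lemma hsum_partial_le x N : \sum_(n < N) rnorm (x n) ^+ 2 <= rnorm x ^+ 2.
Proof.
apply: (ge_lim (N := N) (@cvg_hnorm x)) => M NM; rewrite -(big_mkord xpredT (fun n => rnorm (x n) ^+ 2)).
by apply: nondecreasing_series NM => i _ _; exact: sqr_ge0.
Qed.

Definition htrunc_fun N x n : V n := if (n < N)%N then x n else 0.

Lemma htrunc_fin N x : (sqsum (htrunc_fun N x) < +oo)%E.
Proof.
apply: le_lt_trans (sqsum_le (x := x) (K := 1) _ _) (ltry _) => // n.
by rewrite /htrunc_fun; case: ifP; rewrite mul1r// rnorm0 rnorm_ge0.
Qed.

Definition htrunc N x : hsum V := Hsum (htrunc_fin N x).

Lemma htruncE N x n : htrunc N x n = if (n < N)%N then x n else 0.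
Proof. by []. Qed.

Lemma rnorm_htrunc N x : rnorm (htrunc N x) ^+ 2 = \sum_(n < N) rnorm (x n) ^+ 2.
Proof.
apply: (cvg_unique (@Rhausdorff R) (@cvg_hnorm (htrunc N x))).
apply: cvg_near_cst; exists N => // M /= NM.
rewrite /series/= (big_cat_nat (leq0n N) NM)//= [X in _ + X]big_nat [X in _ + X]big1 ?addr0.
  rewrite big_mkord; apply: eq_bigr => n _.
  by rewrite /htrunc_fun ltn_ord.
by move=> n /andP[Nn _]; rewrite /htrunc_fun ltnNge Nn rnorm0 expr0n.
Qed.

Lemma rnorm_tail N x : rnorm (x - htrunc N x) ^+ 2 = rnorm x ^+ 2 - \sum_(n < N) rnorm (x n) ^+ 2.
Proof.
apply: (cvg_unique (@Rhausdorff R) (@cvg_hnorm _)).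
have h : series (fun n => rnorm (x n) ^+ 2) M - \sum_(n < N) rnorm (x n) ^+ 2 @[M --> \oo] -->
   rnorm x ^+ 2 - \sum_(n < N) rnorm (x n) ^+ 2.
  by apply: cvgB; [exact: cvg_hnorm|exact: cvg_cst].
apply: cvg_trans h; apply: near_eq_cvg; exists N => // M /= NM.
rewrite /series/= !(big_cat_nat (leq0n N) NM)//= big_mkord addrAC subrr add0r.
rewrite [X in _ = X + _]big_nat [X in _ = X + _]big1 ?add0r.
  rewrite big_nat [RHS]big_nat; apply: eq_bigr => n /andP[Nn _].
  by rewrite /htrunc_fun ltnNge Nn/= subr0.
by move=> n /andP[_ nN]; rewrite /htrunc_fun nN subrr rnorm0 expr0n.
Qed.

Lemma htrunc_cvg x : htrunc N x @[N --> \oo] --> x.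
Proof.
apply/cvg_rnormP => e e0.
have /cvgrPdist_le/(_ _ (exprn_gt0 2 e0))[N _ h] := @cvg_hnorm x.
exists N => n /h /= hn.
rewrite -ler_sqr ?nnegrE ?rnorm_ge0 ?(ltW e0)// rnorm_tail.
by apply: le_trans (ler_norm _) _; rewrite -(big_mkord xpredT (fun n => rnorm (x n) ^+ 2)).
Qed.

End hsum_nat.
Arguments cvg_hnorm {R V} x.
Arguments htrunc_cvg {R V} x.

(** * Square-summable sequences in a Hilbert space *)

Section series_facts.
Variable R : realType.

Lemma series_shift (f g : nat -> R) d (l : R) :
  (forall n, (n < d)%N -> f n = 0) -> (forall n, f (n + d)%N = g n) ->
  series g @ \oo --> l -> series f @ \oo --> l.
Proof.
move=> f0 fg gl; rewrite -(cvg_shiftn d).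
apply: cvg_trans gl; apply: near_eq_cvg; apply: nearW => n.
rewrite /series/= addnC (big_cat_nat (leq0n d) (leq_addr n d))//=.
rewrite [X in _ = X + _]big_nat [X in _ = X + _]big1 ?add0r; last by move=> i /andP[_ /f0].
have -> : \sum_(d <= i < d + n) f i = \sum_(0 + d <= i < d + n) f i by rewrite add0n.
rewrite big_addn addKn.
by apply: eq_bigr => i _; rewrite fg.
Qed.

Lemma series_single (f : nat -> R) k : (forall n, n != k -> f n = 0) ->
  series f @ \oo --> f k.
Proof.
move=> f0; apply: cvg_near_cst; exists k.+1 => // M /= kM.
rewrite /series/= (big_cat_nat (leq0n k) (ltnW kM))//= big_nat big1 ?add0r; last first.
  by move=> n /andP[_ nk]; rewrite f0// neq_ltn nk.
rewrite big_ltn// big_nat big1 ?addr0//.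
by move=> n /andP[kn _]; rewrite f0// neq_ltn kn orbT.
Qed.

Lemma cvg_rnorm (V : normedModType R[i]) (u : nat -> V) l : u @ \oo --> l ->
  rnorm (u n) @[n --> \oo] --> rnorm l.
Proof.
move=> /cvg_rnormP h; apply/cvgrPdist_le => e /h [N hN]; exists N => // n /= /hN.
apply: le_trans.
have h1 := rnormD (l - u n) (u n); rewrite subrK in h1.
have h2 := rnormD (u n - l) l; rewrite subrK (rnormB (u n) l) in h2.
by rewrite ler_norml; apply/andP; split; lra.
Qed.

End series_facts.

Section l2.
Variables (R : realType) (E : hilbertType R).
Local Notation l2 := (hsum (fun _ : nat => E : normedModType R[i])).
Implicit Types (a b c : l2).

(** A Hilbert sum carries a norm only; its real inner product is recovered by
polarization. *)
Definition hdot a b : R := (rnorm (a + b) ^+ 2 - rnorm (a - b) ^+ 2) / 4.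

Lemma cvg_hdot a b : series (fun n => rdot (a n) (b n)) @ \oo --> hdot a b.
Proof.
have h : (series (fun n => rnorm ((a + b) n) ^+ 2) N - series (fun n => rnorm ((a - b) n) ^+ 2) N) / 4
    @[N --> \oo] --> hdot a b.
  by apply: cvgM; [apply: cvgB; exact: cvg_hnorm|exact: cvg_cst].
apply: cvg_trans h; apply: near_eq_cvg; apply: nearW => N /=.
rewrite /series/= -sumrB mulr_suml; apply: eq_bigr => n _.
by rewrite rdot_polar.
Qed.

Lemma hdot_unique a b l : series (fun n => rdot (a n) (b n)) @ \oo --> l -> hdot a b = l.
Proof. by move=> h; apply: (cvg_unique (@Rhausdorff R) (@cvg_hdot a b) h). Qed.

Lemma eq_hdot a b a' b' : (forall n, rdot (a n) (b n) = rdot (a' n) (b' n)) -> hdot a b = hdot a' b'.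
Proof.
move=> h; apply: hdot_unique; rewrite (_ : (fun n => _) = (fun n => rdot (a' n) (b' n))).
  exact: cvg_hdot.
by apply/funext => n.
Qed.

Lemma hdotC a b : hdot a b = hdot b a.
Proof. by apply: eq_hdot => n; rewrite rdotC. Qed.

Lemma hdotDl a b c : hdot (a + b) c = hdot a c + hdot b c.
Proof.
apply: hdot_unique.
have h : series (fun n => rdot (a n) (c n)) N + series (fun n => rdot (b n) (c n)) N @[N --> \oo] -->
    hdot a c + hdot b c.
  by apply: cvgD; exact: cvg_hdot.
apply: cvg_trans h; apply: near_eq_cvg; apply: nearW => N.
by rewrite /series/= -big_split/=; apply: eq_bigr => n _; rewrite rdotDl.
Qed.

Lemma hdotDr a b c : hdot c (a + b) = hdot c a + hdot c b.
Proof. by rewrite ![hdot c _]hdotC hdotDl. Qed.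

Lemma hdotZl (t : R) a b : hdot (t%:C *: a) b = t * hdot a b.
Proof.
apply: hdot_unique.
have h : t * series (fun n => rdot (a n) (b n)) N @[N --> \oo] --> t * hdot a b.
  by apply: cvgM; [exact: cvg_cst|exact: cvg_hdot].
apply: cvg_trans h; apply: near_eq_cvg; apply: nearW => N.
rewrite /series/= mulr_sumr; apply: eq_bigr => n _.
by rewrite rdotZl /rdot; case: (inner _ _) => p q /=; ring.
Qed.

Lemma hdotZr (t : R) a b : hdot a (t%:C *: b) = t * hdot a b.
Proof. by rewrite hdotC hdotZl hdotC. Qed.

Lemma hdotNl a b : hdot (- a) b = - hdot a b.
Proof. by rewrite -scaleN1r (_ : -1 = (-1)%:C) ?hdotZl ?mulN1r// rmorphN1. Qed.

Lemma hdotNr a b : hdot a (- b) = - hdot a b.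
Proof. by rewrite hdotC hdotNl hdotC. Qed.

Lemma hdot0l a : hdot 0 a = 0.
Proof. by rewrite -(scale0r 0) (_ : 0 = 0%:C) ?hdotZl ?mul0r. Qed.

Lemma hdot_suml J (s : seq J) (P : pred J) (F : J -> l2) b :
  hdot (\sum_(j <- s | P j) F j) b = \sum_(j <- s | P j) hdot (F j) b.
Proof.
by elim/big_rec2: _ => [|j x y _ <-]; rewrite ?hdot0l// hdotDl.
Qed.

Lemma hdot_sumr J (s : seq J) (P : pred J) (F : J -> l2) b :
  hdot b (\sum_(j <- s | P j) F j) = \sum_(j <- s | P j) hdot b (F j).
Proof. by rewrite hdotC hdot_suml; apply: eq_bigr => j _; rewrite hdotC. Qed.

Lemma hdotxx a : hdot a a = rnorm a ^+ 2.
Proof.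
apply: hdot_unique; rewrite (_ : (fun n => _) = (fun n => rnorm (a n) ^+ 2)).
  exact: cvg_hnorm.
by apply/funext => n; rewrite rdotxx.
Qed.

Lemma hnormD_sq a b : rnorm (a + b) ^+ 2 = rnorm a ^+ 2 + 2 * hdot a b + rnorm b ^+ 2.
Proof. by rewrite -!hdotxx hdotDl !hdotDr (hdotC b a); ring. Qed.

Lemma hnormB_sq a b : rnorm (a - b) ^+ 2 = rnorm a ^+ 2 - 2 * hdot a b + rnorm b ^+ 2.
Proof. by rewrite hnormD_sq hdotNr rnormN; ring. Qed.

Lemma rnormZR (V : normedModType R[i]) (t : R) (x : V) : rnorm (t%:C *: x) = `|t| * rnorm x.
Proof. by rewrite rnormZ normc_def /= expr0n addr0 sqrtr_sqr. Qed.

Lemma hdot_CS a b : `|hdot a b| <= rnorm a * rnorm b.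
Proof.
apply: quad_CS; rewrite ?rnorm_ge0// => t.
have := sqr_ge0 (rnorm (a + t%:C *: b)); rewrite hnormD_sq hdotZr rnormZR exprMn.
by rewrite real_normK ?num_real//; lra.
Qed.

Lemma hdot_hinj k (x : E) b : hdot (@hinj _ _ (fun=> E) k x) b = rdot x (b k).
Proof.
apply: hdot_unique; have := @series_single R (fun n => rdot (@hinj _ _ (fun=> E) k x n) (b n)) k.
rewrite /= hinj_at; apply => n nk.
by rewrite hinj_out 1?eq_sym// rdot0l.
Qed.

Lemma complete_l2 (u : nat -> l2) :
  (forall e : R, 0 < e -> exists N, forall m n, (N <= m)%N -> (N <= n)%N -> rnorm (u m - u n) <= e) ->
  exists l : l2, u @ \oo --> l.
Proof.
move=> h.
have /choice[l lP] : forall n, exists l : E, u k n @[k --> \oo] --> l.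
  move=> n; apply: complete_rnorm => e /h [N hN]; exists N => p q Np Nq.
  by apply: le_trans (hN p q Np Nq); exact: (rnorm_coord (u p - u q) n).
have key (e : R) N : 0 < e -> (forall m n, (N <= m)%N -> (N <= n)%N -> rnorm (u m - u n) <= e) ->
    forall m, (N <= m)%N -> forall K, \sum_(n < K) rnorm (l n - u m n) ^+ 2 <= e ^+ 2.
  move=> e0 hN m Nm K.
  have c : \sum_(n < K) rnorm (u k n - u m n) ^+ 2 @[k --> \oo] --> \sum_(n < K) rnorm (l n - u m n) ^+ 2.
    elim: K => [|K IH].
      under eq_fun do rewrite big_ord0; rewrite big_ord0; exact: cvg_cst.
    under eq_fun do rewrite big_ord_recr/=; rewrite big_ord_recr/=.
    apply: cvgD => //; apply: cvg_sq; apply: cvg_rnorm.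
    by apply: cvgB; [exact: lP|exact: cvg_cst].
  apply: (le_rnorm_lim (N := N) c) => k Nk.
  apply: le_trans (hsum_partial_le (u k - u m) K) _.
  by rewrite lerXn2r ?nnegrE ?rnorm_ge0 ?(ltW e0)// hN.
have [N0 h0] := h 1 ltr01.
have [x xE _] := @mk_hsum R (fun _ : nat => E : normedModType R[i]) (fun n => l n - u N0 n) 1 ler01
  (key 1 N0 ltr01 h0 N0 (leqnn _)).
exists (x + u N0); apply/cvg_rnormP => e e0.
have [N hN] := h e e0; exists N => m Nm.
have [y yE yn] := @mk_hsum R (fun _ : nat => E : normedModType R[i]) (fun n => l n - u m n) e (ltW
  e0) (key e N e0 hN m Nm).
suff -> : x + u N0 - u m = y by [].
by apply: hsum_ext => n /=; rewrite xE yE subrK.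
Qed.

(** By the parallelogram law a minimizing sequence is a Cauchy sequence. *)
Lemma min_norm (A : set l2) : A !=set0 ->
  (forall u l, (forall n, A (u n)) -> u @ \oo --> l -> A l) ->
  (forall a b, A a -> A b -> A ((2^-1)%:C *: (a + b))) ->
  exists2 v, A v & forall a, A a -> rnorm v <= rnorm a.
Proof.
move=> [a0 Aa0] clA mid.
pose D := [set rnorm a ^+ 2 | a in A].
have lbD : has_lbound D by exists 0 => _ [a _ <-]; exact: sqr_ge0.
have infD : has_inf D by split => //; exists (rnorm a0 ^+ 2); exists a0.
pose de := inf D.
have deA a : A a -> de <= rnorm a ^+ 2 by move=> Aa; apply: ge_inf => //; exists a.
have /choice[u uP] : forall n : nat, exists a, A a /\ rnorm a ^+ 2 <= de + n.+1%:R^-1.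
  move=> n; have n0 : 0 < n.+1%:R^-1 :> R by rewrite invr_gt0 ltr0n.
  by have [_ [a Aa <-] h] := inf_adherent n0 infD; exists a; split => //; exact: ltW.
have uN N n : (N <= n)%N -> rnorm (u n) ^+ 2 <= de + N.+1%:R^-1.
  move=> Nn; apply: le_trans (uP n).2 _; rewrite lerD2l lef_pV2 ?posrE ?ltr0n//.
  by rewrite ler_nat.
have ex_small (e : R) : 0 < e -> exists N : nat, N.+1%:R^-1 <= e.
  move=> e0; exists (Num.truncn e^-1).
  by rewrite invf_ple ?posrE ?ltr0n// ltW// truncnS_gt.
have [|v uv] := @complete_l2 u.
  move=> e e0; have e4 : 0 < e ^+ 2 / 4 by rewrite divr_gt0// exprn_gt0.
  have [N NE] := ex_small _ e4; exists N => m n Nm Nn.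
  apply: sqr_leW; first exact: ltW.
  have M1 := deA _ (mid _ _ (uP m).1 (uP n).1).
  rewrite rnormZR exprMn hnormD_sq ger0_norm ?invr_ge0// in M1.
  rewrite hnormB_sq; have := uN N m Nm; have := uN N n Nn.
  move: M1 NE; rewrite exprVn (_ : 2 ^+ 2 = 4 :> R); last by ring.
  move: (rnorm (u m) ^+ 2) (rnorm (u n) ^+ 2) (hdot _ _) (N.+1%:R^-1) (e ^+ 2) => x z y t ee.
  by lra.
exists v; first by apply: clA uv => n; case: (uP n).
move=> a Aa; apply: sqr_leW; first exact: rnorm_ge0.
apply/ler_addgt0Pl => e e0; have [N NE] := ex_small _ e0.
have c : rnorm (u n) ^+ 2 @[n --> \oo] --> rnorm v ^+ 2.
  have c := cvg_rnorm uv.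
  exact: cvg_sq.
apply: (le_rnorm_lim (N := N) c) => n Nn; apply: le_trans (uN N n Nn) _.
by rewrite (addrC de) lerD//; exact: deA.
Qed.

(** The derivative at t = 0 of the squared norm of v + t h vanishes. *)
Lemma min_norm_orth (v h : l2) : (forall t : R, rnorm v <= rnorm (v + t%:C *: h)) -> hdot h v = 0.
Proof.
move=> hv; apply/normr0_eq0/eqP; rewrite eq_le normr_ge0 andbT.
have : `|hdot h v| <= 0 * rnorm h.
  apply: quad_CS; rewrite ?rnorm_ge0// => t; rewrite expr0n add0r.
  have := sqr_le (rnorm_ge0 v) (hv t); rewrite hnormD_sq hdotZr rnormZR exprMn.
  by rewrite real_normK ?num_real// hdotC; lra.
by rewrite mul0r.
Qed.

Definition shift_src d n := if (n < d)%N then None else Some (n - d)%N.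

Lemma shift_src_inj d i j k : shift_src d i = Some k -> shift_src d j = Some k -> i = j.
Proof.
rewrite /shift_src; case: ltnP => // di; case: ltnP => // dj [<-] [].
by move=> h; rewrite -(subnK di) -(subnK dj) h.
Qed.

(** Multiplication by z^d, read on coefficients. *)
Definition zshift d : l2 -> l2 := pshift (@shift_src_inj d).

Lemma zshiftE d a n : zshift d a n = if (n < d)%N then 0 else a (n - d)%N.
Proof. by rewrite /zshift /= /shift_src; case: ifP. Qed.

Lemma zshift_shifted d a n : zshift d a (n + d)%N = a n.
Proof. by rewrite zshiftE ltnNge leq_addl/= addnK. Qed.

Lemma hdot_zshift d a b : hdot (zshift d a) (zshift d b) = hdot a b.
Proof.
apply: hdot_unique; apply: (@series_shift _ _ _ d _ _ _ (@cvg_hdot a b)) => n.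
  by move=> nd; rewrite !zshiftE nd rdot0l.
by rewrite !zshift_shifted.
Qed.

Lemma rnorm_zshift d a : rnorm (zshift d a) = rnorm a.
Proof.
apply/eqP; rewrite -(@eqrXn2 _ 2) ?rnorm_ge0//.
by rewrite -!hdotxx hdot_zshift.
Qed.

Lemma zshift_add d d' a : zshift d (zshift d' a) = zshift (d + d') a.
Proof.
apply: hsum_ext => n; rewrite !zshiftE; case: ltnP => nd.
  by rewrite ltn_addr.
by rewrite ltn_subLR// subnDA.
Qed.

Lemma zshift0 a : zshift 0 a = a.
Proof. by apply: hsum_ext => n; rewrite zshiftE ltn0 subn0. Qed.

End l2.
Arguments zshift : simpl never.

(** * Beurling's theorem for scalar symbols *)

Lemma big_nat_trim (V : nmodType) (F : nat -> V) N M : (N <= M)%N ->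
  (forall j, (N <= j)%N -> F j = 0) -> \sum_(0 <= j < M) F j = \sum_(0 <= j < N) F j.
Proof.
move=> NM F0; rewrite (big_cat_nat (leq0n N) NM)/= [X in _ + X]big_nat [X in _ + X]big1 ?addr0//.
by move=> j /andP[/F0].
Qed.

Lemma zmod_sub2 (V : zmodType) (f a b : V) : f - a - (f - b) = - (a - b).
Proof. by rewrite !opprB addrC subrKA. Qed.

Lemma zmod_sub3 (V : zmodType) (f l a b : V) : a - b = (l - (f - a)) - (l - (f - b)).
Proof. by rewrite zmod_sub2 zmod_sub2 opprK. Qed.

Lemma half_double (R : realType) (V : lmodType R[i]) (x : V) : (2^-1)%:C *: (x + x) = x.
Proof.
have -> : x + x = 2%:R *: x by rewrite scaler_nat mulr2n.
by rewrite scalerA fmorphV rmorph_nat mulVf ?pnatr_eq0// scale1r.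
Qed.

Lemma rnorm_sq_eq (R : realType) (V W : normedModType R[i]) (x : V) (y : W) :
  rnorm x ^+ 2 = rnorm y ^+ 2 -> rnorm x = rnorm y.
Proof.
move=> h; apply/eqP; rewrite eq_le; apply/andP.
by split; apply: sqr_leW; rewrite ?rnorm_ge0// h.
Qed.

Section cauchy_prod.
Variables (R : realType) (E : lmodType R[i]).
Implicit Types (u : nat -> R[i]) (a b : nat -> E).

Definition cauchy_prod u a n : E := \sum_(i < n.+1) u i *: a (n - i)%N.

Lemma cauchy_prod_lin u (c : R[i]) a b n :
  cauchy_prod u (fun k => c *: a k + b k) n = c *: cauchy_prod u a n + cauchy_prod u b n.
Proof.
rewrite /cauchy_prod scaler_sumr -big_split/=; apply: eq_bigr => i _.
by rewrite scalerDr !scalerA mulrC.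
Qed.

Lemma eq_cauchy_prod u a b n : (forall k, (k <= n)%N -> a k = b k) -> cauchy_prod u a n = cauchy_prod u b n.
Proof. by move=> ab; apply: eq_bigr => i _; rewrite ab// leq_subr. Qed.

Lemma cauchy_prod0 u n : cauchy_prod u (fun=> 0 : E) n = 0.
Proof. by apply: big1 => i _; rewrite scaler0. Qed.

End cauchy_prod.

Section beurling.
Variables (R : realType) (E : hilbertType R).
Local Notation l2 := (hsum (fun _ : nat => E : normedModType R[i])).
Implicit Types (a b g h : l2).

Lemma coef_rank1_fin (x y : E) a : (sqsum (V := fun _ : nat => E : normedModType R[i]) (fun n =>
  rank1 x y (a n)) < +oo)%E.
Proof.
apply: le_lt_trans (sqsum_le (x := a) (K := rnorm x * rnorm y) _ _) (ltry _).
  by rewrite mulr_ge0 ?rnorm_ge0.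
by move=> n; exact: rank1_le.
Qed.

Definition coef_rank1 (x y : E) a : l2 := Hsum (coef_rank1_fin x y a).
Arguments coef_rank1 : simpl never.

Lemma coef_rank1E x y a n : coef_rank1 x y a n = inner (a n) x *: y. Proof. by []. Qed.

Lemma rnorm_coef_rank1 x y a : rnorm (coef_rank1 x y a) <= rnorm x * rnorm y * rnorm a.
Proof.
apply: hnorm_sqsum_le; first by rewrite !mulr_ge0 ?rnorm_ge0.
rewrite [rnorm a]rnorm_hsum; apply: sqsum_le; first by rewrite mulr_ge0 ?rnorm_ge0.
by move=> n; exact: rank1_le.
Qed.

Lemma coef_rank1_linear x y : linear (coef_rank1 x y).
Proof. by move=> c a b; apply: hsum_ext => n /=; rewrite rank1_linear. Qed.

(** Invariance under rank-one operators expresses that, seen in the tensor product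
of l^2 and E, the subspace is the product of a shift invariant subspace of l^2
with E; this is what makes the symbol scalar. Closedness is sequential. *)
Record shift_reducing (S : set l2) : Prop := ShiftReducing {
  reducing_0 : S 0;
  reducing_lin : forall c a b, S a -> S b -> S (c *: a + b);
  reducing_closed : forall (u : nat -> l2) l, (forall n, S (u n)) -> u @ \oo --> l -> S l;
  reducing_shift : forall a, S a -> S (zshift 1 a);
  reducing_rank1 : forall x y a, S a -> S (coef_rank1 x y a)
}.

Lemma reducing_iter_shift S n a : shift_reducing S -> S a -> S (zshift n a).
Proof.
move=> rS Sa; elim: n => [|n IH]; first by rewrite zshift0.
by rewrite -add1n -zshift_add; apply: reducing_shift.
Qed.

Lemma reducingZ S c a : shift_reducing S -> S a -> S (c *: a).
Proof. by move=> rS Sa; rewrite -[_ *: _]addr0; apply: reducing_lin => //; exact: reducing_0. Qed.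

Lemma reducingD S a b : shift_reducing S -> S a -> S b -> S (a + b).
Proof. by move=> rS Sa Sb; rewrite -[a]scale1r; exact: reducing_lin. Qed.

Lemma reducing_sum S J (s : seq J) (F : J -> l2) : shift_reducing S -> (forall j, S (F j)) ->
  S (\sum_(j <- s) F j).
Proof.
move=> rS SF; elim: s => [|j s IH]; first by rewrite big_nil; exact: reducing_0.
by rewrite big_cons; apply: reducingD.
Qed.

(** Let m be the least index of a nonzero coefficient in S and e a unit vector that
occurs there. Take the element of S of least norm with m-th coefficient e.
Adding an element of z S does not change that coefficient, so it is orthogonal
to z S. Its image under the projection to e is in S, has the same m-th
coefficient and no larger norm, and its coefficients are multiples of e. *)
Lemma wandering S : shift_reducing S -> (exists2 a, S a & a != 0) ->
  exists (u : nat -> R[i]) (e : E) (w : l2),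
   [/\ rnorm e = 1, S w, forall n, w n = u n *: e, rnorm w = 1 &
       forall h n, S h -> hdot (zshift n.+1 h) w = 0].
Proof.
move=> rS [a0 Sa0 a00].
pose P m := `[< exists2 a, S a & a m != 0 >].
have exP : exists m, P m.
  have [m am] : exists m, a0 m != 0.
    apply/not_existsP => h; move/eqP: a00; apply; apply: hsum_ext => n.
    by apply/eqP; apply: contraT => /h.
  by exists m; apply/asboolP; exists a0.
have [m /asboolP[a Sa am] mmin] := ex_minnP exP.
have low h k : S h -> (k < m)%N -> h k = 0.
  move=> Sh km; apply/eqP; apply: contraT => hk.
  by have /mmin : P k by [apply/asboolP; exists h]; rewrite leqNgt km.
have ra0 : 0 < rnorm (a m).
  rewrite lt_def rnorm_ge0 andbT; apply: contra am => /eqP h.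
  by apply/eqP; exact: rnorm_eq0.
pose e := (rnorm (a m))^-1%:C *: a m.
have e1 : rnorm e = 1.
  by rewrite rnormZR ger0_norm ?invr_ge0 ?rnorm_ge0// mulVf ?gt_eqF.
pose A := [set b | S b /\ b m = e].
have [v Av vmin] : exists2 v, A v & forall b, A b -> rnorm v <= rnorm b.
  apply: min_norm.
  - exists (coef_rank1 (a m) ((rnorm (a m) ^+ 2)^-1%:C *: e) a); split.
      exact: reducing_rank1.
    rewrite coef_rank1E scalerA innerxx -rmorphM/= mulfV ?scale1r//.
    by rewrite expf_neq0// gt_eqF.
  - move=> u l uA ul; split; first by apply: (reducing_closed rS) ul => n; case: (uA n).
    apply/eqP; rewrite -subr_eq0; apply/eqP/rnorm_eq0/eqP; rewrite eq_le rnorm_ge0 andbT.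
    apply/ler_addgt0Pl => d d0; rewrite addr0.
    have /cvg_rnormP/(_ d d0)[N hN] := ul.
    rewrite -(uA N).2; apply: le_trans (hN N (leqnn N)).
    exact: (rnorm_coord (l - u N) m).
  - move=> b c [Sb bm] [Sc cm]; split; first by apply: reducingZ => //; exact: reducingD.
    by rewrite -[LHS]/((2^-1)%:C *: (b m + c m)) bm cm half_double.
have ee : inner e e = 1 by rewrite innerxx e1 expr1n.
pose w0 := coef_rank1 e e v.
have Aw0 : A w0.
  by split; [apply: reducing_rank1 => //; case: Av|rewrite coef_rank1E (Av).2 ee scale1r].
have w0min b : A b -> rnorm w0 <= rnorm b.
  move=> /vmin; apply: le_trans; apply: le_trans (rnorm_coef_rank1 _ _ _) _.
  by rewrite e1 !mul1r.
have d0 : 0 < rnorm w0.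
  by apply: lt_le_trans (rnorm_coord w0 m); rewrite (Aw0).2 e1.
have orth h n : S h -> hdot (zshift n.+1 h) w0 = 0.
  move=> Sh; apply: min_norm_orth => t; apply: w0min; split.
    by apply: reducingD => //; [case: Aw0|apply: reducingZ => //; exact: reducing_iter_shift].
  rewrite -[LHS]/(w0 m + t%:C *: zshift n.+1 h m) (Aw0).2 zshiftE.
  case: ltnP => nm; first by rewrite scaler0 addr0.
  by rewrite (low h)// ?scaler0 ?addr0// ltn_subrL/= (leq_trans _ nm).
pose u n := (rnorm w0)^-1%:C * inner (v n) e.
exists u, e, ((rnorm w0)^-1%:C *: w0); split => //.
- by apply: reducingZ => //; case: Aw0.
- move=> n; rewrite -[LHS]/((rnorm w0)^-1%:C *: (w0 n)) /w0 coef_rank1E scalerA.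
  by [].
- by rewrite rnormZR ger0_norm ?invr_ge0 ?rnorm_ge0// mulVf ?gt_eqF.
- by move=> h n Sh; rewrite hdotZr orth// mulr0.
Qed.

Section inner_sequence.
(* w = u e is the normalized wandering vector; multiplication by u is shown to be
   an isometry onto S. *)
Variables (u : nat -> R[i]) (e : E) (w : l2) (S : set l2).
Hypotheses (rS : shift_reducing S) (e1 : rnorm e = 1) (Sw : S w).
Hypotheses (wE : forall n, w n = u n *: e) (w1 : rnorm w = 1).
Hypothesis worth : forall h n, S h -> hdot (zshift n.+1 h) w = 0.

Let ee : inner e e = 1. Proof. by rewrite innerxx e1 expr1n. Qed.

(* the product of u and the constant x, obtained from u e by a rank-one operator *)
Lemma ueE x n : coef_rank1 e x w n = u n *: x.
Proof. by rewrite coef_rank1E wE innerZl ee mulr1. Qed.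

Let ue x := coef_rank1 e x w.

Lemma rank1_w (x : E) n : rank1 e x (w n) = u n *: x.
Proof. exact: ueE. Qed.

Lemma sq_u_cvg : series (fun n => sqabs (u n)) @ \oo --> (1 : R).
Proof.
have := cvg_hnorm w; rewrite w1 expr1n.
apply: cvg_trans; apply: near_eq_cvg; apply: nearW => N.
by apply: eq_bigr => n _; rewrite wE rnormZ_sq e1 expr1n mulr1.
Qed.

Lemma S_ue x : S (ue x). Proof. exact: reducing_rank1. Qed.

(** The rank-one operators x to e and e to x are adjoint to each other, which
reduces x to e. *)
Lemma S_orth_ue h n x : S h -> hdot (zshift n.+1 h) (ue x) = 0.
Proof.
move=> Sh; rewrite -(worth n (reducing_rank1 rS x e Sh)).
apply: eq_hdot => k; rewrite !zshiftE ueE wE.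
case: ifP => _; first by rewrite !rdot0l.
rewrite coef_rank1E rdotZr rdotZl innerZr ee mulr1.
by congr complex.Re; rewrite mulrC.
Qed.

Lemma hdot_ue x y : hdot (ue x) (ue y) = rdot x y.
Proof.
apply: hdot_unique.
have h : series (fun n => sqabs (u n)) N * rdot x y @[N --> \oo] --> 1 * rdot x y.
  by apply: cvgM; [exact: sq_u_cvg|exact: cvg_cst].
rewrite mul1r in h; apply: cvg_trans h; apply: near_eq_cvg; apply: nearW => N.
rewrite /series/= mulr_suml; apply: eq_bigr => n _.
rewrite !rank1_w rdotZl innerZr /rdot; case: (u n) => p q; case: (inner x y) => p' q'.
by rewrite /sqabs /=; ring.
Qed.

Lemma hdot_sh_ue n m x y : (n != m)%N -> hdot (zshift n (ue x)) (zshift m (ue y)) = 0.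
Proof.
wlog nm : n m x y / (n < m)%N.
  move=> H nm; case: (ltngtP n m) nm => // h _; first by apply: H => //; rewrite ltn_eqF.
  by rewrite hdotC; apply: H => //; rewrite ltn_eqF.
move=> _; rewrite hdotC -(subnK (ltnW nm)) addnC -zshift_add hdot_zshift.
have : (0 < m - n)%N by rewrite subn_gt0.
by case: (m - n)%N => // k _; apply: S_orth_ue; exact: S_ue.
Qed.

(** The product of u and the polynomial with coefficients g 0, ..., g N.-1. *)
Definition upoly N (g : nat -> E) : l2 := \sum_(n < N) zshift n (ue (g n)).

Lemma rnorm_upoly N g : rnorm (upoly N g) ^+ 2 = \sum_(n < N) rnorm (g n) ^+ 2.
Proof.
rewrite /upoly; elim: N => [|N IH]; first by rewrite !big_ord0 rnorm0 expr0n.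
rewrite !big_ord_recr/= hnormD_sq IH hdot_suml [X in 2 * X]big1 ?mulr0 ?addr0; last first.
  by move=> i _; rewrite hdot_sh_ue// ltn_eqF.
by rewrite rnorm_zshift -[rnorm (ue _) ^+ 2]hdotxx hdot_ue rdotxx.
Qed.

Lemma upolyE N g k : upoly N g k = cauchy_prod u (fun n => if (n < N)%N then g n else 0) k.
Proof.
rewrite /upoly hsum_sumE.
have -> : cauchy_prod u (fun n => if (n < N)%N then g n else 0) k =
    \sum_(0 <= j < k.+1) u (k - j)%N *: (if (j < N)%N then g j else 0).
  rewrite /cauchy_prod (reindex_inj rev_ord_inj) big_mkord; apply: eq_bigr => j _ /=.
  by rewrite subSS subKn// leq_ord.
have -> : \sum_(j < N) zshift j (ue (g j)) k = \sum_(0 <= j < N) zshift j (ue (g j)) k.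
  by rewrite big_mkord.
pose F j := if (j <= k)%N && (j < N)%N then u (k - j)%N *: g j else 0.
transitivity (\sum_(0 <= j < maxn N k.+1) F j).
  rewrite (big_nat_trim (leq_maxl _ _)); last first.
    by move=> j Nj; rewrite /F [(j < N)%N]ltnNge Nj andbF.
  apply: eq_big_nat => j /andP[_ jN].
  by rewrite zshiftE /F jN andbT ltnNge; case: (j <= k)%N => //; exact: ueE.
rewrite (big_nat_trim (leq_maxr _ _)); last first.
  by move=> j kj; rewrite /F leqNgt kj.
apply: eq_big_nat => j /andP[_ jk].
rewrite /F -ltnS jk andTb.
by case: ifP; rewrite ?scaler0.
Qed.

Lemma S_upoly N g : S (upoly N g).
Proof. by apply: reducing_sum => // j; apply: reducing_iter_shift => //; exact: S_ue. Qed.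

Lemma umul_exists g : exists2 f : l2, (forall n, f n = cauchy_prod u g n) & rnorm f <= rnorm g.
Proof.
apply: mk_hsum; first exact: rnorm_ge0.
move=> N; apply: le_trans (_ : rnorm (upoly N g) ^+ 2 <= _); last first.
  by rewrite rnorm_upoly hsum_partial_le.
apply: le_trans (hsum_partial_le (upoly N g) N); apply: ler_sum => n _.
rewrite upolyE (@eq_cauchy_prod _ _ _ _ g)// => k kn.
by rewrite (leq_ltn_trans kn).
Qed.

Definition umul g : l2 := projT1 (cid2 (umul_exists g)).

Lemma umulE g n : umul g n = cauchy_prod u g n.
Proof. by rewrite /umul; case: cid2. Qed.

Lemma umul_le g : rnorm (umul g) <= rnorm g.
Proof. by rewrite /umul; case: cid2. Qed.

Lemma umul_lin c g h : umul (c *: g + h) = c *: umul g + umul h.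
Proof. by apply: hsum_ext => n /=; rewrite !umulE cauchy_prod_lin. Qed.

Lemma umul0 : umul 0 = 0.
Proof. by apply: hsum_ext => n; rewrite umulE cauchy_prod0. Qed.

Lemma umulZ c g : umul (c *: g) = c *: umul g.
Proof. by have := umul_lin c g 0; rewrite umul0 !addr0. Qed.

Lemma umulD g h : umul (g + h) = umul g + umul h.
Proof. by have := umul_lin 1 g h; rewrite !scale1r. Qed.

Lemma umulB g h : umul (g - h) = umul g - umul h.
Proof. by rewrite -[g - h]addrC -scaleN1r umul_lin scaleN1r addrC. Qed.

Lemma umul_trunc N g : umul (htrunc N g) = upoly N g.
Proof. by apply: hsum_ext => n; rewrite umulE upolyE. Qed.

Lemma umul_isom g : rnorm (umul g) = rnorm g.
Proof.
have c1 : rnorm (umul (htrunc N g)) @[N --> \oo] --> rnorm (umul g).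
  apply: cvg_rnorm; apply/cvg_rnormP => d d0.
  have /cvg_rnormP/(_ d d0)[N hN] := htrunc_cvg g.
  by exists N => n /hN; rewrite -umulB; apply: le_trans; exact: umul_le.
have c2 := cvg_rnorm (htrunc_cvg g).
apply: (cvg_unique (@Rhausdorff R) c1); apply: cvg_trans c2; apply: near_eq_cvg.
apply: nearW => N; apply: rnorm_sq_eq.
by rewrite umul_trunc rnorm_upoly rnorm_htrunc.
Qed.

Lemma S_umul g : S (umul g).
Proof.
apply: (reducing_closed rS (u := fun N => umul (htrunc N g))).
  by move=> N; rewrite umul_trunc; exact: S_upoly.
apply/cvg_rnormP => d d0; have /cvg_rnormP/(_ d d0)[N hN] := htrunc_cvg g.
by exists N => n /hN; rewrite -umulB umul_isom.
Qed.

Lemma umul_hinj n x : umul (@hinj _ _ (fun _ : nat => E : normedModType R[i]) n x) = zshift n (ue x).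
Proof.
have -> : @hinj _ _ (fun _ : nat => E : normedModType R[i]) n x = htrunc n.+1 (@hinj _ _ (fun _ :
  nat => E : normedModType R[i]) n x).
  apply: hsum_ext => k; rewrite htruncE /=; case: ltnP => // nk.
  by rewrite hinj_out// ltn_eqF.
rewrite umul_trunc /upoly big_ord_recr/= big1 ?add0r ?hinj_at//.
move=> i _; rewrite hinj_out ?gtn_eqF//.
apply: hsum_ext => k; rewrite zshiftE ueE scaler0; by case: ifP.
Qed.

(** All shifts of f are orthogonal to all shifts of all u x: to one side by
[S_orth_ue], to the other by hypothesis. The monomial x z^(N+k) is approximated
by W N, the sum over j <= N of conj(u_j) z^(N+k-j) u x: the squared distance is
|x|^2 (1 - sum_(j <= N) |u_j|^2). For x = f k the inner product of z^N f with
the monomial is |x|^2, and with W N it is 0; hence |x|^4 is at most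
|f|^2 |x|^2 (1 - sum_(j <= N) |u_j|^2), which tends to 0. *)
Lemma S_orth0 f : S f -> (forall g, hdot (umul g) f = 0) -> f = 0.
Proof.
move=> Sf orth.
have corr i j x : hdot (zshift i f) (zshift j (ue x)) = 0.
  case: (ltnP j i) => ij.
    have -> : i = (j + (i - j).-1.+1)%N by rewrite prednK ?subn_gt0// subnKC// ltnW.
    by rewrite -zshift_add hdot_zshift S_orth_ue.
  have -> : j = (i + (j - i))%N by rewrite subnKC.
  by rewrite -zshift_add hdot_zshift hdotC -umul_hinj orth.
apply: hsum_ext => k; set x := f k; apply: rnorm_eq0.
pose del N := @hinj _ _ (fun _ : nat => E : normedModType R[i]) (N + k)%N x.
pose W N := \sum_(j < N.+1) zshift (N + k - j)%N (ue (conjc (u j) *: x)).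
have fW N : hdot (zshift N f) (W N) = 0 by rewrite hdot_sumr big1.
have fdel N : hdot (zshift N f) (del N) = rnorm x ^+ 2.
  by rewrite hdotC hdot_hinj addnC zshift_shifted rdotxx.
pose s N := \sum_(j < N.+1) sqabs (u j).
have delW N : hdot (del N) (W N) = s N * rnorm x ^+ 2.
  rewrite hdot_sumr mulr_suml; apply: eq_bigr => j _.
  have jN : (j <= N + k)%N by rewrite (leq_trans (leq_ord j)) ?leq_addr.
  rewrite hdot_hinj -{2}(subnKC jN) zshift_shifted ueE rdotZr innerZr innerxx.
  by case: (u j) => p q; rewrite /sqabs /=; ring.
have WW N : rnorm (W N) ^+ 2 = s N * rnorm x ^+ 2.
  rewrite -hdotxx hdot_suml.
  rewrite mulr_suml; apply: eq_bigr => i _.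
  rewrite hdot_sumr (bigD1 i)//= big1 ?addr0.
    rewrite hdot_zshift hdot_ue rdotxx rnormZ_sq; congr (_ * _).
    by case: (u i) => p q; rewrite /sqabs /= sqrrN.
  move=> j ji; apply: hdot_sh_ue; apply: contra ji => /eqP h; apply/eqP/val_inj => /=.
  have iN : (i <= N + k)%N by rewrite (leq_trans (leq_ord i)) ?leq_addr.
  have jN : (j <= N + k)%N by rewrite (leq_trans (leq_ord j)) ?leq_addr.
  by rewrite -(subKn iN) h subKn.
have bound N : (rnorm x ^+ 2) ^+ 2 <= rnorm f ^+ 2 * rnorm x ^+ 2 * (1 - s N).
  have h : hdot (zshift N f) (del N - W N) = rnorm x ^+ 2.
    by rewrite hdotDr hdotNr fW fdel subr0.
  have h1 := hdot_CS (zshift N f) (del N - W N).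
  rewrite h rnorm_zshift (ger0_norm (sqr_ge0 (rnorm x))) in h1.
  have h2 := sqr_le (sqr_ge0 (rnorm x)) h1.
  have dn : rnorm (del N) = rnorm x by exact: rnorm_hinj.
  rewrite [X in _ <= X]exprMn (hnormB_sq (del N) (W N)) delW WW dn in h2.
  move: h2; move: (rnorm f ^+ 2) (rnorm x ^+ 2) (s N) => p q r h2.
  by apply: (le_trans h2); rewrite le_eqVlt; apply/orP; left; apply/eqP; ring.
have sc : s N @[N --> \oo] --> (1 : R).
  have := sq_u_cvg; rewrite -(cvg_shiftn 1); apply: cvg_trans; apply: near_eq_cvg.
  by apply: nearW => N; rewrite /s /series/= addn1 big_mkord.
have c : rnorm f ^+ 2 * rnorm x ^+ 2 * (1 - s N) @[N --> \oo] --> rnorm f ^+ 2 * rnorm x ^+ 2 * (1 - 1).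
  by apply: cvgM; [exact: cvg_cst|apply: cvgB => //; exact: cvg_cst].
rewrite subrr mulr0 in c.
have := ge_lim (N := 0) c (fun n _ => bound n) => h0.
have : rnorm x ^+ 2 = 0 by apply/eqP; rewrite -sqrf_eq0 eq_le h0 sqr_ge0.
by move/eqP; rewrite sqrf_eq0 => /eqP.
Qed.

(** The element of f - u H^2 of least norm is in S and orthogonal to u H^2. *)
Lemma S_umul_onto f : S f -> exists g, f = umul g.
Proof.
move=> Sf; pose A := [set h | exists g, h = f - umul g].
have [v [g vE] vmin] : exists2 v, A v & forall h, A h -> rnorm v <= rnorm h.
  apply: min_norm.
  - by exists f; exists 0; rewrite umul0 subr0.
  - move=> a l /choice[g gE] al.
    have [|gl gcvg] := @complete_l2 _ _ g.
      move=> d d0; have d20 : 0 < d / 2 by rewrite divr_gt0.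
      have /cvg_rnormP/(_ _ d20)[N hN] := al; exists N => m n Nm Nn.
      rewrite -umul_isom umulB.
      have -> : umul (g m) - umul (g n) = (l - a m) - (l - a n).
        by rewrite !gE -zmod_sub3.
      apply: le_trans (rnormD _ _) _; rewrite rnormN.
      by have := hN m Nm; have := hN n Nn; lra.
    exists gl; apply: (cvg_unique _ al); first exact: norm_hausdorff.
    apply/cvg_rnormP => d d0; have /cvg_rnormP/(_ _ d0)[N hN] := gcvg.
    exists N => n /hN h; rewrite gE.
    by rewrite zmod_sub2 -umulB rnormN umul_isom.
  - move=> a b [ga ->] [gb ->]; exists ((2^-1)%:C *: (ga + gb)).
    rewrite umulZ umulD addrACA -opprD scalerBr; congr (_ - _).
    by rewrite half_double.
exists g; apply/eqP; rewrite -subr_eq0; apply/eqP; rewrite -vE.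
apply: S_orth0.
  rewrite vE -scaleN1r addrC; apply: reducing_lin => //; exact: S_umul.
move=> h; apply: min_norm_orth => t; apply: vmin; exists (g - t%:C *: h).
by rewrite vE umulB umulZ opprB addrA addrAC.
Qed.

End inner_sequence.

(** Beurling's theorem: the third clause says S = u H^2, and the first two, that
multiplication by u is an isometry. *)
Theorem beurling S : shift_reducing S -> (exists2 a, S a & a != 0) ->
  exists u : nat -> R[i],
    [/\ series (fun n => sqabs (u n)) @ \oo --> (1 : R),
        forall g, exists2 f : l2, (forall n, f n = cauchy_prod u g n) & rnorm f = rnorm g &
        forall f, S f <-> exists g : l2, forall n, f n = cauchy_prod u g n].
Proof.
move=> rS /(wandering rS)[u [e [w [e1 Sw wE w1 wo]]]].
exists u; split.
- exact: (sq_u_cvg e1 wE w1).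
- move=> g; exists (umul rS e1 Sw wE w1 wo g); first exact: umulE.
  exact: umul_isom.
- move=> f; split.
    by move=> /(S_umul_onto rS e1 Sw wE w1 wo)[g ->]; exists g => n; rewrite umulE.
  move=> [g gE]; rewrite (_ : f = umul rS e1 Sw wE w1 wo g); first exact: S_umul.
  by apply: hsum_ext => n; rewrite gE umulE.
Qed.

End beurling.

(** * Power series on the disc *)

Section scalar_complete.
Variable R : realType.

Lemma complete_real (u : nat -> R) :
  (forall e : R, 0 < e -> exists N, forall m n, (N <= m)%N -> (N <= n)%N -> `|u m - u n| <= e) ->
  exists l : R, u @ \oo --> l.
Proof.
move=> h; suff : cvg (u @ \oo) by move=> ?; exists (lim (u @ \oo)).
apply/cauchy_cvgP; apply/cauchy_ballP => e e0; near_simpl.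
have e1 : 0 < e / 2 by rewrite divr_gt0.
have [N Nh] := h _ e1.
near=> m n; rewrite -ball_normE /=.
apply: le_lt_trans (Nh m n _ _) _; last by lra.
  by near: m; exact: nbhs_infty_ge.
by near: n; exact: nbhs_infty_ge.
Unshelve. all: by end_near. Qed.

Lemma abs_Re_le (w : R[i]) : `|complex.Re w| <= rnorm (w : R[i]^o).
Proof. by apply: abs_Re_sq; rewrite ?rnorm_ge0// rnorm_sqE. Qed.

Lemma abs_Im_le (w : R[i]) : `|complex.Im w| <= rnorm (w : R[i]^o).
Proof. by apply: abs_Im_sq; rewrite ?rnorm_ge0// rnorm_sqE. Qed.

Lemma complete_complex (u : nat -> R[i]^o) :
  (forall e : R, 0 < e -> exists N, forall m n, (N <= m)%N -> (N <= n)%N -> rnorm (u m - u n) <= e) ->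
  exists l : R[i]^o, u @ \oo --> l.
Proof.
move=> h.
have [a ha] : exists l : R, (fun n => complex.Re (u n)) @ \oo --> l.
  apply: complete_real => e /h[N hN]; exists N => m n Nm Nn; apply: le_trans (hN m n Nm Nn).
  by apply: le_trans (abs_Re_le _); case: (u m) => ? ?; case: (u n).
have [b hb] : exists l : R, (fun n => complex.Im (u n)) @ \oo --> l.
  apply: complete_real => e /h[N hN]; exists N => m n Nm Nn; apply: le_trans (hN m n Nm Nn).
  by apply: le_trans (abs_Im_le _); case: (u m) => ? ?; case: (u n).
by exists (a +i* b); apply: cvg_complex.
Qed.

End scalar_complete.

Section power_series_facts.
Variables (R : realType) (V : normedModType R[i]).
Implicit Types (a : nat -> V) (z : R[i]).

Definition seq_complete := forall u : nat -> V,
  (forall e : R, 0 < e -> exists N, forall m n, (N <= m)%N -> (N <= n)%N -> rnorm (u m - u n) <= e) ->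
  exists l : V, u @ \oo --> l.

Definition rabs z : R := rnorm (z : R[i]^o).

Lemma rabs_ge0 z : 0 <= rabs z. Proof. exact: rnorm_ge0. Qed.

Lemma rabs_lt1 z : `|z| < 1 -> rabs z < 1.
Proof. by rewrite (rnormE (z : R[i]^o)) -[1]/(1%:C) ltcR. Qed.

Lemma rnorm_term a z n : rnorm (z ^+ n *: a n) = rabs z ^+ n * rnorm (a n).
Proof.
rewrite rnormZ; congr (_ * _).
by rewrite normrX (rnormE (z : R[i]^o)) -rmorphXn.
Qed.

Lemma pser_diff a z (B q : R) N M : 0 <= q < 1 -> 0 <= B ->
  (forall n, rabs z ^+ n * rnorm (a n) <= B * q ^+ n) -> (N <= M)%N ->
  rnorm (power_series a z M - power_series a z N) <= B * (q ^+ N / (1 - q)).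
Proof.
move=> q01 B0 h NM; rewrite /power_series /series/= (big_cat_nat (leq0n N) NM)/= addrAC subrr add0r.
apply: le_trans (rnorm_sum _ _ _) _.
apply: (@le_trans _ _ (\sum_(N <= n < M) B * q ^+ n)).
  by apply: ler_sum => n _; rewrite rnorm_term.
by rewrite -mulr_sumr ler_wpM2l// geo_sum.
Qed.

Lemma geo_small (K q : R) : 0 <= q < 1 -> K * q ^+ n @[n --> \oo] --> (0 : R).
Proof.
move=> /andP[q0 q1]; rewrite -[X in _ --> X](mulr0 K); apply: cvgM; first exact: cvg_cst.
by apply: cvg_expr; rewrite ger0_norm.
Qed.

Lemma geo_small_ex (K q e : R) : 0 <= q < 1 -> 0 < e ->
  exists N, forall n, (N <= n)%N -> K * q ^+ n <= e.
Proof.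
move=> q01 e0; have /cvgrPdist_le/(_ e e0)[N _ h] := geo_small K q01.
exists N => n /h /=; rewrite sub0r normrN; apply: le_trans; exact: ler_norm.
Qed.

Lemma pser_cvg a z B : seq_complete -> `|z| < 1 -> (forall n, rnorm (a n) <= B) ->
  exists l : V, power_series a z @ \oo --> l.
Proof.
move=> comp /rabs_lt1 z1 aB; have z01 : 0 <= rabs z < 1 by rewrite rabs_ge0.
have B0 : 0 <= B by apply: le_trans (rnorm_ge0 _) (aB 0%N).
have h n : rabs z ^+ n * rnorm (a n) <= B * rabs z ^+ n by rewrite mulrC ler_wpM2r ?exprn_ge0 ?rabs_ge0.
apply: comp => e e0.
have [N hN] := geo_small_ex (B / (1 - rabs z)) z01 e0.
exists N => m n; wlog mn : m n / (m <= n)%N.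
  move=> H Nm Nn; case: (leqP m n) => mn; first exact: H.
  by rewrite rnormB; apply: H => //; exact: ltnW.
move=> Nm Nn; rewrite rnormB; apply: le_trans (pser_diff z01 B0 h mn) _.
by have := hN m Nm; rewrite mulrAC -mulrA.
Qed.

Lemma pser_tail a z (B q : R) v N : 0 <= q < 1 -> 0 <= B ->
  (forall n, rabs z ^+ n * rnorm (a n) <= B * q ^+ n) -> power_series a z @ \oo --> v ->
  rnorm (v - power_series a z N) <= B * (q ^+ N / (1 - q)).
Proof.
move=> q01 B0 h av; apply: (rnorm_cvg_le (N := N) av) => M NM.
exact: pser_diff.
Qed.

Lemma cvg_rnorm_bounded (x : nat -> V) (l : V) : x @ \oo --> l -> exists2 B, 0 <= B & forall n,
  rnorm (x n) <= B.
Proof.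
move=> /cvg_rnormP/(_ 1 ltr01)[N hN].
exists (rnorm l + 1 + \sum_(n < N) rnorm (x n)).
  by rewrite !addr_ge0 ?rnorm_ge0// sumr_ge0// => i _; exact: rnorm_ge0.
move=> n; have [Nn|nN] := leqP N n.
  apply: (@le_trans _ _ (rnorm l + 1)); last first.
    by rewrite lerDl sumr_ge0// => i _; exact: rnorm_ge0.
  have := rnormD (x n - l) l; rewrite subrK => /le_trans; apply.
  by rewrite addrC lerD2l rnormB hN.
rewrite (bigD1 (Ordinal nN))//= addrCA lerDl addr_ge0// ?addr_ge0 ?rnorm_ge0//.
by apply: sumr_ge0 => i _; exact: rnorm_ge0.
Qed.

(** The terms are bounded at the larger radius (1 + |z|) / 2. *)
Lemma pser_geo a (f : disc R -> V) : (forall z : disc R, power_series a (val z) @ \oo --> f z) ->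
  forall z, `|z| < 1 -> exists B q, [/\ 0 <= B, 0 <= q < 1 &
     forall n, rabs z ^+ n * rnorm (a n) <= B * q ^+ n].
Proof.
move=> af z /rabs_lt1 z1; have z0 := rabs_ge0 z.
pose rho := (1 + rabs z) / 2.
have rho0 : 0 < rho by rewrite /rho; lra.
have rho1 : rho < 1 by rewrite /rho; lra.
have r1 : `|rho%:C : R[i]| < 1.
  by rewrite ger0_norm ?ler0c ?(ltW rho0)// -[1]/(1%:C) ltcR.
have [B B0 hB] := cvg_rnorm_bounded (af (exist _ rho%:C r1)).
have term n : rho ^+ n * rnorm (a n) <= 2 * B.
  have -> : rho ^+ n * rnorm (a n) = rnorm (power_series a rho%:C n.+1 - power_series a rho%:C n).
    rewrite /power_series /series/= big_nat_recr//= addrAC subrr add0r rnorm_term.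
    by rewrite /rabs /rnorm ger0_norm ?ler0c ?(ltW rho0).
  apply: le_trans (rnormD _ _) _; rewrite rnormN.
  by have := hB n; have := hB n.+1; rewrite /=; lra.
exists (2 * B), (rabs z / rho); split; first by lra.
  by rewrite divr_ge0 ?(ltW rho0)//= ltr_pdivrMr// mul1r /rho; lra.
move=> n; rewrite exprMn exprVn mulrA ler_pdivlMr ?exprn_gt0//.
by rewrite mulrAC [leRHS]mulrC -mulrA ler_wpM2l ?exprn_ge0// mulrC.
Qed.

(** The difference of the two series converges at 1/2, so its dilation by 1/4 has
square-summable coefficients, and square-summable coefficients are determined
by the sum. *)
Lemma pser_unique a b (f : disc R -> V) :
  (forall z : disc R, power_series a (val z) @ \oo --> f z) ->
  (forall z : disc R, power_series b (val z) @ \oo --> f z) -> forall n, a n = b n.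
Proof.
move=> af bf.
pose c n := - 1 *: a n + b n.
have c0 (z : disc R) : power_series c (val z) @ \oo --> (0 : V).
  have := @cvg_power_series_lin R V (-1) _ _ _ _ _ (af z) (bf z).
  by rewrite scaleN1r addNr.
have h2 : `|(2^-1)%:C : R[i]| < 1.
  by rewrite ger0_norm ?ler0c ?invr_ge0// -[X in _ < X]/(1%:C) ltcR; lra.
have [B [q [B0 /andP[q0 q1] hq]]] := pser_geo c0 h2.
pose s := (2^-1)%:C : R[i].
have rs : rabs s = 2^-1 by rewrite /rabs /rnorm ger0_norm ?ler0c ?invr_ge0.
have cs n : rnorm (s ^+ n *: (s ^+ n *: c n)) <= B * 2^-1 ^+ n.
  rewrite (rnorm_term (fun n => s ^+ n *: c n)) rnorm_term rs mulrC.
  rewrite ler_wpM2r ?exprn_ge0 ?invr_ge0// -rs; apply: le_trans (hq n) _.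
  by rewrite ler_piMr// exprn_ile1// ltW.
have [l lE _] : exists2 l : hsum (fun _ : nat => V), (forall n, l n = s ^+ n *: (s ^+ n *: c n)) &
  rnorm l <= B * 2.
  apply: (@mk_hsum R (fun _ : nat => V) (fun n => s ^+ n *: (s ^+ n *: c n))); first by rewrite mulr_ge0.
  move=> N; apply: (@le_trans _ _ (\sum_(0 <= n < N) B ^+ 2 * 4^-1 ^+ n)).
    rewrite big_mkord; apply: ler_sum => n _.
    have -> : 4^-1 ^+ n = (2^-1 ^+ n) ^+ 2 :> R by rewrite -exprM mulnC exprM; congr (_ ^+ _);
      rewrite exprVn -natrX.
    rewrite -exprMn; by apply: sqr_le; [exact: rnorm_ge0|exact: cs].
  rewrite -mulr_sumr exprMn ler_wpM2l ?sqr_ge0//.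
  have h4 : 0 <= (4^-1 : R) < 1 by lra.
  by apply: le_trans (geo_sum 0 N h4) _; rewrite expr0 ler_pdivrMr; lra.
have l0 n : l n = 0.
  apply: power_series_inj0 => z.
  have sz : `|s * s * val z| < 1.
    rewrite !normrM (rnormE (s : R[i]^o)) -/(rabs s) rs.
    have := valP z; rewrite /= => z1.
    have := rabs_lt1 z1; rewrite (rnormE (val z : R[i]^o)) -!rmorphM /= -[1]/(1%:C) ltcR -/(rabs _).
    have := rabs_ge0 (val z); nra.
  rewrite (_ : power_series l _ = power_series c (s * s * val z)); first exact: (c0 (exist _ (s * s
    * val z) sz)).
  apply/funext => N.
  rewrite /power_series /series/=; apply: eq_bigr => k _.
  by rewrite lE !scalerA !exprMn; congr (_ *: _); ring.
move=> n; have := l0 n; rewrite lE => /eqP; rewrite scalerA scaler_eq0 mulf_eq0 orbb expf_eq0.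
have s0 : s != 0 by apply/eqP => s0; move: rs; rewrite s0 /rabs rnorm0; lra.
by rewrite (negbTE s0) andbF/= /c scaleN1r addrC subr_eq0 => /eqP.
Qed.

Lemma pser_shift a z v m : power_series a z @ \oo --> v ->
  power_series (fun n => if (n < m)%N then 0 else a (n - m)%N) z @ \oo --> z ^+ m *: v.
Proof.
move=> av; rewrite -(cvg_shiftn m).
have h : z ^+ m *: power_series a z n @[n --> \oo] --> z ^+ m *: v by apply: cvgZr.
apply: cvg_trans h; apply: near_eq_cvg; apply: nearW => n.
rewrite /power_series /series/= addnC (big_cat_nat (leq0n m) (leq_addr n m)).
rewrite [X in _ = X + _](_ : _ = 0) ?add0r; last first.
  by rewrite big_nat big1// => i /andP[_ im]; rewrite im scaler0.
rewrite -{2}[m]add0n big_addn addKn scaler_sumr; apply: eq_bigr => i _.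
by rewrite scalerA -exprD [(m + i)%N]addnC ltnNge leq_addl/= addnK.
Qed.

End power_series_facts.

(** * Products in the Hardy space *)

Section mertens.
Variables (R : realType) (V : lmodType R[i]).

Definition partial_sum (a : nat -> V) z N : V := \sum_(n < N) z ^+ n *: a n.

(** Summation by the power of z carried by u. *)
Lemma partial_sum_cauchy_prod u (a : nat -> V) z N :
  partial_sum (cauchy_prod u a) z N = \sum_(i < N) (z ^+ i * u i) *: partial_sum a z (N - i).
Proof.
elim: N => [|N IH]; first by rewrite /partial_sum !big_ord0.
rewrite /partial_sum big_ord_recr/= -/(partial_sum _ _ _) IH.
rewrite (eq_bigr (fun i : 'I_N.+1 => (z ^+ i * u i) *: partial_sum a z (N - i) + z ^+ N *: (u i *:
  a (N - i)%N))); last first.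
  move=> i _; have iN : (i <= N)%N by rewrite -ltnS.
  rewrite (subSn iN) {1}/partial_sum big_ord_recr/= scalerDr; congr (_ + _).
  by rewrite !scalerA mulrAC -exprD subnKC.
rewrite big_split/= big_ord_recr/= subnn [partial_sum a z 0]big_ord0 scaler0 addr0.
by rewrite /cauchy_prod scaler_sumr.
Qed.

End mertens.

Lemma partial_sumE (R : realType) (V : normedModType R[i]) (a : nat -> V) z N :
  power_series a z N = partial_sum a z N.
Proof. by rewrite /power_series /series/= big_mkord. Qed.

(** If the terms of u decay like q^n and the tails of a like t^n with q < t, the
error sum q^i t^(N-i) is O(t^N), without the factor N that a common ratio would
give. *)
Lemma common_ratio (R : realType) (p q : R) : 0 <= p < 1 -> 0 <= q < 1 ->
  exists t, [/\ p < t, q < t, 0 < t & t < 1].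
Proof.
move=> /andP[p0 p1] /andP[q0 q1]; exists ((1 + Num.max p q) / 2).
by case: (leP p q) => pq; split; lra.
Qed.

Section cauchy_product.
Variables (R : realType) (V : normedModType R[i]).

(** Mertens' theorem in a normed module. *)
Lemma cvg_cauchy_prod (u : nat -> R[i]) (a : nat -> V) (U : disc R -> R[i]^o) (f : disc R -> V) :
  (forall z : disc R, power_series (E := R[i]^o) u (val z) @ \oo --> U z) ->
  (forall z : disc R, power_series a (val z) @ \oo --> f z) ->
  forall z : disc R, power_series (cauchy_prod u a) (val z) @ \oo --> U z *: f z.
Proof.
move=> uU af z; have z1 := valP z; rewrite /= in z1.
have [B [q [B0 q01 hB]]] := pser_geo uU z1.
have [C [p [C0 p01 hC]]] := pser_geo af z1.
have [t [lpt lqt t0 t1]] := common_ratio p01 q01.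
have /andP[p0 _] := p01; have /andP[q0 _] := q01.
have t01 : 0 <= t < 1 by rewrite (ltW t0).
have hC' n : rabs (val z) ^+ n * rnorm (a n) <= C * t ^+ n.
  apply: le_trans (hC n) _; apply: ler_wpM2l => //.
  by rewrite lerXn2r ?nnegrE ?(ltW t0) ?(ltW lpt).
have tail n := pser_tail n t01 C0 hC' (@af z).
have r01 : 0 <= q / t < 1.
  by rewrite divr_ge0 ?(ltW t0)//= ltr_pdivrMr// mul1r.
have bound N : rnorm (power_series (E := R[i]^o) u (val z) N *: f z - power_series (cauchy_prod u
  a) (val z) N)
    <= B * C / (1 - t) / (1 - q / t) * t ^+ N.
  rewrite (@partial_sumE R R[i]^o) {1}/partial_sum partial_sumE partial_sum_cauchy_prod scaler_suml -sumrB.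
  apply: le_trans (rnorm_sum _ _ _) _.
  apply: (@le_trans _ _ (\sum_(0 <= i < N) (B * C / (1 - t) * t ^+ N) * (q / t) ^+ i)).
    rewrite big_mkord; apply: ler_sum => i _.
    rewrite -[_ *: (u i : R[i]^o)]/(val z ^+ i * u i) -scalerBr rnormZ.
    have -> : complex.Re `|val z ^+ i * u i| = rabs (val z) ^+ i * rnorm (u i : R[i]^o).
      by rewrite -(rnorm_term (V := R[i]^o) u).
    have := tail (N - i)%N; rewrite partial_sumE => ti.
    apply: le_trans (ler_pM _ _ (hB i) ti) _; rewrite ?rnorm_ge0//.
      by rewrite mulr_ge0 ?exprn_ge0 ?rabs_ge0 ?rnorm_ge0.
    have iN : (i <= N)%N by exact: ltnW.
    have -> : t ^+ N = t ^+ (N - i) * t ^+ i by rewrite -exprD subnK.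
    rewrite le_eqVlt; apply/orP; left; apply/eqP; rewrite expr_div_n.
    have ti0 : t ^+ i != 0 by rewrite expf_neq0// gt_eqF.
    have t10 : 1 - t != 0 by rewrite subr_eq0 gt_eqF.
    by move: (t ^+ (N - i)) (t ^+ i) ti0 (q ^+ i) => x y y0 w; field; rewrite y0 t10.
  rewrite -mulr_sumr -mulrA -[leRHS]mulrA; apply: ler_wpM2l.
    by rewrite mulr_ge0 ?mulr_ge0 ?invr_ge0 ?subr_ge0 ?(ltW t1).
  rewrite mulrC; apply: ler_wpM2r; first by rewrite exprn_ge0// ltW.
  by have := geo_sum 0 N r01; rewrite expr0 mul1r.
have Uf : power_series (E := R[i]^o) u (val z) N *: f z @[N --> \oo] --> U z *: f z.
  by apply: cvgZl.
apply/cvg_rnormP => e e0; have e2 : 0 < e / 2 by rewrite divr_gt0 ?ltr0n.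
have /cvg_rnormP/(_ _ e2)[N1 h1] := Uf.
have [N2 h2] := geo_small_ex (B * C / (1 - t) / (1 - q / t)) t01 e2.
exists (maxn N1 N2) => n; rewrite geq_max => /andP[n1 n2].
have := h1 n n1; have := le_trans (bound n) (h2 n n2).
set x := _ *: f z; set y := power_series _ _ _ => xy fx.
rewrite (_ : _ - y = (U z *: f z - x) + (x - y)); last by rewrite addrA subrK.
rewrite [leRHS]splitr; apply: le_trans (rnormD _ _) _; exact: lerD.
Qed.

End cauchy_product.

Section of_l2.
Variables (R : realType) (V : normedModType R[i]).
Hypothesis cV : seq_complete V.
Local Notation l2 := (hsum (fun _ : nat => V)).
Implicit Types (a b : l2).

Lemma l2_pser_cvg a z : `|z| < 1 -> exists l : V, power_series a z @ \oo --> l.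
Proof. by move=> z1; apply: pser_cvg z1 (rnorm_coord a). Qed.

Definition l2_eval a (z : disc R) : V := projT1 (cid (l2_pser_cvg a (valP z))).

Lemma l2_evalP a (z : disc R) : power_series a (val z) @ \oo --> l2_eval a z.
Proof. by rewrite /l2_eval; case: cid. Qed.

(** The function with a given Taylor sequence, the inverse of [taylor]. *)
Definition of_l2 a : hardy V := @Hardy R V (l2_eval a) (ex_intro _ a (@l2_evalP a)).

Lemma taylor_of_l2 a : taylor (of_l2 a) = a.
Proof. by apply: taylor_unique => z; exact: l2_evalP. Qed.

Lemma eq_taylor (f g : hardy V) : taylor f = taylor g -> f = g.
Proof.
move=> fg; apply/eqP; rewrite -subr_eq0; apply/eqP; apply: taylor_inj.
by rewrite linearB/= fg subrr.
Qed.

Lemma of_l2_taylor (f : hardy V) : of_l2 (taylor f) = f.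
Proof. by apply: eq_taylor; rewrite taylor_of_l2. Qed.

Lemma of_l2_linear : linear of_l2.
Proof.
by move=> c a b; apply: eq_taylor; rewrite linearP/= !taylor_of_l2.
Qed.

Lemma rnorm_hardy (f : hardy V) : rnorm f = rnorm (taylor f).
Proof. by []. Qed.

Lemma rnorm_of_l2 a : rnorm (of_l2 a) = rnorm a.
Proof. by rewrite rnorm_hardy taylor_of_l2. Qed.

Lemma hardy_coef_unique (f : hardy V) (a : nat -> V) :
  (forall z : disc R, power_series a (val z) @ \oo --> f z) -> forall n, taylor f n = a n.
Proof. exact: pser_unique (@taylorP _ _ f). Qed.

Lemma hardy_value (f : hardy V) (a : nat -> V) (z : disc R) v :
  (forall n, taylor f n = a n) -> power_series a (val z) @ \oo --> v -> f z = v.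
Proof.
move=> fa av; apply: cvg_unique (@taylorP _ _ f z) _ => //.
by have -> : (taylor f : nat -> V) = a by exact/funext.
Qed.

Lemma taylorZ c (f : hardy V) n : taylor (c *: f) n = c *: taylor f n.
Proof. by rewrite linearZ. Qed.

Lemma taylorD (f g : hardy V) n : taylor (f + g) n = taylor f n + taylor g n.
Proof. by rewrite linearD. Qed.

Lemma taylor_mulz (f : hardy V) n :
  taylor (mulz V f) n = if n is m.+1 then taylor f m else 0.
Proof.
rewrite (@hardy_coef_unique _ (fun n => if (n < 1)%N then 0 else taylor f (n - 1)%N)).
  by case: n => // n; rewrite subn1.
by move=> z; exact: (@pser_shift R V _ _ _ 1 (@taylorP _ _ f z)).
Qed.

Lemma taylor_iter_mulz d (f : hardy V) n :
  taylor (iter d (mulz V) f) n = if (n < d)%N then 0 else taylor f (n - d)%N.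
Proof.
elim: d n => [|d IH] n; first by rewrite subn0.
by rewrite iterS taylor_mulz; case: n => // n; rewrite IH ltnS subSS.
Qed.

Lemma iter_mulz_ex d (f : hardy V) : (forall n, (n < d)%N -> taylor f n = 0) ->
  exists g : hardy V, f = iter d (mulz V) g.
Proof.
move=> f0.
have [a aE _] : exists2 a : l2, (forall n, a n = taylor f (n + d)%N) & rnorm a <= rnorm f.
  apply: (@mk_hsum R (fun _ : nat => V) (fun n => taylor f (n + d)%N)); first exact: rnorm_ge0.
  move=> N; apply: le_trans (hsum_partial_le (taylor f) (d + N)).
  rewrite big_split_ord/= addrC -[leLHS]addr0 lerD//.
    by apply: ler_sum => i _; rewrite addnC.
  by apply: sumr_ge0 => i _; rewrite sqr_ge0.
exists (of_l2 a); apply: eq_taylor; apply: hsum_ext => n.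
rewrite taylor_iter_mulz taylor_of_l2 aE; case: ltnP => [/f0//|dn].
by rewrite subnK.
Qed.

End of_l2.

Section mul_hardy_facts.
Variables (R : realType) (E : hilbertType R).
Local Notation cE := (@complete_rnorm R E).
Implicit Types (f g h : hardy E) (u : nat -> R[i]) (U : disc R -> R[i]^o).

Lemma mul_hardyE u U f h :
  (forall z : disc R, power_series (E := R[i]^o) u (val z) @ \oo --> U z) ->
  (forall z, f z = U z *: h z) <-> (forall n, taylor f n = cauchy_prod u (taylor h) n).
Proof.
move=> uU; split=> [fE|fE z].
  apply: hardy_coef_unique => z; rewrite fE.
  exact: (cvg_cauchy_prod uU (@taylorP _ _ h)).
by apply: hardy_value fE _; exact: (cvg_cauchy_prod uU (@taylorP _ _ h)).
Qed.

Lemma zpow_taylor U f h m : zpow_hardy m U -> (forall z, f z = U z *: h z) ->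
  forall n, (n < m)%N -> taylor f n = 0.
Proof.
move=> [g gE] fE n nm.
rewrite (@hardy_coef_unique _ _ f (fun n => if (n < m)%N then 0 else cauchy_prod (taylor g) (taylor
  h) (n - m)%N)) ?nm//.
move=> z; rewrite fE gE -scalerA; apply: pser_shift.
exact: (cvg_cauchy_prod (@taylorP _ _ g) (@taylorP _ _ h)).
Qed.

(** Modulo z^(n+1) H^2 the product u h is p(z) h, with p the Taylor polynomial of u of
degree n. Since A commutes with polynomials in z and preserves z^(n+1) H^2, the
n-th coefficients of A (u h) and u (A h) agree. *)
Lemma commute_mul_hardy (A : {linear hardy E -> hardy E}) U f h :
  (forall g, A (mulz E g) = mulz E (A g)) -> analytic U ->
  (forall z, f z = U z *: h z) -> forall z, A f z = U z *: A h z.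
Proof.
move=> cA [u uU] fE; apply/(mul_hardyE _ _ uU) => n.
have iterA d g : A (iter d (mulz E) g) = iter d (mulz E) (A g).
  by elim: d => //= d IH; rewrite cA IH.
pose p g := \sum_(i < n.+1) u i *: iter i (mulz E) g.
have pE g k : (k <= n)%N -> taylor (p g) k = cauchy_prod u (taylor g) k.
  move=> kn; rewrite /p linear_sum hsum_sumE /cauchy_prod.
  rewrite (big_ord_widen_cond n.+1 xpredT (fun i => u i *: taylor g (k - i)%N)) ?ltnS//.
  rewrite [RHS]big_mkcond; apply: eq_bigr => i _.
  rewrite -[LHS]/(taylor (u i *: iter i (mulz E) g) k) taylorZ taylor_iter_mulz andTb ltnS.
  by case: leqP => _ //; rewrite scaler0.
have [g gE] : exists g, f - p h = iter n.+1 (mulz E) g.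
  apply: (iter_mulz_ex cE) => k; rewrite ltnS => kn.
  rewrite linearB/= pE// (proj1 (mul_hardyE f h uU) fE).
  exact: subrr.
have pA : A (p h) = p (A h).
  by rewrite /p [A _]linear_sum; apply: eq_bigr => i _; rewrite linearZ; congr (_ *: _); exact: iterA.
have -> : A f = p (A h) + iter n.+1 (mulz E) (A g).
  by rewrite -iterA -gE -pA -linearD addrCA subrr addr0.
by rewrite taylorD pE// taylor_iter_mulz ltnSn addr0.
Qed.

Section inner_symbol.
Variables (u : nat -> R[i]) (U : disc R -> R[i]^o).
Local Notation l2 := (hsum (fun _ : nat => E : normedModType R[i])).
Hypothesis uU : forall z : disc R, power_series (E := R[i]^o) u (val z) @ \oo --> U z.

(** U^k e has norm 1 for every k, and point evaluation at z has norm at most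
1 / (1 - |z|); hence |U z|^k is bounded in k. *)
Lemma isometric_symbol_le1 (e : E) : rnorm e = 1 ->
  (forall g : l2, exists2 f : l2, (forall n, f n = cauchy_prod u g n) & rnorm f = rnorm g) ->
  forall z, `|U z| <= 1.
Proof.
move=> e1 iso z.
have pw k : exists2 h : hardy E, rnorm h = 1 & h z = U z ^+ k *: e.
  elim: k => [|k [h h1 hz]].
    exists (of_l2 cE (@hinj _ _ (fun _ : nat => E : normedModType R[i]) 0%N e)).
      by rewrite rnorm_of_l2 rnorm_hinj.
    apply: (hardy_value (a := fun n => if (n < 1)%N then e else 0)).
      move=> n; rewrite taylor_of_l2; case: n => [|n]; first exact: hinj_at.
      exact: hinj_out.
    rewrite scale1r -(cvg_shiftn 1); apply: cvg_near_cst; apply: nearW => n.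
    rewrite /= partial_sumE /partial_sum addn1 big_ord_recl big1 ?addr0 ?scale1r//.
    by move=> i _; rewrite scaler0.
  have [f fE fn] := iso (taylor h).
  exists (of_l2 cE f); first by rewrite rnorm_of_l2 fn -rnorm_hardy.
  have := proj2 (mul_hardyE (of_l2 cE f) h uU).
  rewrite taylor_of_l2 => /(_ fE z) ->.
  by rewrite hz scalerA exprS.
have z1 := valP z; rewrite /= in z1.
have q01 : 0 <= rabs (val z) < 1 by rewrite rabs_ge0 rabs_lt1.
pose C := 1 / (1 - rabs (val z)).
have pC k : rnorm (U z) ^+ k <= C.
  have [h h1 hz] := pw k.
  have hb n : rabs (val z) ^+ n * rnorm (taylor h n) <= 1 * rabs (val z) ^+ n.
    rewrite mulrC ler_wpM2r ?exprn_ge0 ?rabs_ge0//.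
    by apply: le_trans (rnorm_coord _ _) _; rewrite -rnorm_hardy h1.
  have := pser_tail 0 q01 ler01 hb (@taylorP _ _ h z).
  rewrite partial_sumE /partial_sum big_ord0 subr0 hz rnormZ e1 mulr1 expr0 mul1r.
  by rewrite normrX (rnormE (U z : R[i]^o)) -rmorphXn.
rewrite rnormE -[X in _ <= X]/(1%:C) lecR leNgt; apply/negP => U1.
have U0 : 0 < rnorm (U z) by apply: lt_trans U1; exact: ltr01.
have i01 : 0 <= (rnorm (U z))^-1 < 1 by rewrite invr_ge0 (ltW U0) invf_lt1.
have h2 : 0 < (2^-1 : R) by rewrite invr_gt0 ltr0n.
have [N /(_ N (leqnn N))] := geo_small_ex C i01 h2.
rewrite exprVn ler_pdivrMr ?exprn_gt0// => /(le_trans (pC N)).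
by rewrite ler_pMl ?exprn_gt0// leNgt invf_lt1 ?ltr1n.
Qed.

Hypothesis usq : series (fun n => sqabs (u n)) @ \oo --> (1 : R).

Lemma partial_sq_le N : \sum_(n < N) sqabs (u n) <= 1.
Proof.
have u0 n : 0 <= sqabs (u n) by rewrite addr_ge0 ?sqr_ge0.
have inc : nondecreasing_seq (series (fun n => sqabs (u n))).
  by apply/nondecreasing_seqP => n; rewrite /series/= big_nat_recr//= lerDl.
have := nondecreasing_cvgn_le inc (cvgP _ usq) N.
by rewrite (cvg_lim _ usq)// /series/= big_mkord.
Qed.

Lemma symbol_zpow m : (forall n, (n < m)%N -> u n = 0) -> zpow_hardy m U.
Proof.
move=> um.
have [a aE _] : exists2 a : hsum (fun _ : nat => R[i]^o), (forall n, a n = u (n + m)%N) & rnorm a <= 1.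
  apply: (@mk_hsum R (fun _ : nat => R[i]^o) (fun n => u (n + m)%N)); first exact: ler01.
  move=> N; rewrite expr1n; apply: le_trans (partial_sq_le (m + N)).
  rewrite big_split_ord/= addrC -[leLHS]addr0 lerD//.
    by apply: ler_sum => i _; rewrite rnorm_sqE addnC.
  by apply: sumr_ge0 => i _; rewrite addr_ge0 ?sqr_ge0.
exists (of_l2 (@complete_complex R) a) => z.
apply: cvg_unique (@uU z) _ => //.
have := @pser_shift R (R[i]^o) _ _ _ m (@taylorP _ _ (of_l2 (@complete_complex R) a) z).
rewrite taylor_of_l2 (_ : (fun n => if (n < m)%N then 0 else a (n - m)%N) = u)//.
by apply/funext => n; case: ltnP => [/um ->//|mn]; rewrite aE subnK.
Qed.

End inner_symbol.

End mul_hardy_facts.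

(** * Truncated shifts *)

Section copies_slots.
Variables (R : realType) (G : normedModType R[i]) (m : nat).
Local Notation J := (trunc_shift G m).
Implicit Types (x y : copies m G) (a : nat -> G).

(** Indexing by natural numbers, with value 0 outside, removes all casts between
ordinals in the formulas for shifts. *)
Definition slot x (n : nat) : G := oapp x (0 : G) (insub n).

Lemma slot_ord x (i : 'I_m) : slot x i = x i.
Proof. by rewrite /slot valK. Qed.

Lemma slot_out x n : (m <= n)%N -> slot x n = 0.
Proof. by move=> mn; rewrite /slot insubF// ltnNge mn. Qed.

Lemma slot_ext x y : (forall n, (n < m)%N -> slot x n = slot y n) -> x = y.
Proof. by move=> h; apply: hsum_ext => i; rewrite -!slot_ord h. Qed.

Lemma slotP c x y n : slot (c *: x + y) n = c *: slot x n + slot y n.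
Proof. by rewrite /slot; case: insub => //=; rewrite scaler0 addr0. Qed.

Lemma slot0 n : slot 0 n = 0.
Proof. by rewrite /slot; case: insub. Qed.

Lemma slotB x y n : slot (x - y) n = slot x n - slot y n.
Proof. by rewrite addrC -scaleN1r slotP scaleN1r addrC. Qed.

Lemma slot_le x n : rnorm (slot x n) <= rnorm x.
Proof.
by rewrite /slot; case: insub => [i|] /=; rewrite ?rnorm_coord// rnorm0 rnorm_ge0.
Qed.

Definition of_slots a : copies m G := \sum_(i < m) @hinj _ _ (fun _ : 'I_m => G) i (a i).

Lemma of_slotsE a n : slot (of_slots a) n = if (n < m)%N then a n else 0.
Proof.
case: ltnP => [nm|]; last exact: slot_out.
rewrite -[n in slot _ n]/(val (Ordinal nm)) slot_ord /of_slots hsum_sumE.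
rewrite (bigD1 (Ordinal nm))//= hinj_at big1 ?addr0// => i.
exact: hinj_out.
Qed.

Lemma of_slots_le a : rnorm (of_slots a) <= \sum_(i < m) rnorm (a i).
Proof.
apply: le_trans (rnorm_sum _ _ _) _.
by apply: ler_sum => i _; rewrite rnorm_hinj.
Qed.

Lemma slot_shift x n : (n < m)%N -> slot (J x) n = if n is n'.+1 then slot x n' else 0.
Proof.
move=> nm; rewrite -[n in LHS]/(val (Ordinal nm)) slot_ord /= /ord_prev /=.
by case: n nm.
Qed.

Lemma slot_iter d x n : (n < m)%N ->
  slot (iter d J x) n = if (n < d)%N then 0 else slot x (n - d)%N.
Proof.
elim: d n => [|d IH] n nm; first by rewrite subn0.
rewrite iterS slot_shift//; case: n nm => // n nm.
by rewrite IH ?(ltnW nm)// ltnS subSS.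
Qed.

(** J^n moves slot i to slot i + n and loses the last n slots. *)
Lemma nullspace_slots n x : (n <= m)%N ->
  nullspace (iter n J) x <-> (forall i, (i < m - n)%N -> slot x i = 0).
Proof.
move=> nm; split=> [x0 i im|x0].
  have im' : (i + n < m)%N by lia.
  have := slot_iter n x im'; rewrite ltnNge leq_addl/= addnK => <-.
  by rewrite (x0 : iter n J x = 0) slot0.
apply: slot_ext => i im; rewrite slot_iter// slot0.
by case: ltnP => // ni; apply: x0; lia.
Qed.

Lemma iter_trunc_shift0 d x : (m <= d)%N -> iter d J x = 0.
Proof.
move=> md; apply: slot_ext => n nm; rewrite slot_iter// slot0.
by rewrite (leq_trans nm md).
Qed.

(** The source of the backward shift by d slots. *)
Definition ord_next d (i : 'I_m) : option 'I_m := insub (i + d)%N.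

Lemma ord_next_inj d (i j l : 'I_m) :
  ord_next d i = Some l -> ord_next d j = Some l -> i = j.
Proof.
rewrite /ord_next; case: insubP => // a _ ai [al]; case: insubP => // b _ bj [bl].
by apply: val_inj; move: ai bj; rewrite al bl => h1 h2; apply: (@addIn d); exact: etrans (esym h1) h2.
Qed.

Definition back_shift d : lin_contraction (copies m G) :=
  Contraction (pshift_linear (@ord_next_inj d)) (pshift_le (@ord_next_inj d)).

Lemma slot_back_shift d x n : slot (back_shift d x) n = slot x (n + d)%N.
Proof.
case: (ltnP n m) => nm; last by rewrite !slot_out// (leq_trans nm) ?leq_addr.
by rewrite -[n in LHS]/(val (Ordinal nm)) slot_ord.
Qed.

Lemma back_shiftK d x : (forall i, (i < d)%N -> slot x i = 0) ->
  iter d J (back_shift d x) = x.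
Proof.
move=> x0; apply: slot_ext => n nm; rewrite slot_iter// slot_back_shift.
by case: ltnP => [/x0->//|dn]; rewrite subnK.
Qed.

End copies_slots.

(** * Interpolation of slopes *)

(** The least extension, D' k = max_l (D l - max(l - k, 0)), is nondecreasing with
steps at most 1. The last clause, that values of D' are bounded by values of D,
keeps the divisibility condition on the symbol. *)
Lemma lipschitz_extension (N : nat -> Prop) (D : nat -> nat) :
  (forall l, N l -> (D l <= l.+1)%N) ->
  (forall j k, N j -> N k -> (D k <= D j + (k - j))%N) ->
  exists D' : nat -> nat, [/\ forall k, (D' k <= k.+1)%N,
    forall k, (D' k <= D' k.+1 <= (D' k).+1)%N,
    forall k, N k -> D' k = D k &
    forall k i, (i < D' k)%N -> exists2 l, N l & (i < D l)%N].
Proof.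
move=> Dle Dlip.
pose P k d := d = 0%N \/ exists2 l, N l & (d <= D l - (l - k))%N.
have P0 k : exists d, `[< P k d >] by exists 0%N; apply/asboolP; left.
have Pb k d : `[< P k d >] -> (d <= k.+1)%N.
  by case/asboolP => [->//|[l /Dle Dl]]; lia.
pose D' k := ex_maxn (P0 k) (Pb k).
have D'P k : P k (D' k) by rewrite /D'; case: ex_maxnP => d /asboolP.
have D'max k d : P k d -> (d <= D' k)%N.
  by move=> Pd; rewrite /D'; case: ex_maxnP => e _; apply; apply/asboolP.
exists D'; split.
- by move=> k; exact: (Pb k (D' k) (asboolT (D'P k))).
- move=> k; apply/andP; split.
    apply: D'max; case: (D'P k) => [->|[l Nl Dl]]; first by left.
    by right; exists l => //; lia.
  have [|D0] := leqP (D' k.+1) 1%N; first by lia.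
  rewrite -(prednK (ltnW D0)) ltnS; apply: D'max.
  case: (D'P k.+1) => [->|[l Nl Dl]]; first by left.
  by right; exists l => //; lia.
- move=> k Nk; apply/eqP; rewrite eqn_leq; apply/andP; split.
    case: (D'P k) => [->//|[l Nl Dl]].
    have := Dlip k l Nk Nl; have := Dlip l k Nl Nk; lia.
  by apply: D'max; right; exists k => //; lia.
- move=> k i iD; case: (D'P k) => [D0|[l Nl Dl]]; first by rewrite D0 in iD.
  by exists l => //; lia.
Qed.

(** * Reducing summands *)

Section linear_functions.
Variables (R : realType) (V W : lmodType R[i]) (f : V -> W).
Hypothesis lf : linear f.

Lemma lin_sub x y : f (x - y) = f x - f y.
Proof. by rewrite addrC -scaleN1r lf scaleN1r addrC. Qed.

Lemma lin_zero : f 0 = 0.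
Proof. by rewrite -(subrr 0) lin_sub subrr. Qed.

Lemma lin_add x y : f (x + y) = f x + f y.
Proof. by have := lf 1 x y; rewrite !scale1r. Qed.

End linear_functions.

Section summand.
Variable R : realType.

(** W with the operator S is a reducing summand of V with the operator T. Treating
all summands through this interface gives one statement for maps between the
Hardy space and truncated shifts of any lengths. *)
Record summand (V W : normedModType R[i]) (T : V -> V) (S : W -> W) := Summand {
  pr : V -> W;
  inj : W -> V;
  pr_linear : linear pr;
  inj_linear : linear inj;
  pr_le : forall v, rnorm (pr v) <= rnorm v;
  inj_le : forall w, rnorm (inj w) <= rnorm w;
  injK : forall w, pr (inj w) = w;
  pr_commute : forall v, pr (T v) = S (pr v);
  inj_commute : forall w, T (inj w) = inj (S w)
}.

Section summand_linear.
Variables (V W : normedModType R[i]) (T : V -> V) (S : W -> W) (s : summand T S).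

Lemma inj0 : inj s 0 = 0.
Proof. exact: lin_zero (inj_linear s). Qed.

Lemma injD x y : inj s (x + y) = inj s x + inj s y.
Proof. exact: lin_add (inj_linear s) x y. Qed.

Lemma injB x y : inj s (x - y) = inj s x - inj s y.
Proof. exact: lin_sub (inj_linear s) x y. Qed.

Lemma pr0 : pr s 0 = 0.
Proof. exact: lin_zero (pr_linear s). Qed.

Lemma prD x y : pr s (x + y) = pr s x + pr s y.
Proof. exact: lin_add (pr_linear s) x y. Qed.

End summand_linear.

Lemma pr_iter V W T S (s : @summand V W T S) d v : pr s (iter d T v) = iter d S (pr s v).
Proof. by elim: d => //= d IH; rewrite pr_commute IH. Qed.

Lemma inj_iter V W T S (s : @summand V W T S) d w : iter d T (inj s w) = inj s (iter d S w).
Proof. by elim: d => //= d IH; rewrite IH inj_commute. Qed.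

Definition summand_comp V W U T S Q (s : @summand V W T S) (r : @summand W U S Q) :
  summand T Q.
Proof.
refine (@Summand _ _ T Q (fun v => pr r (pr s v)) (fun u => inj s (inj r u)) _ _ _ _ _ _ _).
- by move=> c x y; rewrite !pr_linear.
- by move=> c x y; rewrite !inj_linear.
- by move=> v; apply: le_trans (pr_le _ _) (pr_le _ _).
- by move=> v; apply: le_trans (inj_le _ _) (inj_le _ _).
- by move=> w; rewrite !injK.
- by move=> v; rewrite !pr_commute.
- by move=> w; rewrite !inj_commute.
Defined.

Definition hsum_summand (I : choiceType) (V : I -> normedModType R[i])
  (T : forall i, lin_contraction (V i)) i : summand (hsum_map T) (T i).
Proof.
refine (@Summand _ _ (hsum_map T) (T i) (fun v : hsum V => v i) (fun w => hinj w) _ _ _ _ _ _ _).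
- by [].
- exact: hinj_linear.
- by move=> v; exact: rnorm_coord.
- by move=> w; rewrite rnorm_hinj.
- exact: hinj_at.
- by [].
- move=> w; apply: hsum_ext => j /=.
  have [<-|ij] := eqVneq i j; first by rewrite !hinj_at.
  rewrite !hinj_out//; have := contraction_linear (T j) (-1) 0 0.
  by rewrite scaler0 addr0 scaleN1r addNr.
Defined.

(** Projecting, applying A and injecting commutes with T. *)
Lemma hyperinvariant_intertwiner V W W' T S S' (s : @summand V W T S) (s' : @summand V W' T S')
    (M : set V) (A : W -> W') c :
  hyperinvariant T M -> linear A -> (forall w, rnorm (A w) <= c * rnorm w) -> 0 <= c ->
  (forall w, A (S w) = S' (A w)) -> forall v, M v -> M (inj s' (A (pr s v))).
Proof.
move=> hM linA Ale c0 AS.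
pose X v := inj s' (A (pr s v)).
have linX : linear X by move=> a x y; rewrite /X pr_linear linA inj_linear.
pose X' : {linear V -> V} := HB.pack_for {linear V -> V} X
  (GRing.isLinear.Build R[i] V V *:%R X linX).
apply: (hM X').
- exists c => x; rewrite rnormE (rnormE x) -rmorphM lecR.
  apply: le_trans (inj_le _ _) _; apply: le_trans (Ale _) _.
  by rewrite ler_wpM2l// pr_le.
- by move=> v; rewrite /= /X pr_commute AS inj_commute.
Qed.

End summand.

(** * Hyperinvariant subspaces of the model *)

Lemma closed_seq (R : realType) (W : normedModType R[i]) (M : set W) (u : nat -> W) l :
  closed M -> (forall n, M (u n)) -> u @ \oo --> l -> M l.
Proof.
move=> cM Mu ul; by apply: (closed_cvg M cM _ _ ul); exact: nearW.
Qed.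

Section htrunc_rec.
Variables (R : realType) (V : nat -> normedModType R[i]).

Lemma htrunc0 (x : hsum V) : htrunc 0 x = 0.
Proof. by apply: hsum_ext => k; rewrite htruncE. Qed.

Lemma htruncS (x : hsum V) N : htrunc N.+1 x = htrunc N x + hinj (x N).
Proof.
apply: hsum_ext => k; rewrite /= /htrunc_fun ltnS leq_eqVlt.
have [->|kN] /= := eqVneq k N; first by rewrite ltnn add0r hinj_at.
by rewrite hinj_out 1?eq_sym// addr0.
Qed.

End htrunc_rec.

Section model.
Variables (R : realType) (E : hilbertType R) (F : nat -> hilbertType R).
Local Notation l2 := (hsum (fun _ : nat => E : normedModType R[i])).
Local Notation J k := (trunc_shift (F k) k.+1).
Local Notation K := (hsum (fun k : nat => copies k.+1 (F k))).
Local Notation V := (hsum2 (hardy E) K).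
Local Notation T := (hsum2_map (mulz E) (hsum_map (fun k : nat => J k))).
Local Notation cE := (@complete_rnorm R E).

Local Notation V2 b := (if b return normedModType R[i] then hardy E else K).
Let T2 : forall b : bool, lin_contraction (V2 b) :=
  fun b => if b return lin_contraction (V2 b) then mulz E else hsum_map (fun k : nat => J k).

Definition hardy_part : summand T (mulz E) := hsum_summand T2 true.
Definition copies_sum : summand T (hsum_map (fun k : nat => J k)) := hsum_summand T2 false.
Definition copies_part k : summand T (J k) :=
  summand_comp copies_sum (hsum_summand (fun k : nat => J k) k).

Lemma hsum2_split (v : V) :
  v = inj hardy_part (pr hardy_part v) + inj copies_sum (pr copies_sum v).
Proof.
apply: hsum_ext => -[] /=.
  by rewrite hinj_at hinj_out// addr0.
by rewrite hinj_at hinj_out// add0r.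
Qed.

Section forward.
Variable M : set V.
Hypotheses (cM : closed_subspace M) (hM : hyperinvariant T M).

Lemma M_lin c x y : M x -> M y -> M (c *: x + y).
Proof. by case: cM => _ _; apply. Qed.

Lemma M_add x y : M x -> M y -> M (x + y).
Proof. by move=> Mx My; rewrite -[x]scale1r; exact: M_lin. Qed.

Lemma M_seq (u : nat -> V) l : (forall n, M (u n)) -> u @ \oo --> l -> M l.
Proof. by case: cM => cl _ _; exact: closed_seq. Qed.

Lemma cvg_inj (W : normedModType R[i]) (S : W -> W) (s : summand T S) (u : nat -> W) l :
  u @ \oo --> l -> (fun n => inj s (u n)) @ \oo --> inj s l.
Proof.
move=> ul; apply/cvg_rnormP => e e0; have /cvg_rnormP/(_ e e0)[N h] := ul.
exists N => n Nn; rewrite -injB.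
exact: le_trans (inj_le _ _) (h n Nn).
Qed.

Lemma M_part (W : normedModType R[i]) (S : W -> W) (s : summand T S) v : M v -> M (inj s (pr s v)).
Proof.
move=> Mv; apply: (hyperinvariant_intertwiner s s (A := id) (c := 1) hM) => //.
by move=> w; rewrite mul1r.
Qed.

(** For the converse, a vector is the limit of its truncations, which are finite
sums of its components, and M is closed. *)
Lemma M_parts v : M v <-> M (inj hardy_part (pr hardy_part v)) /\
  forall k, M (inj (copies_part k) (pr (copies_part k) v)).
Proof.
split=> [Mv|[M0 Mk]]; first by split=> [|k]; exact: M_part.
rewrite [v]hsum2_split; apply: M_add => //; set b := pr copies_sum v.
apply: (M_seq (u := fun N => inj copies_sum (htrunc N b))); last first.
  by apply: cvg_inj; exact: htrunc_cvg.
elim=> [|N IH].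
  by rewrite htrunc0 inj0; case: cM.
rewrite htruncS injD; apply: M_add => //.
exact: Mk N.
Qed.

(** Downward induction on d: subtracting from x an element of M with the same d-th
slot leaves a vector whose first d + 1 slots vanish. *)
Lemma M_slots k d :
  (forall l y, (d <= l < k.+1)%N -> exists2 z, M (inj (copies_part k) z) &
     slot z l = y /\ forall n, (n < l)%N -> slot z n = 0) ->
  forall x, (forall n, (n < d)%N -> slot x n = 0) -> M (inj (copies_part k) x).
Proof.
have [r] : exists r, (k.+1 <= d + r)%N by exists k.+1; rewrite leq_addl.
elim: r d => [|r IH] d dr h x x0.
  rewrite (_ : x = 0); first by rewrite inj0; case: cM.
  by apply: slot_ext => n nk; rewrite slot0 x0// (leq_trans nk)// -[d]addn0.
have [dk|kd] := ltnP d k.+1; last first.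
  by apply: (IH d _ h x x0); rewrite (leq_trans kd)// leq_addr.
have [|z Mz [zd z0]] := h d (slot x d); first by rewrite leqnn.
rewrite -[x](subrK z) injD; apply: M_add => //.
apply: (IH d.+1); first by rewrite addSnnS.
  by move=> l y /andP[dl lk]; apply: h; rewrite (ltnW dl).
move=> n; rewrite ltnS leq_eqVlt slotB => /predU1P[->|nd].
  by rewrite zd subrr.
by rewrite x0// z0// subrr.
Qed.

(** The map w to (0, ..., 0, <cf w 0, x0> y, <cf w 1, x0> y, ...), with l - i zeros in
front, intertwines S and J as long as cf turns S into a shift on the slots that
are not cut off; this is where s comes in. It sends w to a vector with first
nonzero slot y, at l. *)
Lemma M_fill (W : normedModType R[i]) (S : W -> W) (sm : summand T S) (G : hilbertType R)
    (cf : W -> nat -> G) k s i w :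
  (forall n, linear (fun w => cf w n)) -> (forall w n, rnorm (cf w n) <= rnorm w) ->
  (forall w n, (n + s < k.+1)%N -> cf (S w) n = if n is n'.+1 then cf w n' else 0) ->
  M (inj sm w) -> cf w i != 0 -> (forall n, (n < i)%N -> cf w n = 0) ->
  forall x, (forall n, (n < i + s)%N -> slot x n = 0) -> M (inj (copies_part k) x).
Proof.
move=> cf_lin cf_le cf_shift Mw wi w0; apply: M_slots => l y /andP[il lk].
(* dual to cf w i, so that the first nonzero slot is exactly y *)
pose x0 := ((rnorm (cf w i) ^+ 2)^-1)%:C *: cf w i.
have wx0 : inner (cf w i) x0 = 1.
  have ne : rnorm (cf w i) ^+ 2 != 0.
    by rewrite expf_neq0//; apply/eqP => /rnorm_eq0/eqP; rewrite (negbTE wi).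
  rewrite innerZr innerxx conjc_real -rmorphM mulVf//.
pose t := (l - i)%N.
pose A v := of_slots k.+1 (fun n => if (n < t)%N then 0 else rank1 x0 y (cf v (n - t)%N)).
have AE v n : (n < k.+1)%N -> slot (A v) n = if (n < t)%N then 0 else rank1 x0 y (cf v (n - t)%N).
  by move=> nk; rewrite of_slotsE nk.
exists (A w); last first.
  split=> [|n nl].
    rewrite AE// ltnNge leq_subr/= subKn; last by rewrite (leq_trans _ il)// leq_addr.
    by rewrite /rank1 wx0 scale1r.
  rewrite AE; last exact: ltn_trans lk.
  case: ltnP => // tn; rewrite w0; last by rewrite /t in tn *; lia.
  exact: lin_zero (rank1_linear x0 y).
rewrite -[w](injK sm).
apply: (hyperinvariant_intertwiner sm (copies_part k) (A := A) (c := \sum_(j < k.+1) (rnorm x0 *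
  rnorm y)) hM) => //.
- move=> c a b; apply: slot_ext => n nk; rewrite slotP !AE//.
  case: ltnP => _; first by rewrite scaler0 addr0.
  by rewrite cf_lin rank1_linear.
- move=> v; apply: le_trans (of_slots_le _ _) _; rewrite mulr_suml; apply: ler_sum => j _.
  case: ltnP => _; first by rewrite rnorm0 !mulr_ge0 ?rnorm_ge0.
  by apply: le_trans (rank1_le _ _ _) _; rewrite ler_wpM2l ?cf_le// mulr_ge0 ?rnorm_ge0.
- by apply: sumr_ge0 => j _; rewrite mulr_ge0 ?rnorm_ge0.
- move=> v; apply: slot_ext => n nk; rewrite slot_shift// AE//.
  case: ltnP => tn.
    case: n nk tn => // n nk tn; rewrite AE ?(ltnW nk)//.
    by rewrite (ltnW tn).
  rewrite cf_shift; last by rewrite /t in tn *; lia.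
  case: n nk tn => [|n] nk tn.
    by rewrite sub0n; exact: lin_zero (rank1_linear x0 y).
  rewrite AE ?(ltnW nk)//; case: ltnP => nt.
    have -> : (n.+1 - t = 0)%N by lia.
    exact: lin_zero (rank1_linear x0 y).
  by rewrite subSn.
Qed.

(** Passing to a longer truncated shift needs a delay of k - j, so that nothing that
J_j cuts off stays visible in J_k. *)
Lemma M_fill_copies j k (w : copies j.+1 (F j)) i :
  M (inj (copies_part j) w) -> slot w i != 0 -> (forall n, (n < i)%N -> slot w n = 0) ->
  forall x : copies k.+1 (F k), (forall n, (n < i + (k - j))%N -> slot x n = 0) ->
  M (inj (copies_part k) x).
Proof.
apply: M_fill => [n c x y|x n|x n nk]; first exact: slotP.
  exact: slot_le.
by apply: slot_shift; lia.
Qed.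

Lemma M_fill_hardy k (f : hardy E) i :
  M (inj hardy_part f) -> taylor f i != 0 -> (forall n, (n < i)%N -> taylor f n = 0) ->
  forall x : copies k.+1 (F k), (forall n, (n < i)%N -> slot x n = 0) ->
  M (inj (copies_part k) x).
Proof.
move=> Mf fi f0 x x0; apply: (M_fill (s := 0%N) (sm := hardy_part) (cf := fun f n => taylor f n) _
  _ _ Mf fi f0).
- by move=> n c g h; rewrite taylorD taylorZ.
- by move=> g n; rewrite rnorm_hardy rnorm_coord.
- by move=> g n _; rewrite taylor_mulz.
- by move=> n; rewrite addn0; exact: x0.
Qed.

(** d is the first slot that is nonzero on some vector of M, and [M_fill] fills
all slots from there on. *)
Lemma M_copies k : exists d, (d <= k.+1)%N /\
  forall x, M (inj (copies_part k) x) <-> (forall n, (n < d)%N -> slot x n = 0).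
Proof.
pose P i := `[< exists2 x, M (inj (copies_part k) x) & slot x i != 0 >].
have [exP|noP] := pselect (exists i, P i); last first.
  exists k.+1; split=> // x; split=> [Mx n nk|x0].
    apply/eqP/negP => /negP xn; apply: noP; exists n; apply/asboolP; by exists x.
  rewrite (_ : x = 0); first by rewrite inj0; case: cM.
  by apply: slot_ext => n nk; rewrite slot0 x0.
case: (ex_minnP exP) => d /asboolP[w Mw wd] dmin.
have Mlow x : M (inj (copies_part k) x) -> forall n, (n < d)%N -> slot x n = 0.
  move=> Mx n nd; apply/eqP/negP => /negP xn.
  by have := dmin n; rewrite leqNgt nd; move=> /(_ (asboolT (ex_intro2 _ _ x Mx xn))).
exists d; split.
  by rewrite leqNgt; apply/negP => kd; move: wd; rewrite slot_out ?eqxx// ltnW.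
move=> x; split=> [|x0]; first exact: Mlow.
apply: (M_fill_copies Mw wd (Mlow w Mw)) => n; rewrite subnn addn0; exact: x0.
Qed.

Definition depth k : nat := projT1 (cid (M_copies k)).

Lemma depth_le k : (depth k <= k.+1)%N.
Proof. by rewrite /depth; case: cid => d []. Qed.

Lemma depthP k x : M (inj (copies_part k) x) <-> (forall n, (n < depth k)%N -> slot x n = 0).
Proof. by rewrite /depth; case: cid => d []. Qed.

Let nz k := exists e : F k, e != 0.

Lemma fill_depth k i : nz k -> (i < k.+1)%N ->
  (forall x, (forall n, (n < i)%N -> slot x n = 0) -> M (inj (copies_part k) x)) ->
  (depth k <= i)%N.
Proof.
move=> [e e0] ik fill; rewrite leqNgt; apply/negP => id.
pose x := of_slots (G := F k) k.+1 (fun n => if n == i then e else 0).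
have /depthP/(_ i id) : M (inj (copies_part k) x).
  by apply: fill => n ni; rewrite of_slotsE ltn_eqF// if_same.
by rewrite of_slotsE ik eqxx => e0'; rewrite e0' eqxx in e0.
Qed.

(** Filling copies of index k from a vector of index j whose first nonzero slot is at
[depth j]. *)
Lemma depth_lip j k : nz j -> nz k -> (depth k <= depth j + (k - j))%N.
Proof.
move=> [e e0] nk; have dj := depth_le j; have dk := depth_le k.
have [ik|ki] := ltnP (depth j + (k - j)) k.+1; last by lia.
have jj : (depth j < j.+1)%N by lia.
apply: fill_depth => //.
pose w := of_slots (G := F j) j.+1 (fun n => if n == depth j then e else 0).
have wE n : (n < j.+1)%N -> slot w n = if n == depth j then e else 0 by move=> nj; rewrite of_slotsE nj.
have w0 n : (n < depth j)%N -> slot w n = 0 by move=> nd; rewrite wE ?ltn_eqF//; lia.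
apply: (M_fill_copies (w := w)) => //; first exact/depthP.
by rewrite wE// eqxx.
Qed.

Let S : set l2 := [set a | M (inj hardy_part (of_l2 cE a))].

Lemma S_taylor f : S (taylor f) <-> M (inj hardy_part f).
Proof. by rewrite /S /= of_l2_taylor. Qed.

Lemma S_reducing : shift_reducing S.
Proof.
split.
- by change (M (inj hardy_part (of_l2 cE 0))); rewrite (lin_zero (of_l2_linear cE)) inj0; case: cM.
- move=> c a b; rewrite /S /mkset => Ma Mb.
  by rewrite of_l2_linear (inj_linear hardy_part); exact: M_lin.
- move=> u l Su ul; apply: (M_seq Su); apply: cvg_inj.
  apply/cvg_rnormP => e e0; have /cvg_rnormP/(_ e e0)[N h] := ul.
  by exists N => n Nn; rewrite -(lin_sub (of_l2_linear cE)) rnorm_of_l2 h.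
- move=> a Sa; rewrite /S /= (_ : of_l2 cE (zshift 1 a) = mulz E (of_l2 cE a)).
    rewrite -[of_l2 cE a](injK hardy_part).
    apply: (hyperinvariant_intertwiner hardy_part hardy_part (A := mulz E) (c := 1) hM) => //.
      exact: contraction_linear.
    by move=> w; rewrite mul1r le_rnorm contraction_le.
  apply: eq_taylor; apply: hsum_ext => n; rewrite taylor_of_l2 taylor_mulz taylor_of_l2 zshiftE.
  by case: n => // n; rewrite subn1.
- move=> x y a Sa; rewrite /S /= -[a in coef_rank1 _ _ a](taylor_of_l2 cE) -[of_l2 cE a](injK hardy_part).
  apply: (hyperinvariant_intertwiner hardy_part hardy_part (A := fun f => of_l2 cE (coef_rank1 x y
    (taylor f))) (c := rnorm x * rnorm y) hM) => //.
  + by move=> c f g; rewrite linearP/= coef_rank1_linear of_l2_linear.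
  + by move=> f; rewrite rnorm_of_l2 rnorm_hardy; exact: rnorm_coef_rank1.
  + by rewrite mulr_ge0 ?rnorm_ge0.
  + move=> f; apply: eq_taylor; apply: hsum_ext => n.
    rewrite taylor_of_l2 taylor_mulz taylor_of_l2 coef_rank1E taylor_mulz.
    by case: n => // ; exact: lin_zero (rank1_linear x y).
Qed.

Lemma hyperinvariant_form : exists n : nat -> nat,
    [/\ forall k, (n k <= k.+1)%N,
        forall k, (n k <= n k.+1 <= (n k).+1)%N &
        M = hsum2_set [set 0]
              (hsum_set (fun k => nullspace (iter (n k) (trunc_shift (F k) k.+1))))
        \/
        exists u : disc R -> R[i]^o,
          [/\ inner_function u,
              forall k, zpow_hardy (k.+1 - n k) u &
              M = hsum2_set (mul_hardy u)
                    (hsum_set (fun k =>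
                       nullspace (iter (n k) (trunc_shift (F k) k.+1))))]].
Proof.
have [d [dle dlip dE dmax]] := lipschitz_extension (N := nz) (fun l _ => depth_le l) depth_lip.
(* d interpolates the depths over the indices k with F k = 0 *)
pose n k := (k.+1 - d k)%N.
have nd k : (k.+1 - n k)%N = d k by rewrite /n subKn.
exists n.
have nle k : (n k <= k.+1)%N by rewrite leq_subr.
have Mk k x : M (inj (copies_part k) x) <-> nullspace (iter (n k) (J k)) x.
  rewrite (nullspace_slots _ (nle k)) nd.
  have [nk|zk] := pselect (nz k); first by rewrite dE//; exact: depthP.
  have x0 i : slot x i = 0 by apply/eqP/negP => /negP xi; apply: zk; exists (slot x i).
  by split=> // _; apply/depthP.
have MS (A : set (hardy E)) : (forall f, S (taylor f) <-> A f) ->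
    M = hsum2_set A (hsum_set (fun k => nullspace (iter (n k) (J k)))).
  move=> SA; apply/seteqP; split=> v.
    move=> /M_parts[/S_taylor/SA v0 vk] [] //= k.
    by apply/Mk; exact: vk.
  move=> vA; apply/M_parts; split=> [|k]; first by apply/S_taylor/SA; exact: (vA true).
  by apply/Mk; exact: (vA false).
split=> //.
  by move=> k; have := dlip k; have := dle k; have := dle k.+1; rewrite /n; lia.
have [exS|noS] := pselect (exists2 a, S a & a != 0); last first.
  left; apply: MS => f; split=> [Sf|->].
    apply: taylor_inj; apply/eqP/negP => /negP f0; apply: noS; by exists (taylor f).
  by apply/S_taylor; rewrite inj0; case: cM.
right; have [u [usq uiso uS]] := beurling S_reducing exS.
have [e e1] : exists e : E, rnorm e = 1.
  have [a _ a0] := exS.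
  have [k ak] : exists k, a k != 0.
    apply: contrapT => h; move: a0; rewrite (_ : a = 0) ?eqxx//.
    by apply: hsum_ext => k; apply/eqP/negP => /negP ak; apply: h; exists k.
  have ne : rnorm (a k) != 0 by apply/eqP => /rnorm_eq0/eqP; rewrite (negbTE ak).
  exists ((rnorm (a k))^-1%:C *: a k).
  by rewrite rnormZR ger0_norm ?invr_ge0 ?rnorm_ge0// mulVf.
have u1 k : rnorm (u k : R[i]^o) <= 1.
  apply: sqr_leW => //; rewrite rnorm_sqE expr1n; apply: le_trans (partial_sq_le usq k.+1).
  by rewrite big_ord_recr/= lerDr sumr_ge0// => i _; rewrite addr_ge0 ?sqr_ge0.
have exU (z : disc R) : exists l : R[i]^o, power_series (E := R[i]^o) u (val z) @ \oo --> l.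
  exact: (pser_cvg (@complete_complex R) (valP z) u1).
pose U (z : disc R) : R[i]^o := projT1 (cid (exU z)).
have uU (z : disc R) : power_series (E := R[i]^o) u (val z) @ \oo --> U z by rewrite /U; case: cid.
have U1 := isometric_symbol_le1 uU e1 uiso.
exists U; split.
- split; first by exists u.
    by exists 1 => z; exact: U1.
  exact: fatou_inner usq uU U1.
- move=> k; rewrite nd; apply: (symbol_zpow uU usq) => i id.
  (* otherwise the first nonzero coefficient of u would fill the slots below
   depth l, for some l with F l nonzero *)
  have [l nl il] := dmax k i id.
  apply/eqP/negP => /negP ui.
  have exu : exists i, u i != 0 by exists i.
  case: (ex_minnP exu) => m um mmin.
  have mi := mmin i ui.
  have ml : (m < l.+1)%N by have := depth_le l; lia.
  suff : (depth l <= m)%N by lia.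
  apply: fill_depth => //.
  have [f fE _] := uiso (@hinj _ _ (fun _ : nat => E : normedModType R[i]) 0%N e).
  have fu j : f j = u j *: e.
    rewrite fE /cauchy_prod big_ord_recr/= subnn hinj_at big1 ?add0r// => t _.
    rewrite hinj_out ?scaler0//; have := ltn_ord t; lia.
  have Sf : S f by apply/uS; exists (@hinj _ _ (fun _ : nat => E : normedModType R[i]) 0%N e).
  have e0 : e != 0 by apply/eqP => e0; move/eqP: e1; rewrite e0 rnorm0 eq_sym oner_eq0.
  apply: (M_fill_hardy (f := of_l2 cE f)) => //.
    by rewrite taylor_of_l2 fu scaler_eq0 negb_or um.
  move=> j jm; rewrite taylor_of_l2 fu; case: (eqVneq (u j) 0) => [->|uj]; first by rewrite scale0r.
  by have := mmin j uj; lia.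
- apply: MS => f; rewrite uS; split=> [[g gE]|[h hE]].
    exists (of_l2 cE g); apply/(mul_hardyE _ _ uU) => j.
    by rewrite taylor_of_l2.
  by exists (taylor h); apply/(mul_hardyE _ _ uU).
Qed.

End forward.

Section backward.
Variables (X : {linear V -> V}) (c : R).
Hypotheses (c0 : 0 <= c) (Xc : forall x, rnorm (X x) <= c * rnorm x)
  (XT : forall x, X (T x) = T (X x)).

Lemma X_iter d x : X (iter d T x) = iter d T (X x).
Proof. by elim: d => //= d IH; rewrite XT IH. Qed.

Lemma mulz_iter_inj d (f : hardy E) : iter d (mulz E) f = 0 -> f = 0.
Proof.
move=> f0; apply: taylor_inj; apply: hsum_ext => n.
have := taylor_iter_mulz d f (n + d)%N.
by rewrite f0 ltnNge leq_addl/= addnK linear0 => <-.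
Qed.

(** T is nilpotent on each summand of b and multiplication by z is injective on H^2,
so X maps each summand into the kernel of the projection to H^2; the rest is
continuity. *)
Lemma pr_X_copies b : pr hardy_part (X (inj copies_sum b)) = 0.
Proof.
pose L a := pr hardy_part (X (inj copies_sum a)).
have linL : linear L by move=> a x y; rewrite /L inj_linear linearP pr_linear.
have Lh k (x : copies k.+1 (F k)) : L (hinj x) = 0.
  apply: (@mulz_iter_inj k.+1); rewrite /L -pr_iter -X_iter.
  rewrite -[inj copies_sum _]/(inj (copies_part k) x) inj_iter iter_trunc_shift0//.
  by rewrite inj0 linear0; exact: pr0.
have Lt N : L (htrunc N b) = 0.
  elim: N => [|N IH]; first by rewrite htrunc0; exact: lin_zero linL.
  by rewrite htruncS (lin_add linL) IH add0r; exact: Lh.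
apply: rnorm_eq0; apply/eqP; rewrite eq_le rnorm_ge0 andbT.
apply/ler_addgt0Pl => e e0; rewrite addr0.
have c1 : 0 < c + 1 by rewrite ltr_wpDl.
have e1 : 0 < e / (c + 1) by rewrite divr_gt0.
have /cvg_rnormP/(_ _ e1)[N /(_ N (leqnn N)) h] := htrunc_cvg b.
rewrite -/(L b) -[L b]subr0 -(Lt N) -(lin_sub linL).
apply: le_trans (pr_le _ _) _; apply: le_trans (Xc _) _.
apply: (@le_trans _ _ (c * (e / (c + 1)))).
  by rewrite ler_wpM2l// (le_trans (inj_le _ _) h).
by rewrite mulrCA ger_pMr// ler_pdivrMr// mul1r lerDl.
Qed.

Lemma pr_X_mul (U : disc R -> R[i]^o) v : analytic U ->
  mul_hardy U (pr hardy_part v) -> mul_hardy U (pr hardy_part (X v)).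
Proof.
move=> aU [h hE].
pose B f := pr hardy_part (X (inj hardy_part f)).
have linB : linear B by move=> a x y; rewrite /B inj_linear linearP pr_linear.
pose B' : {linear hardy E -> hardy E} := HB.pack_for {linear hardy E -> hardy E} B
  (GRing.isLinear.Build R[i] (hardy E) (hardy E) *:%R B linB).
have BT f : B' (mulz E f) = mulz E (B' f).
  by rewrite /= /B -inj_commute XT pr_commute.
exists (B' h) => z.
rewrite -(commute_mul_hardy BT aU hE z) [v in LHS]hsum2_split linearD prD.
by rewrite pr_X_copies addr0.
Qed.

Lemma pr_X_zero v : pr hardy_part v = 0 -> pr hardy_part (X v) = 0.
Proof.
move=> v0; rewrite [v]hsum2_split v0 inj0 add0r.
exact: pr_X_copies.
Qed.

Variable n : nat -> nat.
Hypotheses (nle : forall k, (n k <= k.+1)%N)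
  (nstep : forall k, (n k <= n k.+1 <= (n k).+1)%N).

Lemma n_mono j k : (j <= k)%N -> (n j <= n k <= n j + (k - j))%N.
Proof.
elim: k => [|k IH]; first by rewrite leqn0 => /eqP ->; rewrite leqnn leq_addr.
rewrite leq_eqVlt => /predU1P[->|]; first by rewrite leqnn leq_addr.
rewrite ltnS => jk; have := IH jk; have := nstep k; lia.
Qed.

(** With d = k + 1 - n k, the Hardy component is divisible by z^d, and so is each
component j > k by J_j^d; the components j <= k are killed by J_j^(n k). Hence
T^(n k) v = T^(k+1) y, where y is the backward shift of v by d. Since X commutes
with T and J_k^(k+1) = 0, this gives the claim. *)
Lemma pr_X_copies_part v k :
  (forall m, (m < k.+1 - n k)%N -> taylor (pr hardy_part v) m = 0) ->
  (forall j, nullspace (iter (n j) (J j)) (pr (copies_part j) v)) ->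
  nullspace (iter (n k) (J k)) (pr (copies_part k) (X v)).
Proof.
move=> v0 vj; pose d := (k.+1 - n k)%N.
have [g gE] := iter_mulz_ex cE v0.
pose b : K := hsum_map (fun j => back_shift (F j) j.+1 d) (pr copies_sum v).
pose y := inj hardy_part g + inj copies_sum b.
have y0 : pr hardy_part y = g.
  by rewrite /y prD injK /= hinj_out// addr0.
have yj j : pr (copies_part j) y = back_shift (F j) j.+1 d (pr (copies_part j) v).
  rewrite /y prD.
  rewrite /= hinj_out// add0r.
  by rewrite hinj_at.
have Tnv : iter (n k) T v = iter k.+1 T y.
  have e0 : pr hardy_part (iter (n k) T v) = pr hardy_part (iter k.+1 T y).
    by rewrite !pr_iter y0 gE -iterD subnKC.
  have ej j : pr (copies_part j) (iter (n k) T v) = pr (copies_part j) (iter k.+1 T y).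
    rewrite !pr_iter yj; have vn := vj j.
    have [jk|kj] := leqP j k.
      have /andP[njk _] := n_mono jk.
      rewrite [iter k.+1 _ _]iter_trunc_shift0 1?ltnS//.
      have -> : n k = (n k - n j + n j)%N by rewrite subnK.
      rewrite iterD (vn : iter _ _ _ = 0).
      by elim: (_ - _)%N => //= r ->; exact: lin_zero (contraction_linear (J j)).
    have /andP[_ nkj] := n_mono (ltnW kj).
    have -> : k.+1 = (n k + d)%N by rewrite subnKC.
    rewrite iterD back_shiftK// => i id.
    apply: (proj1 (nullspace_slots _ (nle j)) vn); rewrite /d in id; lia.
  apply: hsum_ext => -[]; first exact: e0.
  apply: hsum_ext => j; exact: ej j.
change (iter (n k) (J k) (pr (copies_part k) (X v)) = 0).
by rewrite -pr_iter -X_iter Tnv X_iter pr_iter iter_trunc_shift0.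
Qed.

End backward.

Lemma form_hyperinvariant (M : set V) n (A : set (hardy E)) :
  (forall k, (n k <= k.+1)%N) -> (forall k, (n k <= n k.+1 <= (n k).+1)%N) ->
  (A = [set 0] \/ exists2 u : disc R -> R[i]^o, analytic u &
     (forall k, zpow_hardy (k.+1 - n k) u) /\ A = mul_hardy u) ->
  hyperinvariant T (hsum2_set A
    (hsum_set (fun k => nullspace (iter (n k) (trunc_shift (F k) k.+1))))).
Proof.
move=> nle nstep hA X [c Xc] XT v Mv.
have Xc' x : rnorm (X x) <= Num.max c 0 * rnorm x.
  apply: (@le_trans _ _ (c * rnorm x)).
    by rewrite -lecR rmorphM -!rnormE.
  by rewrite ler_wpM2r ?rnorm_ge0// le_max lexx.
have c0 : 0 <= Num.max c 0 by rewrite le_max lexx orbT.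
have v0 : A (pr hardy_part v) := Mv true.
have vj j : nullspace (iter (n j) (J j)) (pr (copies_part j) v) := Mv false j.
have part k : nullspace (iter (n k) (J k)) (pr (copies_part k) (X v)).
  apply: pr_X_copies_part => // m mk.
  case: hA => [A0|[u _ [uz Au]]].
    by move: v0; rewrite A0 => ->; rewrite linear0.
  move: v0; rewrite Au => -[h hE].
  exact: zpow_taylor (uz k) hE m mk.
case=> [|k]; last exact: part.
case: hA => [A0|[u au [_ Au]]]; rewrite /= ?A0 ?Au.
  by apply: (pr_X_zero c0 Xc' XT); move: v0; rewrite A0.
by apply: (pr_X_mul c0 Xc' XT) => //; move: v0; rewrite Au.
Qed.

End model.

(* [F k] is the space $\mathcal{E}_{k+1}$ and [n k] is $n_{k+1}$, for k >= 0. *)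
Theorem theorem5p7 (R : realType) (E : hilbertType R)
    (F : nat -> hilbertType R)
    (E_separable : separable_space E)
    (F_separable : forall k, separable_space (F k))
    (M : set (hsum2 (hardy E) (hsum (fun k : nat => copies k.+1 (F k)))))
    (M_closed : closed_subspace M) :
  hyperinvariant
    (hsum2_map (mulz E) (hsum_map (fun k : nat => trunc_shift (F k) k.+1))) M
  <->
  exists n : nat -> nat,
    [/\ forall k, (n k <= k.+1)%N,
        forall k, (n k <= n k.+1 <= (n k).+1)%N &
        M = hsum2_set [set 0]
              (hsum_set (fun k => nullspace (iter (n k) (trunc_shift (F k) k.+1))))
        \/
        exists u : disc R -> R[i]^o,
          [/\ inner_function u,
              forall k, zpow_hardy (k.+1 - n k) u &
              M = hsum2_set (mul_hardy u)
                    (hsum_set (fun k =>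
                       nullspace (iter (n k) (trunc_shift (F k) k.+1))))]].
Proof.
split=> [|[n [nle nstep [->|[u [[au _ _] uz ->]]]]]].
- exact: hyperinvariant_form.
- by apply: form_hyperinvariant => //; left.
- by apply: form_hyperinvariant => //; right; exists u.
Qed.
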